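(* Let $V$ be a $\mathbb Z_2$-graded complex vector space of superdimension $(m|n)$, let $\Lambda$ be the infinite-dimensional Grassmann algebra, and let $U=V\otimes_{\mathbb C}\Lambda$. Let $s\in\mathbb N$, let $t_i,b_i$ ($1\le i\le s$) be non-negative integers, and let $W=\bigoplus_{i=1}^s U_{b_i}^{t_i}$. Then the graded picture invariants $\varphi_\sigma$ (for all $s$-tuples $(m_1,\dots,m_s)$ of non-negative integers with $\sum_k m_kt_k=\sum_k m_kb_k=:N$ and all $\sigma\in\mathfrak S_N$) span the invariant subalgebra $S(W^* )^{\operatorname{GL}(U)}$ over $\Lambda$.
   Context: **Setting.** $\Lambda=\varinjlim\Lambda(k)$ is the complex Grassmann (exterior) algebra on countably many generators, with its $\mathbb Z_2$-grading. It is supercommutative, so one-sided $\Lambda$-modules are bimodules. $V=V_0\oplus V_1$ has a basis $e_1,\dots,e_{m+n}$, with the first $m$ vectors even and the last $n$ odd, and dual basis $e_1^*,\dots,e_{m+n}^*$. These are also regarded as $\Lambda$-bases of $U=V\otimes_{\mathbb C}\Lambda$ and $U^*=\operatorname{Hom}_\Lambda(U,\Lambda)$. All tensor products of $\Lambda$-modules are over $\Lambda$. $|x|$ denotes the parity of a homogeneous element $x$. **Group and modules.** $\operatorname{GL}(U)$ is the group of invertible elements of the even part $\operatorname{End}_\Lambda(U)_0$. It acts on $U$, on $U^*$ by $(g.f)(v)=f(g^{-1}v)$, diagonally on $U_b^t:=U^{\otimes b}\otimes (U^* )^{\otimes t}$, on $W=\bigoplus_{i=1}^s U_{b_i}^{t_i}$,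 on $W^*$, and diagonally on each $T^r(W^* )=(W^* )^{\otimes r}$ (with $T^0(W^* )=\Lambda$). **Supersymmetric algebra.** $S(W^* )=T(W^* )/I(W^* )$, where $I(W^* )$ is the two-sided ideal generated by $u\otimes v-(-1)^{|u||v|}v\otimes u$ for homogeneous $u,v\in W^*$. The $\operatorname{GL}(U)$-action on $T(W^* )$ descends to $S(W^* )$. For $1\le i\le s$, $T(i)_{l_1\cdots l_{b_i}}^{u_1\cdots u_{t_i}}\in (U_{b_i}^{t_i})^*\subset W^*$ denotes the element of the dual basis which is $1$ on $e_{l_1}\otimes\cdots\otimes e_{l_{b_i}}\otimes e_{u_1}^*\otimes\cdots\otimes e_{u_{t_i}}^*$ and $0$ on all other standard basis vectors of $U_{b_i}^{t_i}$ (and $0$ on the other summands of $W$). Its parity is that of this basis vector. $S(W^* )$ is the algebra over $\Lambda$ of polynomials in these supercommuting variables. **Graded picture invariants.** Let $(m_1,\dots,m_s)$ be non-negative integers with $\sum_k m_kt_k=\sum_k m_kb_k=N$, and let $\sigma\in\mathfrak S_N$. For $1\le i\le s$, $1\le j\le m_i$ put $B(i,j)=\sum_{p<i}m_pb_p+(j-1)b_i$ and $C(i,j)=\sum_{p<i}m_pt_p+(j-1)t_i$. Then $$\varphi_\sigma=\sum_{r_1,\dots,r_N\in\{1,\dots,m+n\}}\gamma\,(-1)^{q}\prod_{i=1}^s\prod_{j=1}^{m_i}T(i)_{r_{\sigma(B(i,j)+1)}\cdots r_{\sigma(B(i,j)+b_i)}}^{r_{C(i,j)+1}\cdots r_{C(i,j)+t_i}}\in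 S(W^* ),$$ where the product is taken in the order $(1,1),\dots,(1,m_1),(2,1),\dots,(s,m_s)$. With $a_k$ denoting the parity of $e_{r_k}$, $$\gamma=\prod_{\substack{1\le k<l\le N\\ \sigma(k)>\sigma(l)}}(-1)^{a_{\sigma(k)}a_{\sigma(l)}},$$ $$q=\sum_{i=1}^s\sum_{j=1}^{m_i}\Big(\sum_{l=1}^{b_i}a_{\sigma(B(i,j)+l)}\Big)\Big(\sum_{k=1}^{C(i,j)}a_k\Big)+\sum_{k=1}^Na_k+\sum_{1\le k<l\le N}a_ka_l+\sum_{(i,j)<(i',j')}d_{i,j}\,d_{i',j'},$$ where $d_{i,j}=\sum_{l=1}^{b_i}a_{\sigma(B(i,j)+l)}+\sum_{k=1}^{t_i}a_{C(i,j)+k}$ and $(i,j)<(i',j')$ refers to the order above. *)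

(* Defs.v *)
From HB Require Import structures.
From mathcomp Require Import all_boot all_order all_algebra perm.
From mathcomp Require Import finmap boolp reals complex.
From mathcomp.multinomials Require Import monalg.

Set Implicit Arguments.
Unset Strict Implicit.
Unset Printing Implicit Defensive.

Import GRing.Theory.
Local Open Scope ring_scope.
Local Open Scope quotient_scope.

Lemma mul5 (R : pzRingType) (s a y b t : R) :
  s * (a * y * b) * t = (s * a) * y * (b * t).
Proof. by rewrite !mulrA. Qed.

Section Convolution.
Variables (M : choiceType) (R : nzRingType) (op : M -> M -> M).
Variable c : M -> M -> R -> R -> R.

Definition conv (x y : {malg R[M]}) : {malg R[M]} :=
  \sum_(A <- msupp x) \sum_(B <- msupp y) << c A B x@_A y@_B *g op A B >>.

Hypothesis cDl : forall A B b, {morph (c A B)^~ b : a a' / a + a'}.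
Hypothesis cDr : forall A B a, {morph c A B a : b b' / b + b'}.

Lemma conv_c0l A B b : c A B 0 b = 0.
Proof. by apply: (addrI (c A B 0 b)); rewrite -cDl !addr0. Qed.

Lemma conv_c0r A B a : c A B a 0 = 0.
Proof. by apply: (addrI (c A B a 0)); rewrite -cDr !addr0. Qed.

Lemma convEw (d1 d2 : {fset M}) x y :
  (msupp x `<=` d1)%fset -> (msupp y `<=` d2)%fset ->
  conv x y = \sum_(A <- d1) \sum_(B <- d2) << c A B x@_A y@_B *g op A B >>.
Proof.
move=> le1 le2; rewrite /conv (big_fset_incl _ le1) /=.
  apply: eq_bigr => A _; apply: big_fset_incl => // B _ /mcoeff_outdom ->.
  by rewrite conv_c0r monalgU0.
move=> A _ /mcoeff_outdom xA.
by rewrite big1 // => B _; rewrite xA conv_c0l monalgU0.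
Qed.

Lemma convDl : left_distributive conv +%R.
Proof.
move=> x y z.
pose d := (msupp x `|` msupp y)%fset.
have sz : (msupp z `<=` msupp z)%fset by exact: fsubset_refl.
have sx : (msupp x `<=` d)%fset by exact: fsubsetUl.
have sy : (msupp y `<=` d)%fset by exact: fsubsetUr.
have sxy : (msupp (x + y) `<=` d)%fset by exact: msuppD_le.
rewrite (convEw sxy sz) (convEw sx sz) (convEw sy sz) -big_split /=.
apply: eq_bigr => A _; rewrite -big_split /=; apply: eq_bigr => B _.
by rewrite mcoeffD cDl monalgUD.
Qed.

Lemma convDr : right_distributive conv +%R.
Proof.
move=> z x y.
pose d := (msupp x `|` msupp y)%fset.
have sz : (msupp z `<=` msupp z)%fset by exact: fsubset_refl.
have sx : (msupp x `<=` d)%fset by exact: fsubsetUl.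
have sy : (msupp y `<=` d)%fset by exact: fsubsetUr.
have sxy : (msupp (x + y) `<=` d)%fset by exact: msuppD_le.
rewrite (convEw sz sxy) (convEw sz sx) (convEw sz sy) -big_split /=.
apply: eq_bigr => A _; rewrite -big_split /=; apply: eq_bigr => B _.
by rewrite mcoeffD cDr monalgUD.
Qed.

Lemma conv0l : left_zero 0 conv.
Proof. by move=> x; apply: (addrI (conv 0 x)); rewrite -convDl !addr0. Qed.

Lemma conv0r : right_zero 0 conv.
Proof. by move=> x; apply: (addrI (conv x 0)); rewrite -convDr !addr0. Qed.

Lemma convUU A B a b :
  conv << a *g A >> << b *g B >> = << c A B a b *g op A B >>.
Proof. by rewrite (convEw msuppU_le msuppU_le) !big_seq_fset1 !mcoeffUU. Qed.

Lemma conv_suml (I : Type) (r : seq I) (F : I -> {malg R[M]}) y :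
  conv (\sum_(i <- r) F i) y = \sum_(i <- r) conv (F i) y.
Proof.
exact: (big_morph (conv^~ y) (fun a b => convDl a b y) (conv0l y)).
Qed.

Lemma conv_sumr (I : Type) (r : seq I) (F : I -> {malg R[M]}) y :
  conv y (\sum_(i <- r) F i) = \sum_(i <- r) conv y (F i).
Proof.
exact: (big_morph (conv y) (fun a b => convDr y a b) (conv0r y)).
Qed.

Lemma convA : associative op ->
  (forall A B C a b d,
     c A (op B C) a (c B C b d) = c (op A B) C (c A B a b) d) ->
  associative conv.
Proof.
move=> opA cA x y z.
rewrite (monalgE x) (monalgE y) (monalgE z).
set X := msupp x; set Y := msupp y; set Z := msupp z.
transitivity (\sum_(A <- X) \sum_(B <- Y) \sum_(C <- Z)
  conv << x@_A *g A >> (conv << y@_B *g B >> << z@_C *g C >>)).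
  rewrite conv_suml; apply: eq_bigr => A _.
  rewrite conv_suml conv_sumr; apply: eq_bigr => B _.
  by rewrite !conv_sumr.
rewrite !conv_suml; apply: eq_bigr => A _.
rewrite [conv _ (\sum_(k <- Y) _)]conv_sumr conv_suml; apply: eq_bigr => B _; rewrite conv_sumr.
by apply: eq_bigr => C _; rewrite !convUU opA cA.
Qed.

Lemma conv1l e : left_id e op -> (forall A b, c e A 1 b = b) ->
  left_id << e >> conv.
Proof.
move=> e1 c1 x; rewrite [in LHS](monalgE x) conv_sumr [RHS]monalgE.
by apply: eq_bigr => A _; rewrite convUU e1 c1.
Qed.

Lemma conv1r e : right_id e op -> (forall A a, c A e a 1 = a) ->
  right_id << e >> conv.
Proof.
move=> e1 c1 x; rewrite [in LHS](monalgE x) conv_suml [RHS]monalgE.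
by apply: eq_bigr => A _; rewrite convUU e1 c1.
Qed.

Lemma convZl k : (forall A B a b, c A B (k * a) b = k * c A B a b) ->
  forall x y, conv (k *: x) y = k *: conv x y.
Proof.
move=> ck x y; rewrite (convEw (msuppZ_le _ _) (fsubset_refl _)) scaler_sumr.
apply: eq_bigr => A _; rewrite scaler_sumr; apply: eq_bigr => B _.
by rewrite mcoeffZ ck; apply/malgP => C; rewrite mcoeffZ !mcoeffU mulrnAr.
Qed.

End Convolution.

(* On generators theta_0, theta_1, ... : << 1 *g A >> is the product, in  *)
(* increasing order, of the theta_a with a \in A, and ninv A B counts the *)
(* transpositions which sort the product of << 1 *g A >> and << 1 *g B >>. *)

Section Grassmann.
Variable K : fieldType.
Implicit Types A B C : {fset nat}.

Definition ninv A B : nat := (\sum_(a <- A) \sum_(b <- B) (b < a))%N.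

Definition gsign A B : K :=
  if [disjoint A & B]%fset then (-1) ^+ ninv A B else 0.

Definition grassmann : Type := {malg K[{fset nat}]}.
HB.instance Definition _ := GRing.Lmodule.on grassmann.

Definition gcoef A B (a b : K) : K := a * b * gsign A B.
(* locked so that conversion never unfolds products *)
Fact gmul_key : unit. Proof. exact: tt. Qed.
Definition gmul : grassmann -> grassmann -> grassmann :=
  locked_with gmul_key (conv fsetU gcoef).
Local Canonical gmul_unlockable := [unlockable of gmul].

Lemma gcoefDl A B b : {morph (gcoef A B)^~ b : a a' / a + a'}.
Proof. by move=> a a'; rewrite /gcoef !mulrDl. Qed.

Lemma gcoefDr A B a : {morph gcoef A B a : b b' / b + b'}.
Proof. by move=> b b'; rewrite /gcoef !mulrDr mulrDl. Qed.

Lemma big_disjU A B (F : nat -> nat) : [disjoint A & B]%fset ->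
  (\sum_(i <- (A `|` B)%fset) F i = \sum_(i <- A) F i + \sum_(i <- B) F i)%N.
Proof.
move=> dAB; rewrite -big_cat /=; apply: perm_big.
apply: uniq_perm; first exact: fset_uniq.
  rewrite cat_uniq !fset_uniq andbT /=; apply/hasPn => x xB.
  by apply/negP => xA; move/fdisjointP: dAB => /(_ x xA); rewrite xB.
by move=> x; rewrite mem_cat in_fsetU.
Qed.

Lemma card_disjU A B : [disjoint A & B]%fset ->
  #|` (A `|` B)%fset| = (#|` A| + #|` B|)%N.
Proof. by move=> dAB; rewrite -!sum1_size big_disjU. Qed.

Lemma ninvUl A B C : [disjoint A & B]%fset ->
  ninv (A `|` B)%fset C = (ninv A C + ninv B C)%N.
Proof. exact: big_disjU. Qed.

Lemma ninvUr A B C : [disjoint B & C]%fset ->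
  ninv A (B `|` C)%fset = (ninv A B + ninv A C)%N.
Proof.
by move=> dBC; rewrite -big_split; apply: eq_bigr => a _; rewrite big_disjU.
Qed.

Lemma ninvC A B : [disjoint A & B]%fset ->
  (ninv A B + ninv B A = #|` A| * #|` B|)%N.
Proof.
move=> dAB; rewrite /ninv [X in (_ + X)%N]exchange_big -big_split /=.
rewrite -(sum1_size A) -(sum1_size B) big_distrlr /=.
rewrite big_seq [RHS]big_seq; apply: eq_bigr => a aA.
rewrite -big_split /=.
rewrite big_seq [RHS]big_seq; apply: eq_bigr => b bB.
have: a != b by apply: contraTneq aA => ->; apply/negP => bA;
  move/fdisjointP: dAB => /(_ b bA); rewrite bB.
by case: ltngtP.
Qed.

Lemma gsignA A B C :
  gsign B C * gsign A (B `|` C)%fset = gsign A B * gsign (A `|` B)%fset C.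
Proof.
rewrite /gsign fdisjointUX fdisjointXU.
have [dBC|] := boolP [disjoint B & C]%fset; last first.
  by rewrite andbF mul0r mulr0.
have [dAB|] /= := boolP [disjoint A & B]%fset; last by rewrite mul0r mulr0.
rewrite andbT; case: ifP => dAC; last by rewrite !mulr0.
by rewrite ninvUl // ninvUr // -!exprD addnCA addnA addnC addnCA addnA addnC.
Qed.

Lemma gsignC A B : gsign A B = (-1) ^+ (#|` A| * #|` B|) * gsign B A.
Proof.
rewrite /gsign [[disjoint B & A]%fset]fdisjoint_sym.
case: ifP => dAB; last by rewrite mulr0.
rewrite -(ninvC dAB) exprD -mulrA -exprD addnn.
by rewrite -mul2n exprM sqrrN expr1n expr1n mulr1.
Qed.

Lemma gmulA : associative gmul.
Proof.
rewrite [gmul]unlock; apply: convA; [exact: gcoefDl|exact: gcoefDr|exact: fsetUA|].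
move=> A B C a b d; rewrite /gcoef -!mulrA; congr (_ * (_ * _)).
by rewrite gsignA !mulrA [d * _]mulrC.
Qed.

Lemma gsign0l A : gsign fset0 A = 1.
Proof. by rewrite /gsign fdisjoint0X /ninv big_seq_fset0. Qed.

Lemma gsign0r A : gsign A fset0 = 1.
Proof.
rewrite /gsign fdisjointX0 /ninv big1 // => a _; exact: big_seq_fset0.
Qed.

Lemma gmul1l : left_id (<< fset0 >> : grassmann) gmul.
Proof.
rewrite [gmul]unlock; apply: conv1l; [exact: gcoefDl|exact: gcoefDr|exact: fset0U|].
by move=> A b; rewrite /gcoef gsign0l mul1r mulr1.
Qed.

Lemma gmul1r : right_id (<< fset0 >> : grassmann) gmul.
Proof.
rewrite [gmul]unlock; apply: conv1r; [exact: gcoefDl|exact: gcoefDr|exact: fsetU0|].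
by move=> A b; rewrite /gcoef gsign0r !mulr1.
Qed.

Lemma gmulDl : left_distributive gmul +%R.
Proof. rewrite [gmul]unlock; exact: (convDl _ gcoefDl gcoefDr). Qed.

Lemma gmulDr : right_distributive gmul +%R.
Proof. rewrite [gmul]unlock; exact: (convDr _ gcoefDl gcoefDr). Qed.

Lemma gone_neq0 : (<< fset0 >> : grassmann) != 0.
Proof. by rewrite monalgU_eq0 oner_eq0. Qed.

HB.instance Definition _ := GRing.Zmodule_isNzRing.Build grassmann
  gmulA gmul1l gmul1r gmulDl gmulDr gone_neq0.

Lemma gmulE (x y : grassmann) (d1 d2 : {fset {fset nat}}) :
  (msupp x `<=` d1)%fset -> (msupp y `<=` d2)%fset ->
  x * y = \sum_(A <- d1) \sum_(B <- d2)
            << x@_A * y@_B * gsign A B *g (A `|` B)%fset >>.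
Proof.
move=> le1 le2; transitivity (gmul x y); first by [].
rewrite [gmul]unlock; exact: (convEw (@fsetU nat) gcoefDl gcoefDr le1 le2).
Qed.

(* 0 is homogeneous of both parities *)
Definition ghomog (p : bool) (x : grassmann) : Prop :=
  forall A, x@_A != 0 -> odd #|` A| = p.

(* sgnc p x = (-1)^(p |x|) x, extended additively: the sign picked up    *)
(* when x moves past something of parity p                              *)
Fact sgnc_key : unit. Proof. exact: tt. Qed.
Definition sgnc (p : bool) : grassmann -> grassmann :=
  locked_with sgnc_key (fun x : grassmann =>
    \sum_(A <- msupp x) << (-1) ^+ (p && odd #|` A|) * x@_A *g A >>).
Local Canonical sgnc_unlockable p := [unlockable of sgnc p].

Lemma sgncE p (x : grassmann) A : (sgnc p x)@_A = (-1) ^+ (p && odd #|` A|) * x@_A.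
Proof.
rewrite [sgnc p]unlock raddf_sum /= [in RHS](monalgE x) raddf_sum mulr_sumr /=.
apply: eq_bigr => B _; rewrite !mcoeffU.
by case: eqP => [->|_] //; rewrite mulr0.
Qed.

Lemma sgnc_supp p x : (msupp (sgnc p x) `<=` msupp x)%fset.
Proof.
apply/fsubsetP => A; rewrite -!mcoeff_neq0 sgncE.
by apply: contraNN => /eqP ->; rewrite mulr0.
Qed.

Lemma sgncD p : {morph sgnc p : x y / x + y}.
Proof. by move=> x y; apply/malgP => A; rewrite mcoeffD !sgncE mcoeffD mulrDr. Qed.

Lemma sgnc0 p : sgnc p 0 = 0.
Proof. by apply/malgP => A; rewrite sgncE mcoeff0 mulr0. Qed.

Lemma sgncN p : {morph sgnc p : x / - x}.
Proof. by move=> x; apply/malgP => A; rewrite mcoeffN !sgncE mcoeffN mulrN. Qed.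

Lemma sgnc_false x : sgnc false x = x.
Proof. by apply/malgP => A; rewrite sgncE mul1r. Qed.

Lemma sgncK p q x : sgnc p (sgnc q x) = sgnc (p (+) q) x.
Proof.
apply/malgP => A; rewrite !sgncE mulrA -signr_addb.
by congr (_ ^+ _ * _); case: p; case: q; case: (odd _).
Qed.

Lemma sgncU p A a : sgnc p << a *g A >> = << (-1) ^+ (p && odd #|` A|) * a *g A >>.
Proof.
by apply/malgP => B; rewrite sgncE !mcoeffU; case: eqP => [->|_] //; rewrite mulr0.
Qed.

Lemma sgnc1 p : sgnc p 1 = 1.
Proof. by rewrite sgncU cardfs0 andbF mul1r. Qed.

Lemma sgnc_sum p (I : Type) (r : seq I) (P : pred I) (F : I -> grassmann) :
  sgnc p (\sum_(i <- r | P i) F i) = \sum_(i <- r | P i) sgnc p (F i).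
Proof. exact: (big_morph (sgnc p) (sgncD p) (sgnc0 p)). Qed.

Lemma sgncM p : {morph sgnc p : x y / x * y}.
Proof.
move=> x y; rewrite (gmulE (sgnc_supp p x) (sgnc_supp p y)).
rewrite (gmulE (fsubset_refl _) (fsubset_refl _)) sgnc_sum.
apply: eq_bigr => A _; rewrite sgnc_sum; apply: eq_bigr => B _.
rewrite sgncU !sgncE; congr (<< _ *g _ >>).
rewrite /gsign; case: ifP => dAB; last by rewrite !mulr0.
rewrite (card_disjU dAB) oddD.
have -> : p && (odd #|` A| (+) odd #|` B|)
   = (p && odd #|` A|) (+) (p && odd #|` B|) by case: p.
rewrite signr_addb !mulrA; congr (_ * _); rewrite -!mulrA; congr (_ * _).
by rewrite mulrCA.
Qed.

Lemma ghomog0 p : ghomog p 0.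
Proof. by move=> A; rewrite mcoeff0 eqxx. Qed.

Lemma ghomogD p x y : ghomog p x -> ghomog p y -> ghomog p (x + y).
Proof.
move=> hx hy A; rewrite mcoeffD.
by have [->|/hx//] := eqVneq x@_A 0; rewrite add0r => /hy.
Qed.

Lemma ghomogN p x : ghomog p x -> ghomog p (- x).
Proof. by move=> hx A; rewrite mcoeffN oppr_eq0 => /hx. Qed.

Lemma ghomogU A a : ghomog (odd #|` A|) << a *g A >>.
Proof. by move=> B; rewrite mcoeffU; have [->|_] := eqVneq A B; rewrite // mulr0n eqxx. Qed.

Lemma ghomog1 : ghomog false 1.
Proof. by have := @ghomogU fset0 1; rewrite cardfs0. Qed.

Lemma ghomog_sum p (I : Type) (r : seq I) (P : pred I) (F : I -> grassmann) :
  (forall i, P i -> ghomog p (F i)) -> ghomog p (\sum_(i <- r | P i) F i).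
Proof.
by move=> hF; apply: (big_ind (ghomog p)) => //; [exact: ghomog0|exact: ghomogD].
Qed.

Lemma ghomog_sgnc p q x : ghomog p x -> ghomog p (sgnc q x).
Proof.
by move=> hx A; rewrite sgncE mulf_eq0 signr_eq0 => /hx.
Qed.

Lemma ghomogM p q x y : ghomog p x -> ghomog q y -> ghomog (p (+) q) (x * y).
Proof.
move=> hx hy; rewrite (gmulE (fsubset_refl _) (fsubset_refl _)).
rewrite big_seq; apply: ghomog_sum => A; rewrite -mcoeff_neq0 => /hx <-.
rewrite big_seq; apply: ghomog_sum => B; rewrite -mcoeff_neq0 => /hy <-.
rewrite /gsign; case: ifP => dAB; last by rewrite mulr0 monalgU0; exact: ghomog0.
by rewrite -oddD -(card_disjU dAB); exact: ghomogU.
Qed.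

Lemma gsupercomm p x y : ghomog p x -> x * y = sgnc p y * x.
Proof.
move=> hx; rewrite (gmulE (sgnc_supp p y) (fsubset_refl _)).
rewrite (gmulE (fsubset_refl _) (fsubset_refl _)) exchange_big /=.
apply: eq_bigr => B _; rewrite big_seq [RHS]big_seq; apply: eq_bigr => A.
rewrite -mcoeff_neq0 => /hx hA; rewrite fsetUC sgncE; congr (<< _ *g _ >>).
rewrite gsignC -hA -oddM -signr_odd mulrA; congr (_ * _).
by rewrite mulrC [x@_A * _]mulrC mulrA.
Qed.

End Grassmann.


(* index set of a homogeneous basis, with the parities of its elements *)
Record gset := GSet { gcar :> finType; gpar : gcar -> bool }.

Definition gunit : gset := GSet (fun _ : unit => false).

Definition gprod (X Y : gset) : gset :=
  GSet (fun z : X * Y => gpar z.1 (+) gpar z.2).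

Fixpoint gpow (X : gset) (b : nat) : gset :=
  if b is b'.+1 then gprod X (gpow X b') else gunit.

Definition gsum (s : nat) (X : 'I_s -> gset) : gset :=
  GSet (fun z : {i : 'I_s & X i} => gpar (tagged z)).

Fixpoint gtup (X : gset) (b : nat) : ('I_b -> X) -> gpow X b :=
  match b with
  | 0 => fun=> tt
  | b'.+1 => fun r => (r ord0, gtup (fun k => r (lift ord0 k)))
  end.

Section Super.
Variable K : fieldType.
Local Notation L := (grassmann K).

(* v : fmod X stands for \sum_x (v x) e_x, with |e_x| = gpar x, the      *)
(* coefficients being on the left; e_x a = (sgnc |x| a) e_x, which gives *)
(* the right action rscale and the formula for tens.                     *)
Definition fmod (X : gset) : Type := {ffun X -> L}.
HB.instance Definition _ X := GRing.Zmodule.on (fmod X).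

Definition bas (X : gset) (x : X) : fmod X := [ffun y => (x == y)%:R].

Definition lscale (X : gset) (a : L) (v : fmod X) : fmod X :=
  [ffun x => a * v x].

Definition rscale (X : gset) (v : fmod X) (a : L) : fmod X :=
  [ffun x => v x * sgnc (gpar x) a].

Definition fhomog (X : gset) (p : bool) (v : fmod X) : Prop :=
  forall x, ghomog (p (+) gpar x) (v x).

Definition tens (X Y : gset) (v : fmod X) (w : fmod Y) : fmod (gprod X Y) :=
  [ffun z : gprod X Y => v z.1 * sgnc (gpar z.1) (w z.2)].

Definition lext (X Y : gset) (F : X -> fmod Y) (v : fmod X) : fmod Y :=
  [ffun y => \sum_x v x * F x y].

(* Hom_Lambda(M, Lambda) consists of the right-linear functionals, with   *)
(* (a f)(v) = a f(v). For M = fmod X it is again identified with fmod X:  *)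
(* f stands for \sum_x (f x) e_x^*, |e_x^*| = gpar x, e_x^*(e_y) = delta, *)
(* and its value at v is ev f v.                                         *)
Definition ev (X : gset) (f v : fmod X) : L :=
  \sum_x f x * sgnc (gpar x) (v x).

(* f |-> f \o h on Hom_Lambda(M, Lambda); see ev_dmap *)
Definition dmap (X : gset) (h : fmod X -> fmod X) (f : fmod X) : fmod X :=
  [ffun x => ev f (h (bas x))].

(* the tensor product of two even endomorphisms; see tmap_tens *)
Definition tmap (X Y : gset) (f : fmod X -> fmod X) (h : fmod Y -> fmod Y) :
    fmod (gprod X Y) -> fmod (gprod X Y) :=
  lext (fun z : gprod X Y => tens (f (bas z.1)) (h (bas z.2))).

Fixpoint powmap (X : gset) (f : fmod X -> fmod X) (b : nat) :
    fmod (gpow X b) -> fmod (gpow X b) :=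
  if b is b'.+1 then tmap f (@powmap X f b') else id.
Arguments powmap {X} f b.

Definition summap (s : nat) (X : 'I_s -> gset)
    (f : forall i, fmod (X i) -> fmod (X i)) (w : fmod (gsum X)) :
    fmod (gsum X) :=
  [ffun z : gsum X =>
     f (tag z) [ffun x => w (Tagged (fun i => gcar (X i)) x)] (tagged z)].

Lemma rscale_tens (X Y : gset) (v : fmod X) (a : L) (w : fmod Y) :
  tens (rscale v a) w = tens v (lscale a w).
Proof. by apply/ffunP => z; rewrite !ffunE sgncM mulrA. Qed.

Lemma evD (X : gset) (f : fmod X) : {morph ev f : v w / v + w}.
Proof.
move=> v w; rewrite /ev -big_split; apply: eq_bigr => x _ /=.
by rewrite ffunE sgncD mulrDr.
Qed.

Lemma ev_rscale (X : gset) (f v : fmod X) a : ev f (rscale v a) = ev f v * a.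
Proof.
rewrite /ev mulr_suml; apply: eq_bigr => x _.
by rewrite ffunE sgncM sgncK addbb sgnc_false mulrA.
Qed.

Lemma ev_bas (X : gset) (f : fmod X) x : ev f (bas x) = f x.
Proof.
rewrite /ev (bigD1 x) //= ffunE eqxx sgnc1 mulr1 big1 ?addr0 // => y yx.
by rewrite ffunE eq_sym (negPf yx) sgnc0 mulr0.
Qed.

Lemma fmodE (X : gset) (v : fmod X) : v = \sum_x rscale (bas x) (sgnc (gpar x) (v x)).
Proof.
apply/ffunP => y; rewrite sum_ffunE (bigD1 y) //= !ffunE eqxx mul1r.
rewrite sgncK addbb sgnc_false big1 ?addr0 // => x xy.
by rewrite !ffunE (negPf xy) mul0r.
Qed.

Lemma ev_onto (X : gset) (F : fmod X -> L) : {morph F : v w / v + w} ->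
  (forall v a, F (rscale v a) = F v * a) -> F =1 ev [ffun x => F (bas x)].
Proof.
move=> FD FZ v.
have F0 : F 0 = 0 by apply: (addrI (F 0)); rewrite -FD !addr0.
rewrite {1}[v]fmodE (big_morph F FD F0) /ev.
by apply: eq_bigr => x _; rewrite FZ ffunE.
Qed.

(* T(M) for M = fmod X: the basis of T^r(M) is the set of words of length *)
(* r in X. (a u)(b v) = a (sgnc |u| b) uv for words u, v.                *)

Definition wpar (X : gset) (u : seq X) : bool := \big[addb/false]_(x <- u) gpar x.

Definition talg (X : gset) : Type := {malg L[seq X]}.
HB.instance Definition _ X := GRing.Lmodule.on (talg X).

Definition tcoef (X : gset) (u v : seq X) (a b : L) : L := a * sgnc (wpar u) b.

Lemma tcoefDl (X : gset) (u v : seq X) b :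
  {morph (tcoef u v)^~ b : a a' / a + a'}.
Proof. by move=> a a'; rewrite /tcoef mulrDl. Qed.

Lemma tcoefDr (X : gset) (u v : seq X) a : {morph tcoef u v a : b b' / b + b'}.
Proof. by move=> b b'; rewrite /tcoef sgncD mulrDr. Qed.

Fact tmul_key : unit. Proof. exact: tt. Qed.
Definition tmul (X : gset) : talg X -> talg X -> talg X :=
  locked_with tmul_key (conv cat (@tcoef X)).
Local Canonical tmul_unlockable X := [unlockable of @tmul X].

Lemma wpar_cat (X : gset) (u v : seq X) : wpar (u ++ v) = wpar u (+) wpar v.
Proof. exact: big_cat. Qed.

Lemma tmulA X : associative (@tmul X).
Proof.
rewrite [@tmul X]unlock; apply: convA; [exact: tcoefDl|exact: tcoefDr|exact: catA|].
by move=> u v w a b d; rewrite /tcoef wpar_cat sgncM sgncK mulrA.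
Qed.

Lemma tmul1l X : left_id (<< [::] >> : talg X) (@tmul X).
Proof.
rewrite [@tmul X]unlock; apply: conv1l; [exact: tcoefDl|exact: tcoefDr|exact: cat0s|].
by move=> u b; rewrite /tcoef /wpar big_nil sgnc_false mul1r.
Qed.

Lemma tmul1r X : right_id (<< [::] >> : talg X) (@tmul X).
Proof.
rewrite [@tmul X]unlock; apply: conv1r; [exact: tcoefDl|exact: tcoefDr|exact: cats0|].
by move=> u b; rewrite /tcoef sgnc1 mulr1.
Qed.

Lemma tmulDl X : left_distributive (@tmul X) +%R.
Proof. rewrite [@tmul X]unlock; exact: (convDl _ (@tcoefDl X) (@tcoefDr X)). Qed.

Lemma tmulDr X : right_distributive (@tmul X) +%R.
Proof. rewrite [@tmul X]unlock; exact: (convDr _ (@tcoefDl X) (@tcoefDr X)). Qed.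

Lemma tone_neq0 X : (<< [::] >> : talg X) != 0.
Proof. by rewrite monalgU_eq0 oner_eq0. Qed.

HB.instance Definition _ X := GRing.Zmodule_isNzRing.Build (talg X)
  (@tmulA X) (@tmul1l X) (@tmul1r X)
  (@tmulDl X) (@tmulDr X) (tone_neq0 X).

Lemma tmulUU (X : gset) (u v : seq X) a b :
  (<< a *g u >> : talg X) * << b *g v >> = << a * sgnc (wpar u) b *g u ++ v >>.
Proof.
transitivity (tmul (<< a *g u >> : talg X) << b *g v >>); first by [].
by rewrite [@tmul X]unlock (convUU cat (@tcoefDl X) (@tcoefDr X)).
Qed.

Lemma tscalerAl (X : gset) a (s t : talg X) : a *: (s * t) = (a *: s) * t.
Proof.
suff: tmul (a *: s) t = a *: tmul s t by move=> <-.
rewrite [@tmul X]unlock.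
apply: (convZl cat (@tcoefDl X) (@tcoefDr X)) => u v b d.
by rewrite /tcoef mulrA.
Qed.

(* M = T^1(M) -> T(M) *)
Definition tin (X : gset) (v : fmod X) : talg X := \sum_x << v x *g [:: x] >>.

(* I(M) *)
Inductive in_sideal (X : gset) : talg X -> Prop :=
| in_sideal0 : in_sideal 0
| in_sidealD s t : in_sideal s -> in_sideal t -> in_sideal (s + t)
| in_sideal_gen (s t : talg X) (p q : bool) (u v : fmod X) :
    fhomog p u -> fhomog q v ->
    in_sideal (s * (tin u * tin v - (-1) ^+ (p && q) * (tin v * tin u)) * t).

Lemma in_sidealM (X : gset) (s t x : talg X) :
  in_sideal x -> in_sideal (s * x * t).
Proof.
elim=> [|y z _ hy _ hz|a b p q u v hu hv].
- by rewrite mulr0 mul0r; exact: in_sideal0.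
- by rewrite mulrDr mulrDl; exact: in_sidealD.
- rewrite mul5; exact: in_sideal_gen.
Qed.

Lemma in_sidealN (X : gset) (x : talg X) : in_sideal x -> in_sideal (- x).
Proof. by move=> hx; have := in_sidealM (-1) 1 hx; rewrite mulN1r mulr1. Qed.

Definition sideal (X : gset) : talg X -> bool := fun t => `[< in_sideal t >].

Lemma sideal_zmod_closed X : zmod_closed (@sideal X).
Proof.
split=> [|x y]; rewrite !unfold_in; first by apply/asboolP; exact: in_sideal0.
move=> /asboolP hx /asboolP hy; apply/asboolP.
by apply: in_sidealD => //; exact: in_sidealN.
Qed.

HB.instance Definition _ X :=
  GRing.isZmodClosed.Build (talg X) (@sideal X) (@sideal_zmod_closed X).

(* S(M) = T(M) / I(M) *)
Definition symalg (X : gset) : Type := 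
  Quotient.quot (GRing.ZmodClosed.clone (talg X) (@sideal X) _).
HB.instance Definition _ X := GRing.Zmodule.on (symalg X).
HB.instance Definition _ X := Quotient.on (symalg X).

Definition spi (X : gset) (t : talg X) : symalg X := \pi_(symalg X) t.

Lemma spiP (X : gset) (s t : talg X) : reflect (spi s = spi t) (sideal (s - t)).
Proof.
rewrite -[sideal _]/((s - t) \in @sideal X) Quotient.idealrBE.
exact: eqP.
Qed.

Lemma spi_surj (X : gset) (x : symalg X) : exists t, x = spi t.
Proof. by exists (repr x); rewrite /spi reprK. Qed.

Lemma spiD (X : gset) : {morph @spi X : s t / s + t}.
Proof. by move=> s t; rewrite /spi; exact: Quotient.pi_add. Qed.

Lemma sideal_mul (X : gset) (s t x : talg X) : sideal x -> sideal (s * x * t).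
Proof. by move=> /asboolP hx; apply/asboolP; exact: in_sidealM. Qed.

Lemma sidealD (X : gset) (s t : talg X) : sideal s -> sideal t -> sideal (s + t).
Proof. by move=> /asboolP hs /asboolP ht; apply/asboolP; exact: in_sidealD. Qed.

Lemma spi_repr (X : gset) (t : talg X) : sideal (repr (spi t) - t).
Proof. by apply/spiP; rewrite /spi reprK. Qed.

Definition smul (X : gset) (x y : symalg X) : symalg X :=
  spi (repr x * repr y).

Definition sscale (X : gset) (a : L) (x : symalg X) : symalg X :=
  spi (a *: repr x).

Lemma smulE (X : gset) (s t : talg X) : smul (spi s) (spi t) = spi (s * t).
Proof.
apply/spiP; set s' := repr _; set t' := repr _.
have -> : s' * t' - s * t = 1 * (s' - s) * t' + s * (t' - t) * 1.
  by rewrite mul1r mulr1 mulrBl mulrBr addrA subrK.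
by apply: sidealD; apply: sideal_mul; exact: spi_repr.
Qed.

Lemma sscaleE (X : gset) a (t : talg X) : sscale a (spi t) = spi (a *: t).
Proof.
apply/spiP; rewrite -scalerBr -[_ - _]mul1r tscalerAl -[_ * _]mulr1.
exact/sideal_mul/spi_repr.
Qed.

Lemma smulA X : associative (@smul X).
Proof.
move=> x y z; have [s ->] := spi_surj x; have [t ->] := spi_surj y.
by have [u ->] := spi_surj z; rewrite !smulE mulrA.
Qed.

Lemma smul1l X : left_id (spi 1) (@smul X).
Proof. by move=> x; have [s ->] := spi_surj x; rewrite smulE mul1r. Qed.

Lemma smul1r X : right_id (spi 1) (@smul X).
Proof. by move=> x; have [s ->] := spi_surj x; rewrite smulE mulr1. Qed.

Lemma smulDl X : left_distributive (@smul X) +%R.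
Proof.
move=> x y z; have [s ->] := spi_surj x; have [t ->] := spi_surj y.
by have [u ->] := spi_surj z; rewrite -spiD !smulE mulrDl spiD.
Qed.

Lemma smulDr X : right_distributive (@smul X) +%R.
Proof.
move=> x y z; have [s ->] := spi_surj x; have [t ->] := spi_surj y.
by have [u ->] := spi_surj z; rewrite -spiD !smulE mulrDr spiD.
Qed.

HB.instance Definition _ X := GRing.Zmodule_isPzRing.Build (symalg X)
  (@smulA X) (@smul1l X) (@smul1r X) (@smulDl X) (@smulDr X).

Lemma spi1 X : spi (1 : talg X) = 1. Proof. by []. Qed.

Lemma spiM X : {morph @spi X : s t / s * t}.
Proof. by move=> s t; rewrite -smulE. Qed.

Lemma sscaleA X a b (x : symalg X) : sscale a (sscale b x) = sscale (a * b) x.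
Proof. by have [s ->] := spi_surj x; rewrite !sscaleE scalerA. Qed.

Lemma sscale1 X : left_id 1 (@sscale X).
Proof. by move=> x; have [s ->] := spi_surj x; rewrite sscaleE scale1r. Qed.

Lemma sscaleDr X : right_distributive (@sscale X) +%R.
Proof.
move=> a x y; have [s ->] := spi_surj x; have [t ->] := spi_surj y.
by rewrite -spiD !sscaleE scalerDr spiD.
Qed.

Lemma sscaleDl X (x : symalg X) : {morph (@sscale X)^~ x : a b / a + b}.
Proof.
by move=> a b; have [s ->] := spi_surj x; rewrite !sscaleE scalerDl spiD.
Qed.

HB.instance Definition _ X := GRing.Zmodule_isLmodule.Build L (symalg X)
  (@sscaleA X) (@sscale1 X) (@sscaleDr X) (@sscaleDl X).

Lemma spiZ X a (t : talg X) : spi (a *: t) = a *: spi t.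
Proof. by rewrite -sscaleE. Qed.


Definition even_endo (X : gset) (f : fmod X -> fmod X) : Prop :=
  [/\ {morph f : v w / v + w},
      forall v a, f (rscale v a) = rscale (f v) a
    & forall p v, fhomog p v -> fhomog p (f v)].

(* T(f) and S(f), for f an even endomorphism of M; see tactM and sactE *)
Definition tact (X : gset) (f : fmod X -> fmod X) (t : talg X) : talg X :=
  \sum_(w <- msupp t) t@_w *: \prod_(x <- w) tin (f (bas x)).

Definition sact (X : gset) (f : fmod X -> fmod X) (x : symalg X) : symalg X :=
  spi (tact f (repr x)).

Lemma bas_homog (X : gset) (x : X) : fhomog (gpar x) (bas x).
Proof.
move=> y; rewrite ffunE; have [->|_] := eqVneq x y; last exact: ghomog0.
by rewrite addbb; exact: ghomog1.
Qed.
Arguments bas_homog {X} x.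

Lemma even_endo_lext (X : gset) (f : fmod X -> fmod X) :
  even_endo f -> forall v, f v = lext (fun x => f (bas x)) v.
Proof.
case=> fD fZ fh v.
have f0 : f 0 = 0 by apply: (addrI (f 0)); rewrite -fD !addr0.
rewrite {1}[v]fmodE (big_morph f fD f0); apply/ffunP => y.
rewrite sum_ffunE [RHS]ffunE; apply: eq_bigr => x _; rewrite fZ ffunE.
have /(_ y) h := fh _ _ (bas_homog x).
by rewrite (gsupercomm _ h) !sgncK; case: (gpar x); case: (gpar y);
  rewrite /= sgnc_false.
Qed.

Lemma even_endo_of_lext (X : gset) (F : X -> fmod X) :
  (forall x, fhomog (gpar x) (F x)) -> even_endo (lext F).
Proof.
move=> hF; split.
- move=> v w; apply/ffunP => y; rewrite !ffunE -big_split /=.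
  by apply: eq_bigr => x _; rewrite ffunE mulrDl.
- move=> v a; apply/ffunP => y; rewrite !ffunE mulr_suml.
  apply: eq_bigr => x _; rewrite ffunE -!mulrA; congr (_ * _).
  have h : ghomog (gpar x (+) gpar y) (F x y) by exact: hF.
  by rewrite (gsupercomm _ h) sgncK -addbA addbb addbF.
- move=> p v hv y; rewrite ffunE; apply: ghomog_sum => x _.
  have -> : p (+) gpar y = (p (+) gpar x) (+) (gpar x (+) gpar y).
    by rewrite -addbA [gpar x (+) (_ (+) _)]addbA addbb addFb.
  by apply: ghomogM; [exact: hv|exact: hF].
Qed.

Definition thomog (X : gset) (p : bool) (t : talg X) : Prop :=
  forall w, ghomog (p (+) wpar w) t@_w.

Lemma thomogU (X : gset) p (w : seq X) a :
  ghomog (p (+) wpar w) a -> thomog p (<< a *g w >> : talg X).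
Proof.
move=> ha u; rewrite mcoeffU; have [<-|_] := eqVneq w u; first by rewrite mulr1n.
by rewrite mulr0n; exact: ghomog0.
Qed.

Lemma thomog_sum (X : gset) p (I : Type) (r : seq I) (F : I -> talg X) :
  (forall i, thomog p (F i)) -> thomog p (\sum_(i <- r) F i).
Proof.
move=> hF; apply: big_ind => //.
  by move=> w; rewrite mcoeff0; exact: ghomog0.
by move=> s t hs ht w; rewrite mcoeffD; apply: ghomogD.
Qed.

Lemma thomog_tin (X : gset) p (v : fmod X) : fhomog p v -> thomog p (tin v).
Proof.
move=> hv; apply: thomog_sum => x; apply: thomogU.
by rewrite /wpar big_seq1; exact: hv.
Qed.

Lemma talgM_sum (X : gset) (s t : talg X) : s * t =
  \sum_(u <- msupp s) \sum_(v <- msupp t)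
     << s@_u * sgnc (wpar u) t@_v *g u ++ v >>.
Proof.
transitivity (tmul s t); first by [].
by rewrite [@tmul X]unlock.
Qed.

Lemma thomogM (X : gset) p q (s t : talg X) :
  thomog p s -> thomog q t -> thomog (p (+) q) (s * t).
Proof.
move=> hs ht; rewrite talgM_sum; apply: thomog_sum => u.
apply: thomog_sum => v; apply: thomogU; rewrite wpar_cat addbACA.
by apply: ghomogM; [exact: hs|apply: ghomog_sgnc; exact: ht].
Qed.

Lemma thomog_mon (X : gset) (G : X -> fmod X) (w : seq X) :
  (forall x, fhomog (gpar x) (G x)) ->
  thomog (wpar w) (\prod_(x <- w) tin (G x)).
Proof.
move=> hG; elim: w => [|x w IH].
  rewrite big_nil /wpar big_nil; apply: thomogU.
  by rewrite /wpar big_nil; exact: ghomog1.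
by rewrite big_cons /wpar big_cons; apply: thomogM => //; exact: thomog_tin.
Qed.

Lemma thomogC (X : gset) p (t s : talg X) b :
  thomog p t -> t * (b *: s) = sgnc p b *: (t * s).
Proof.
move=> ht; rewrite -[s]mul1r tscalerAl !mulrA mulr1 tscalerAl; congr (_ * _).
have -> : b *: (1 : talg X) = << b *g [::] >>.
  by apply/malgP => w; rewrite mcoeffZ !mcoeffU mulrnAr mulr1.
rewrite [in LHS](monalgE t) mulr_suml [in RHS](monalgE t) scaler_sumr.
apply: eq_bigr => w _; rewrite tmulUU cats0 (gsupercomm _ (ht w)) sgncK.
rewrite -addbA addbb addbF.
by apply/malgP => u; rewrite mcoeffZ !mcoeffU mulrnAr.
Qed.

Section Tact.
Variables (X : gset) (f : fmod X -> fmod X).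
Local Notation mon w := (\prod_(x <- w) tin (f (bas x))).

Lemma tactEw (d : {fset seq X}) (t : talg X) : (msupp t `<=` d)%fset ->
  tact f t = \sum_(w <- d) t@_w *: mon w.
Proof.
move=> le; apply: big_fset_incl => // w _ /mcoeff_outdom ->.
by rewrite scale0r.
Qed.

Lemma tactD : {morph tact f : s t / s + t}.
Proof.
move=> s t; rewrite (tactEw (msuppD_le s t)) (tactEw (fsubsetUl _ (msupp t))).
rewrite (tactEw (fsubsetUr (msupp s) _)) -big_split /=.
by apply: eq_bigr => w _; rewrite mcoeffD scalerDl.
Qed.

Lemma tact0 : tact f 0 = 0.
Proof. by apply: (addrI (tact f 0)); rewrite -tactD !addr0. Qed.

Lemma tactN : {morph tact f : t / - t}.
Proof. by move=> t; apply: (addrI (tact f t)); rewrite -tactD !subrr tact0. Qed.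

Lemma tactU a w : tact f << a *g w >> = a *: mon w.
Proof. by rewrite (tactEw msuppU_le) big_seq_fset1 mcoeffUU. Qed.

Lemma tact_sum (I : Type) (r : seq I) (F : I -> talg X) :
  tact f (\sum_(i <- r) F i) = \sum_(i <- r) tact f (F i).
Proof. exact: (big_morph (tact f) tactD tact0). Qed.

Hypothesis f_even : even_endo f.

Lemma tact_hom x : fhomog (gpar x) (f (bas x)).
Proof. by case: f_even => _ _; apply; exact: bas_homog. Qed.

Lemma tactM : {morph tact f : s t / s * t}.
Proof.
move=> s t; rewrite talgM_sum tact_sum mulr_suml.
apply: eq_bigr => u _; rewrite tact_sum mulr_sumr.
apply: eq_bigr => v _; rewrite tactU big_cat /= -tscalerAl.
by rewrite (thomogC _ _ (@thomog_mon _ _ u tact_hom)) scalerA.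
Qed.

Lemma tact_tin (v : fmod X) : tact f (tin v) = tin (f v).
Proof.
rewrite (even_endo_lext f_even v) /tin tact_sum.
transitivity (\sum_x v x *: tin (f (bas x))).
  by apply: eq_bigr => x _; rewrite tactU big_seq1.
rewrite /tin; under eq_bigr do rewrite scaler_sumr.
rewrite exchange_big /=; apply: eq_bigr => y _; rewrite ffunE raddf_sum /=.
by apply: eq_bigr => x _; apply/malgP => w; rewrite mcoeffZ !mcoeffU mulrnAr.
Qed.

Lemma tact_signM n (t : talg X) : tact f ((-1) ^+ n * t) = (-1) ^+ n * tact f t.
Proof.
by rewrite -signr_odd; case: (odd n); rewrite ?mul1r // !mulN1r tactN.
Qed.

Lemma tact_sideal (t : talg X) : in_sideal t -> in_sideal (tact f t).
Proof.
elim=> [|s {}t _ hs _ ht|a b p q u v hu hv].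
- by rewrite tact0; exact: in_sideal0.
- by rewrite tactD; exact: in_sidealD.
- rewrite !tactM tactD tactN tact_signM !tactM !tact_tin.
  by case: f_even => _ _ fh; apply: in_sideal_gen; exact: fh.
Qed.

Lemma sactE (t : talg X) : sact f (spi t) = spi (tact f t).
Proof.
apply/spiP; rewrite -tactN -tactD; apply/asboolP/tact_sideal/asboolP.
exact: spi_repr.
Qed.

End Tact.

Lemma tens_homog (X Y : gset) p q (v : fmod X) (w : fmod Y) :
  fhomog p v -> fhomog q w -> fhomog (p (+) q) (tens v w).
Proof.
move=> hv hw z; rewrite ffunE /= addbACA.
by apply: ghomogM; [exact: hv|apply: ghomog_sgnc; exact: hw].
Qed.

Lemma even_endo_id X : even_endo (@id (fmod X)).
Proof. by split. Qed.

Lemma even_endo_tmap (X Y : gset) (f : fmod X -> fmod X) (h : fmod Y -> fmod Y) :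
  even_endo f -> even_endo h -> even_endo (tmap f h).
Proof.
move=> [_ _ hf] [_ _ hh]; apply: even_endo_of_lext => z.
by apply: tens_homog; [apply: hf|apply: hh]; exact: bas_homog.
Qed.

Lemma tmap_tens (X Y : gset) (f : fmod X -> fmod X) (h : fmod Y -> fmod Y) v w :
  even_endo f -> even_endo h -> tmap f h (tens v w) = tens (f v) (h w).
Proof.
move=> ef eh; rewrite (even_endo_lext ef v) (even_endo_lext eh w).
apply/ffunP => z; rewrite !ffunE sgnc_sum big_distrlr pair_big /=.
apply: eq_bigr => -[x y] _; rewrite !ffunE /= sgncM.
have h1 : ghomog (gpar x (+) gpar z.1) (f (bas x) z.1).
  by case: ef => _ _; apply; exact: bas_homog.
rewrite -!mulrA; congr (_ * _); rewrite !mulrA; congr (_ * _).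
by rewrite (gsupercomm _ h1) sgncK; case: (gpar x); case: (gpar z.1).
Qed.

Lemma even_endo_powmap (X : gset) (f : fmod X -> fmod X) b :
  even_endo f -> even_endo (powmap f b).
Proof.
move=> ef; elim: b => [|b IH] /=; first exact: even_endo_id.
exact: even_endo_tmap.
Qed.

Lemma even_endo_summap s (X : 'I_s -> gset)
    (f : forall i, fmod (X i) -> fmod (X i)) :
  (forall i, even_endo (f i)) -> even_endo (summap f).
Proof.
move=> ef; split.
- move=> v w; apply/ffunP => -[i x]; have [fD _ _] := ef i.
  rewrite [RHS]ffunE !ffunE /=.
  have -> : [ffun y => (v + w) (Tagged (fun i => gcar (X i)) y)]
      = [ffun y => v (Tagged (fun i => gcar (X i)) y)]
        + [ffun y => w (Tagged (fun i => gcar (X i)) y)] :> fmod (X i).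
    by apply/ffunP => y; rewrite !ffunE.
  by rewrite fD ffunE.
- move=> v a; apply/ffunP => -[i x]; have [_ fZ _] := ef i.
  rewrite [RHS]ffunE !ffunE /=.
  have -> : [ffun y => rscale v a (Tagged (fun i => gcar (X i)) y)]
      = rscale ([ffun y => v (Tagged (fun i => gcar (X i)) y)] : fmod (X i)) a.
    by apply/ffunP => y; rewrite !ffunE.
  by rewrite fZ ffunE.
- move=> p v hv [i x]; rewrite ffunE /=.
  have [_ _ fh] := ef i; apply: fh => y; rewrite ffunE.
  exact: (hv (Tagged (fun i => gcar (X i)) y)).
Qed.

Lemma dmapE (X : gset) (h : fmod X -> fmod X) :
  dmap h =1 lext (fun x => [ffun y => sgnc (gpar x) (h (bas y) x)]).
Proof.
by move=> f; apply/ffunP => y; rewrite !ffunE; apply: eq_bigr => x _; rewrite ffunE.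
Qed.

Lemma even_endo_ext (X : gset) (f h : fmod X -> fmod X) :
  f =1 h -> even_endo h -> even_endo f.
Proof.
move=> e [hD hZ hh]; split=> [v w|v a|p v]; rewrite !e //; exact: hh.
Qed.

Lemma even_endo_dmap (X : gset) (h : fmod X -> fmod X) :
  even_endo h -> even_endo (dmap h).
Proof.
move=> [_ _ hh]; apply: even_endo_ext (dmapE h) _.
apply: even_endo_of_lext => x y; rewrite ffunE; apply: ghomog_sgnc.
by rewrite addbC; apply: hh; exact: bas_homog.
Qed.

Lemma ev_dmap (X : gset) (h : fmod X -> fmod X) f v :
  even_endo h -> ev (dmap h f) v = ev f (h v).
Proof.
move=> eh; have [hD hZ _] := eh.
rewrite [RHS](@ev_onto X (fun w => ev f (h w))) //.
- by move=> u w; rewrite hD evD.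
- by move=> u a; rewrite hZ ev_rscale.
Qed.


Section GL.
Variables m n : nat.

Definition gV : gset := GSet (fun i : 'I_(m + n) => m <= i)%N.

Record GL := MkGL {
  gl_fun :> fmod gV -> fmod gV;
  gl_inv : fmod gV -> fmod gV;
  gl_even : even_endo gl_fun;
  gl_inv_even : even_endo gl_inv;
  gl_funK : cancel gl_fun gl_inv;
  gl_invK : cancel gl_inv gl_fun
}.

Definition gl_V (g : GL) : GL :=
  MkGL (gl_inv_even g) (gl_even g) (gl_invK g) (gl_funK g).

(* U = fmod gV, U_b^t = fmod (gUbt b t) and W = fmod gW *)
Definition gUbt (b t : nat) : gset := gprod (gpow gV b) (gpow gV t).

Definition Uact (g : GL) (b t : nat) : fmod (gUbt b t) -> fmod (gUbt b t) :=
  tmap (powmap g b) (powmap (dmap (gl_V g)) t).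

Variables (s : nat) (b t : 'I_s -> nat).

Definition gW : gset := gsum (fun i => gUbt (b i) (t i)).

Definition Wact (g : GL) : fmod gW -> fmod gW :=
  summap (fun i => @Uact g (b i) (t i)).

(* (g.f)(w) = f(g^-1 w) on the dual of W *)
Definition Wdact (g : GL) : fmod gW -> fmod gW := dmap (Wact (gl_V g)).

Definition SWact (g : GL) : symalg gW -> symalg gW := sact (Wdact g).

Lemma Wdact_even g : even_endo (Wdact g).
Proof.
apply/even_endo_dmap/even_endo_summap => i; apply: even_endo_tmap.
  exact/even_endo_powmap/gl_even.
exact/even_endo_powmap/even_endo_dmap/gl_even.
Qed.

Lemma SWactE g (x : talg gW) : SWact g (spi x) = spi (tact (Wdact g) x).
Proof. exact/sactE/Wdact_even. Qed.

(* B(i, j) for c = b and C(i, j) for c = t; i, j and the positions in a    *)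
(* tuple are numbered from 0                                              *)
Definition offset (mu c : 'I_s -> nat) (i : 'I_s) (j : nat) : nat :=
  (\sum_(p < s | p < i) mu p * c p + j * c i)%N.

Lemma offset_lt (mu c : 'I_s -> nat) (i : 'I_s) (j : 'I_(mu i)) (l : 'I_(c i)) :
  (offset mu c i j + l < \sum_p mu p * c p)%N.
Proof.
have lt1 : (j * c i + l < mu i * c i)%N.
  apply: leq_trans (_ : (j.+1 * c i <= _)%N); last by rewrite leq_mul2r ltn_ord orbT.
  by rewrite mulSn addnC ltn_add2r.
rewrite /offset -addnA.
apply: leq_trans (_ : (\sum_(p < s | p < i) mu p * c p + mu i * c i <= _)%N).
  by rewrite ltn_add2l.
rewrite [X in (_ <= X)%N](bigID (fun p : 'I_s => p < i)%N) /= leq_add2l.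
by rewrite [X in (_ <= X)%N](bigD1 i) ?ltnn //= leq_addr.
Qed.

Definition pos (mu c : 'I_s -> nat) (i : 'I_s) (j : 'I_(mu i)) (l : 'I_(c i)) :
    'I_(\sum_p mu p * c p) := Ordinal (offset_lt j l).

Record picture := Picture {
  pmul : 'I_s -> nat;
  pbal : (\sum_p pmul p * t p = \sum_p pmul p * b p)%N;
  pperm : 'S_(\sum_p pmul p * b p)
}.

Section Phi.
Variable P : picture.
Local Notation mu := (pmul P).
Local Notation sigma := (pperm P).
Local Notation N := (\sum_p pmul P p * b p)%N.

(* the variable T(i)_l^u *)
Definition Tvar (i : 'I_s) (l : 'I_(b i) -> gV) (u : 'I_(t i) -> gV) :
    symalg gW :=
  spi (tin (bas (Tagged (fun i => gcar (gUbt (b i) (t i)))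
                        (gtup l, gtup u) : gW))).

(* sigma(B(i, j) + l) and C(i, j) + k *)
Definition lower (i : 'I_s) (j : 'I_(mu i)) (l : 'I_(b i)) : 'I_N :=
  sigma (pos j l).
Definition upper (i : 'I_s) (j : 'I_(mu i)) (k : 'I_(t i)) : 'I_N :=
  cast_ord (pbal P) (pos j k).

Section Signs.
Variable a : 'I_N -> nat.

Definition gamma : L :=
  \prod_(k < N) \prod_(l < N | (k < l)%N && (sigma l < sigma k)%N)
    (-1) ^+ (a (sigma k) * a (sigma l)).

Definition dpar (i : 'I_s) (j : 'I_(mu i)) : nat :=
  (\sum_(l < b i) a (lower j l) + \sum_(k < t i) a (upper j k))%N.

Definition qexp : nat :=
  (\sum_(i < s) \sum_(j < mu i)
      (\sum_(l < b i) a (lower j l)) * (\sum_(k < N | k < offset mu t i j) a k)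
   + \sum_(k < N) a k
   + \sum_(k < N) \sum_(l < N | k < l) a k * a l
   + \sum_(i < s) \sum_(j < mu i) \sum_(i' < s)
       \sum_(j' < mu i' | (i < i') || (i == i') && (j < j')) dpar j * dpar j')%N.

End Signs.

Definition phi : symalg gW :=
  \sum_(r : {ffun 'I_N -> gV})
    let a k : nat := gpar (r k) in
    (gamma a * (-1) ^+ qexp a) *:
      \prod_(i < s) \prod_(j < mu i)
        Tvar (fun l => r (lower j l)) (fun k => r (upper j k)).

End Phi.
End GL.
End Super.

(* Main.v *)
Require Import Defs.
From mathcomp Require Import all_boot all_order all_algebra perm.
From mathcomp Require Import finmap boolp reals complex.
From mathcomp.multinomials Require Import monalg.

(* A degree d element of S(W^* ) is recovered, up to d!, from the multilinear *)
(* part of its values at sums of d even vectors of W, and it is enough to     *)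
(* know this part on decomposable tensors of even vectors of U and U^*: all   *)
(* vectors being even, no sign occurs.  An invariant thus becomes a           *)
(* multilinear form G(u, f) in even vectors u_k of U and f_k of U^* such that *)
(* G(gu, gf) = G(u, f).  Scalars g show that G = 0 unless there are as many   *)
(* u as f, say N.  For g = 1 + \sum_j n_j v_j (x) phi_j, invertible as soon   *)
(* as the products of two coordinates of v_j vanish, the coefficient of       *)
(* \prod_j n_j in this identity is                                            *)
(*   \sum_s G(v_s, f) \prod_k <phi_(s k), u_k>                                *)
(*     = \sum_s G(u, phi_s) \prod_k <f_k, v_(s k)>.                           *)
(* Combining the coefficients in (u, phi) so that \sum_s on the left acts as  *)
(* the identity on tensors writes G(v, f) as a combination of the             *)
(* \prod_k <f_k, v_(s k)>; such a combination exists because A A^T and A have *)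
(* the same column space for a rational matrix A.  The sign of phi_sigma is   *)
(* the one which makes it the element with multilinear form                   *)
(* \prod_k <f_k, u_(sigma^-1 k)>; this also shows that it is invariant.       *)

Set Implicit Arguments.
Unset Strict Implicit.
Unset Printing Implicit Defensive.

Import Order.TTheory GRing.Theory Num.Theory.
Local Open Scope ring_scope.

(** * Signs of reordered products *)

(** Elements of the supersymmetric algebra are studied through their values at even vectors
    ([seval]). At an even vector the coordinates supercommute exactly as the variables do, so
    evaluation is well defined on the quotient, and the group action becomes substitution
    ([seval_sact]). In characteristic zero the values at sums of vectors recover the symmetrized
    multilinear form of each degree component ([polarize]). Since [grassmann] always has generators
    not occurring in a given element, a form vanishing at enough even vectors has zero coefficients
    ([mform_eq0], [bform_eq0]). Sorting the factors by the summands of W they come from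
    ([tag_part_slots]) and inserting decomposable tensors turns every component into a form in even
    vectors u of U and even covectors f ([slot_form], [slot_formE]). Hence an element is zero as
    soon as it vanishes at all sums of decomposable vectors ([seval_separation]). The signs of a
    picture are those for which its form is the product of the pairings of f_k with u at the inverse
    permutation of k ([phi_eval]). Such a product does not change when g acts on vectors and
    covectors together, whence [phi_invariant]. Conversely, an invariant gives invariant forms G(u,
    f). Scalars kill the unbalanced ones ([invariant_form_unbalanced]). In the balanced case, G is
    tested on the unipotent elements of [gl_unipotent]; the multilinear part of its invariance
    ([invariant_form_exchange]) equates a combination of the forms G(v_s, f), v being permuted by s,
    with a combination of products of pairings of f with v. The weights on the left are built from
    matrix coefficients of permutations acting on tensors. A Gram matrix argument
    ([gram_functional]) combines these identities so that the left side becomes G(v, f) itself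
    ([invariant_form_span]). Comparison of coefficients then writes the invariant as a combination
    of pictures ([invariant_in_span]). *)

Definition scomm (R : pzRingType) (p q : nat) (x y : R) : Prop :=
  x * y = (-1) ^+ (p * q) * (y * x).

Section Supercommute.
Variable R : pzRingType.
Implicit Types (x y z : R) (p q : nat).

Lemma signrM_comm n x : x * (-1) ^+ n = (-1) ^+ n * x.
Proof. by rewrite -signr_odd; case: (odd n); rewrite ?mulr1 ?mul1r // mulrN1 mulN1r. Qed.

Lemma signrMA n x y : x * ((-1) ^+ n * y) = (-1) ^+ n * (x * y).
Proof. by rewrite mulrA signrM_comm mulrA. Qed.

Lemma signrK n x : (-1) ^+ n * ((-1) ^+ n * x) = x.
Proof. by rewrite mulrA -exprD addnn -signr_odd odd_double mul1r. Qed.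

Lemma scomm_sym p q x y : scomm p q x y -> scomm q p y x.
Proof. by rewrite /scomm mulnC => ->; rewrite signrK. Qed.

Lemma scomm1 p x : scomm p 0 x 1.
Proof. by rewrite /scomm muln0 !mul1r mulr1. Qed.

Lemma scommM p q q' x y z : scomm p q x y -> scomm p q' x z ->
  scomm p (q + q') x (y * z).
Proof.
rewrite /scomm => xy xz; rewrite mulrA xy -!mulrA xz signrMA.
by rewrite mulnDr exprD -!mulrA.
Qed.

Lemma scomm_prod (I : Type) (s : seq I) (P : pred I) p (q : I -> nat) x (y : I -> R) :
  (forall i, P i -> scomm p (q i) x (y i)) ->
  scomm p (\sum_(i <- s | P i) q i) x (\prod_(i <- s | P i) y i).
Proof.
move=> xy; elim/big_rec2: _ => [|i z n Pi IH]; first exact: scomm1.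
by apply: scommM => //; exact: xy.
Qed.

End Supercommute.

(** The exponents of the reordering signs are sums over pairs of factors in their order of
    occurrence; the recursion matches induction on the product. *)
Fixpoint cross (J : Type) (f : J -> J -> nat) (s : seq J) : nat :=
  if s is x :: s' then (\sum_(z <- s') f x z + cross f s')%N else 0%N.

Lemma cross_pairwise (J : eqType) (lt : rel J) f (s : seq J) :
  irreflexive lt -> (forall x y, lt x y -> ~~ lt y x) -> pairwise lt s ->
  cross f s = (\sum_(x <- s) \sum_(z <- s | lt x z) f x z)%N.
Proof.
move=> irr asym; elim: s => [|x s IH] /=; first by rewrite big_nil.
move=> /andP[/allP xs ps]; rewrite big_cons big_cons irr IH //; congr (_ + _)%N.
  by rewrite big_seq [RHS]big_seq_cond; apply: eq_bigl => z; case zs: (z \in s);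
    rewrite //= xs.
rewrite big_seq [RHS]big_seq; apply: eq_bigr => z zs.
by rewrite big_cons (negPf (asym _ _ (xs _ zs))).
Qed.

Section SortProduct.
Variables (R : pzRingType) (J : finType) (p : J -> nat) (y : J -> R).
Hypothesis yC : forall i j, scomm (p i) (p j) (y i) (y j).

Definition inversions : seq J -> nat :=
  cross (fun x z => if (index z (index_enum J) < index x (index_enum J))%N
                    then p x * p z else 0)%N.

(** Locates the place at which the factor of index x is inserted into a product taken in the order
    of the enumeration, for [prod_sort]. *)
Lemma enum_split x : exists e1 e2, [/\ index_enum J = e1 ++ x :: e2, x \notin e1 ++ e2,
  {in e1, forall z, index z (index_enum J) < index x (index_enum J)}%N
  & {in e2, forall z, ~~ (index z (index_enum J) < index x (index_enum J))}%N].
Proof.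
have xin : x \in index_enum J by exact: mem_index_enum.
have u := index_enum_uniq J.
move: (index_enum J) xin u => e xe; case/splitPr: e / xe => e1 e2 u.
have x1 : x \notin e1.
  by move: u; rewrite cat_uniq /= => /and3P[_ /norP[]].
have ix : index x (e1 ++ x :: e2) = size e1.
  by rewrite index_cat (negPf x1) /= eqxx addn0.
exists e1, e2; split=> //.
- by move: u; rewrite (perm_uniq (permEl (perm_catCA e1 [:: x] e2))) => /andP[].
- by move=> z z1; rewrite ix index_cat z1 index_mem.
- move=> z z2; rewrite ix index_cat; case: ifP => z1; last by rewrite -leqNgt leq_addr.
  by move: u; rewrite cat_uniq => /and3P[_ /hasPn /(_ z)];
    rewrite inE z2 orbT z1 => /(_ isT).
Qed.

(** Insertion sort: the head [y x], placed before the sorted product of the rest, passes exactly the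
    factors that are enumerated before x. *)
Lemma prod_sort s : uniq s ->
  \prod_(j <- s) y j = (-1) ^+ inversions s * \prod_(j | j \in s) y j.
Proof.
elim: s => [_|x s IH] /=.
  by rewrite big_nil mul1r big_pred0.
rewrite /inversions /= -big_mkcond /= -/(inversions s); move=> /andP[xs us];
  rewrite big_cons IH // signrMA addnC exprD -mulrA.
congr (_ * _).
have [e1 [e2 [eJ]]] := enum_split x; rewrite mem_cat negb_or => /andP[x1 x2] lt1 lt2.
rewrite eJ !big_cat !big_cons (negPf xs) inE eqxx /=.
have ext e : x \notin e ->
    \prod_(j <- e | j \in x :: s) y j = \prod_(j <- e | j \in s) y j.
  move=> xe; rewrite big_seq_cond [RHS]big_seq_cond; apply: eq_bigl => j.
  by rewrite inE; case: (eqVneq j x) => // ->; rewrite (negPf xe).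
rewrite !ext // mulrA [y x * _](_ : _ = (-1) ^+ (p x * \sum_(z <- e1 | z \in s) p z)
   * (\prod_(z <- e1 | z \in s) y z * y x)).
  rewrite -!mulrA; congr ((-1) ^+ _ * _).
  rewrite big_distrr /=;
    transitivity (\sum_(z <- index_enum J | (z \in s) && (index z (index_enum J) <
      index x (index_enum J))%N) p x * p z)%N.
    rewrite {1}eJ big_cat big_cons (negPf xs) /= [X in (_ + X)%N]big_seq_cond.
    rewrite [X in (_ + X)%N]big_pred0 => [|z].
      rewrite addn0 big_seq_cond [RHS]big_seq_cond; apply: eq_bigl => z.
      by case z1: (z \in e1) => //=; rewrite lt1 ?andbT.
    by case z2: (z \in e2) => //=; rewrite (negPf (lt2 z z2)) andbF.
  rewrite -[RHS]big_filter [RHS]big_uniq ?filter_uniq //=.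
  by apply: eq_bigl => z; rewrite mem_filter -eJ andbC.
exact: scomm_prod.
Qed.

Lemma prod_bij (I : finType) (h : I -> J) : bijective h ->
  \prod_i y (h i) = (-1) ^+ inversions (map h (index_enum I)) * \prod_j y j.
Proof.
move=> h_bij; rewrite -(big_map h predT y) prod_sort; last first.
  by rewrite map_inj_uniq ?index_enum_uniq //; exact: bij_inj.
congr (_ * _); apply: eq_bigl => j; case: h_bij => g hK gK.
by rewrite -[j]gK map_f.
Qed.

Lemma prod_rev s : \prod_(j <- rev s) y j =
  (-1) ^+ cross (fun i j => p i * p j)%N s * \prod_(j <- s) y j.
Proof.
elim: s => [|x s IH] /=; first by rewrite !big_nil mul1r.
rewrite rev_cons -cats1 big_cat big_seq1 /= IH big_cons -big_distrr /=.
have /scomm_sym : scomm (p x) (\sum_(j <- s) p j) (y x) (\prod_(j <- s) y j).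
  exact: scomm_prod.
rewrite -mulrA => ->.
by rewrite mulrA -exprD addnC mulnC.
Qed.
End SortProduct.

(** To bring all the x to the front, each [y i] has to pass every later [x j]. *)
Lemma prod_interleave (R : pzRingType) (J : Type) (p q : J -> nat) (x y : J -> R) s :
  (forall i j, scomm (q i) (p j) (y i) (x j)) ->
  \prod_(j <- s) (x j * y j) = (-1) ^+ cross (fun i j => q i * p j)%N s *
    (\prod_(j <- s) x j * \prod_(j <- s) y j).
Proof.
move=> xy; elim: s => [|j s IH] /=; first by rewrite !big_nil !mul1r.
rewrite !big_cons IH -big_distrr /= addnC exprD -!mulrA 2!signrMA; congr (_ * _).
have e : scomm (q j) (\sum_(i <- s) p i) (y j) (\prod_(i <- s) x i).
  exact: scomm_prod.
by rewrite [y j * (_ * _)]mulrA [y j * _]e -!mulrA signrMA.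
Qed.

Lemma index_enum_ordE n (i : 'I_n) : index i (index_enum 'I_n) = i.
Proof. by rewrite [index_enum _]unlock -enumT index_enum_ord. Qed.

Lemma pairwise_index_enum_ord n :
  pairwise (fun i j : 'I_n => (i < j)%N) (index_enum 'I_n).
Proof.
rewrite [index_enum _]unlock -enumT -(pairwise_map val ltn) val_enum_ord.
by rewrite -sorted_pairwise ?iota_ltn_sorted //; exact: ltn_trans.
Qed.

Lemma cross_ord n f :
  cross f (index_enum 'I_n) = (\sum_(i < n) \sum_(j < n | i < j) f i j)%N.
Proof.
apply: cross_pairwise (pairwise_index_enum_ord n) => [i|i j] /=.
  exact: ltnn.
by rewrite -leqNgt; exact: ltnW.
Qed.

Lemma cross_map (I J : Type) (h : I -> J) f s :
  cross f (map h s) = cross (fun x z => f (h x) (h z)) s.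
Proof. by elim: s => //= x s ->; rewrite big_map. Qed.

Lemma inversions_perm n (p : 'I_n -> nat) (sigma : 'S_n) :
  inversions p (map sigma (index_enum 'I_n)) =
  (\sum_(k < n) \sum_(l < n | (k < l) && (sigma l < sigma k)) p (sigma k) * p (sigma
    l))%N.
Proof.
rewrite /inversions cross_map cross_ord; apply: eq_bigr => k _.
by rewrite big_mkcondr; apply: eq_bigr => l _; rewrite !index_enum_ordE.
Qed.

(** * Values of elements of S(M) at even points *)

Section Evaluation.
Variable K : fieldType.
Local Notation L := (grassmann K).
Implicit Types X : gset.

Lemma sgnc_homog p q (y : L) : ghomog q y -> sgnc p y = (-1) ^+ (p && q) * y.
Proof.
move=> hy; apply/malgP => A; rewrite sgncE.
have -> : (-1) ^+ (p && q) * y = (-1) ^+ (p && q) *: y :> L.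
  by case: (p && q); rewrite ?expr0 ?expr1 ?scale1r ?mul1r // scaleN1r mulN1r.
rewrite mcoeffZ; have [->|/hy ->//] := eqVneq y@_A 0.
by rewrite !mulr0.
Qed.

Lemma ghomog_scomm p q (x y : L) : ghomog p x -> ghomog q y -> scomm p q x y.
Proof.
move=> hx hy; rewrite /scomm (gsupercomm y hx) (sgnc_homog p hy) -mulrA.
by rewrite mulnb.
Qed.

Lemma ghomog_evenC (x y : L) : ghomog false x -> x * y = y * x.
Proof. by move=> hx; rewrite (gsupercomm y hx) sgnc_false. Qed.

Lemma ghomog_prod (I : Type) (s : seq I) (P : pred I) (p : I -> bool) (F : I -> L) :
  (forall i, P i -> ghomog (p i) (F i)) ->
  ghomog (\big[addb/false]_(i <- s | P i) p i) (\prod_(i <- s | P i) F i).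
Proof.
by move=> hF; apply: (big_ind2 (fun b x => ghomog b x)) => //;
  [exact: ghomog1|move=> *; exact: ghomogM].
Qed.

Lemma ghomog_prod0 (I : Type) (s : seq I) (P : pred I) (F : I -> L) :
  (forall i, P i -> ghomog false (F i)) -> ghomog false (\prod_(i <- s | P i) F i).
Proof.
move=> hF; apply: (big_ind (fun x : L => ghomog false x)) => //; first exact: ghomog1.
by move=> x y hx hy; exact: (ghomogM hx hy).
Qed.

(* the value of bas x, as an element of the dual, at v: see ev_basl *)
Definition coordf X (v : fmod K X) (x : X) : L := sgnc (gpar x) (v x).

Lemma coordf_homog X (v : fmod K X) x : fhomog false v -> ghomog (gpar x) (coordf v x).
Proof. by move=> hv; apply: ghomog_sgnc; exact: hv. Qed.

Definition teval X (v : fmod K X) (t : talg K X) : L :=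
  \sum_(w <- msupp t) t@_w * \prod_(x <- w) coordf v x.

Lemma tevalEw X (v : fmod K X) (d : {fset seq X}) (t : talg K X) :
  (msupp t `<=` d)%fset -> teval v t = \sum_(w <- d) t@_w * \prod_(x <- w) coordf v x.
Proof.
by move=> le; apply: big_fset_incl => // w _ /mcoeff_outdom ->; rewrite mul0r.
Qed.

Lemma tevalD X (v : fmod K X) : {morph teval v : s t / s + t}.
Proof.
move=> s t; rewrite (tevalEw v (msuppD_le s t)) (tevalEw v (fsubsetUl _ (msupp t))).
rewrite (tevalEw v (fsubsetUr (msupp s) _)) -big_split /=.
by apply: eq_bigr => w _; rewrite mcoeffD mulrDl.
Qed.

Lemma teval0 X (v : fmod K X) : teval v 0 = 0.
Proof. by apply: (addrI (teval v 0)); rewrite -tevalD !addr0. Qed.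

Lemma tevalN X (v : fmod K X) : {morph teval v : t / - t}.
Proof. by move=> t; apply: (addrI (teval v t)); rewrite -tevalD !subrr teval0. Qed.

Lemma tevalU X (v : fmod K X) a w :
  teval v << a *g w >> = a * \prod_(x <- w) coordf v x.
Proof. by rewrite (tevalEw v msuppU_le) big_seq_fset1 mcoeffUU. Qed.

Lemma teval_sum X (v : fmod K X) (I : Type) (r : seq I) (F : I -> talg K X) :
  teval v (\sum_(i <- r) F i) = \sum_(i <- r) teval v (F i).
Proof. exact: (big_morph (teval v) (tevalD v) (teval0 v)). Qed.

Lemma tevalZ X (v : fmod K X) a t : teval v (a *: t) = a * teval v t.
Proof.
rewrite (tevalEw v (msuppZ_le _ _)) mulr_sumr; apply: eq_bigr => w _.
by rewrite mcoeffZ mulrA.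
Qed.

Lemma teval_tin X (v f : fmod K X) : teval v (tin f) = ev f v.
Proof. by rewrite teval_sum; apply: eq_bigr => x _; rewrite tevalU big_seq1. Qed.

Lemma ev_homog X p q (f v : fmod K X) : fhomog p f -> fhomog q v -> ghomog (p (+) q)
  (ev f v).
Proof.
move=> hf hv; apply: ghomog_sum => x _.
have -> : p (+) q = (p (+) gpar x) (+) (q (+) gpar x).
  by rewrite addbACA addbb addbF.
by apply: ghomogM; [exact: hf|apply: ghomog_sgnc; exact: hv].
Qed.

Section Even.
Variables (X : gset) (v : fmod K X).
Hypothesis hv : fhomog false v.

Lemma tevalM : {morph teval v : s t / s * t}.
Proof.
move=> s t; rewrite talgM_sum teval_sum mulr_suml.
apply: eq_bigr => u _; rewrite teval_sum mulr_sumr.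
apply: eq_bigr => w _; rewrite tevalU big_cat /= -!mulrA; congr (_ * _).
have h : ghomog (wpar u) (\prod_(x <- u) coordf v x).
  by apply: ghomog_prod => x _; exact: coordf_homog.
by rewrite !mulrA (gsupercomm _ h).
Qed.

Lemma teval_signM n t : teval v ((-1) ^+ n * t) = (-1) ^+ n * teval v t.
Proof.
rewrite -signr_odd -[in RHS]signr_odd.
by case: (odd n); rewrite ?mul1r // !mulN1r tevalN.
Qed.

(** A functional of parity p takes a value of parity p at an even v, and [grassmann] is
    supercommutative, so the generators of the ideal evaluate to 0. *)
Lemma teval_sideal t : in_sideal t -> teval v t = 0.
Proof.
have ev_h p (f : fmod K X) : fhomog p f -> ghomog p (ev f v).
  by move=> hf; rewrite -[p]addbF; exact: ev_homog.
elim=> [|s {}t _ hs _ ht|a b p q f g hf hg].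
- exact: teval0.
- by rewrite tevalD hs ht addr0.
- rewrite !tevalM tevalD tevalN teval_signM !tevalM !teval_tin.
  rewrite (ghomog_scomm (ev_h _ _ hf) (ev_h _ _ hg)) mulnb subrr.
  by rewrite mulr0 mul0r.
Qed.

Definition seval (x : symalg K X) : L := teval v (repr x).

Lemma seval_spi t : seval (spi t) = teval v t.
Proof.
apply: subr0_eq; rewrite -tevalN -tevalD; apply/teval_sideal/asboolP.
exact: spi_repr.
Qed.

Lemma sevalD : {morph seval : x y / x + y}.
Proof.
move=> x y; have [s ->] := spi_surj x; have [t ->] := spi_surj y.
by rewrite -spiD !seval_spi tevalD.
Qed.

Lemma seval0 : seval 0 = 0.
Proof. by apply: (addrI (seval 0)); rewrite -sevalD !addr0. Qed.

Lemma sevalM : {morph seval : x y / x * y}.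
Proof.
move=> x y; have [s ->] := spi_surj x; have [t ->] := spi_surj y.
by rewrite -spiM !seval_spi tevalM.
Qed.

Lemma seval1 : seval 1 = 1.
Proof.
by rewrite -spi1 seval_spi -[1]/(<< [::] >> : talg K X) tevalU big_nil mulr1.
Qed.

Lemma sevalZ a x : seval (a *: x) = a * seval x.
Proof. by have [s ->] := spi_surj x; rewrite -spiZ !seval_spi tevalZ. Qed.

Lemma seval_sum (I : Type) (r : seq I) (P : pred I) (F : I -> symalg K X) :
  seval (\sum_(i <- r | P i) F i) = \sum_(i <- r | P i) seval (F i).
Proof. exact: (big_morph seval sevalD seval0). Qed.

Lemma seval_prod (I : Type) (r : seq I) (P : pred I) (F : I -> symalg K X) :
  seval (\prod_(i <- r | P i) F i) = \prod_(i <- r | P i) seval (F i).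
Proof. exact: (big_morph seval sevalM seval1). Qed.

End Even.

Definition svar X (x : X) : symalg K X := spi (tin (bas K x)).

Lemma ev_basl X (v : fmod K X) x : ev (bas K x) v = coordf v x.
Proof.
rewrite /ev (bigD1 x) //= ffunE eqxx mul1r big1 ?addr0 // => y yx.
by rewrite ffunE eq_sym (negPf yx) mul0r.
Qed.

Lemma seval_svar X (v : fmod K X) x : fhomog false v -> seval v (svar x) = coordf v x.
Proof. by move=> hv; rewrite seval_spi // teval_tin ev_basl. Qed.

Lemma tin_bas X (x : X) : tin (bas K x) = << 1 *g [:: x] >>.
Proof.
rewrite /tin (bigD1 x) //= ffunE eqxx big1 ?addr0 // => y yx.
by rewrite ffunE eq_sym (negPf yx) monalgU0.
Qed.

Lemma svar_scomm X (x y : X) : scomm (gpar x) (gpar y) (svar x) (svar y).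
Proof.
rewrite /scomm -!spiM; apply: subr0_eq.
have signM n (t : talg K X) : (-1) ^+ n * spi t = spi ((-1) ^+ n * t).
  have spiN s : spi (- s) = - spi s :> symalg K X.
    apply: (addrI (spi s)); rewrite -spiD !subrr.
    by apply: (addrI (spi 0)); rewrite -spiD !addr0.
  rewrite -signr_odd -[in RHS]signr_odd.
  by case: (odd n); rewrite ?mul1r // !mulN1r spiN.
rewrite signM; apply/eqP; rewrite subr_eq0; apply/eqP/spiP/asboolP.
have := in_sideal_gen 1 1 (@bas_homog K X x) (@bas_homog K X y).
by rewrite mul1r mulr1 mulnb.
Qed.

Lemma spi_word X a (w : seq X) : spi << a *g w >> = a *: \prod_(x <- w) svar x.
Proof.
have -> : << a *g w >> = a *: (<< 1 *g w >> : talg K X).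
  by apply/malgP => u; rewrite mcoeffZ !mcoeffU mulrnAr mulr1.
rewrite spiZ; congr (_ *: _); elim: w => [|x w IH]; first by rewrite big_nil -spi1.
rewrite big_cons -IH -spiM tin_bas tmulUU sgnc1 mulr1.
by [].
Qed.

Lemma spi_sum X (I : Type) (r : seq I) (P : pred I) (F : I -> talg K X) :
  spi (\sum_(i <- r | P i) F i) = \sum_(i <- r | P i) spi (F i).
Proof.
apply: (big_morph (@spi K X) (@spiD K X)).
by apply: (addrI (spi 0)); rewrite -spiD !addr0.
Qed.

(** Evaluation at an even vector is multiplicative, so it suffices to compare generators, where this
    is [ev_dmap]. *)
Lemma seval_sact X (h : fmod K X -> fmod K X) (v : fmod K X) (x : symalg K X) :
  even_endo h -> fhomog false v -> seval v (sact (dmap h) x) = seval (h v) x.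
Proof.
move=> eh hv; have hhv : fhomog false (h v) by case: eh => _ _; apply.
have [t ->] := spi_surj x; rewrite sactE ?seval_spi //; last exact: even_endo_dmap.
rewrite /tact teval_sum [teval (h v) t]/teval; apply: eq_bigr => w _.
rewrite tevalZ; congr (_ * _).
have t1 : teval v 1 = 1.
  by rewrite -[1]/(<< [::] >> : talg K X) tevalU big_nil mulr1.
rewrite (big_morph (teval v) (tevalM hv) t1); apply: eq_bigr => y _.
by rewrite teval_tin ev_dmap // ev_basl.
Qed.

End Evaluation.

(** * Polarization *)

(** A combination of values that reads off the linear coefficient of any polynomial of degree below
    D. The nodes 0, ..., D-1 are distinct in characteristic zero, so their Vandermonde matrix is
    invertible. *)
Lemma vandermonde_functional (K : numFieldType) D : exists alpha : 'I_D -> K,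
  forall e, (e < D)%N -> \sum_n alpha n * (n : nat)%:R ^+ e = (e == 1%N)%:R.
Proof.
pose V := Vandermonde D (\row_(n < D) (n : nat)%:R : 'rV[K]_D).
have Vu : V \in unitmx.
  rewrite unitmxE det_Vandermonde unitfE; apply/prodf_neq0 => i _.
  apply/prodf_neq0 => j ij; rewrite !mxE subr_eq0 eqr_nat.
  by rewrite gtn_eqF.
pose a := invmx V *m \col_(e < D) (e == 1%N :> nat)%:R.
exists (fun n => a n 0) => e eD.
have := mulKVmx Vu (\col_(e < D) (e == 1%N :> nat)%:R : 'cV[K]_D).
move/colP/(_ (Ordinal eD)); rewrite [RHS]mxE /= => <-; rewrite mxE.
by apply: eq_bigr => n _; rewrite !mxE mulrC.
Qed.

Section MultilinearPart.
Variables I J : finType.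

Definition weight (n : J -> nat) (o : option J) : nat := if o is Some j then n j else 1.

(* h selects the monomial \prod_j n j: see weight_prod *)
Definition multilinear (h : {ffun I -> option J}) : bool :=
  [forall j, #|[pred i | h i == Some j]| == 1%N].

Lemma weight_prod n (h : {ffun I -> option J}) :
  (\prod_i weight n (h i) = \prod_j n j ^ #|[pred i | h i == Some j]|)%N.
Proof.
transitivity (\prod_i \prod_j n j ^ (h i == Some j))%N.
  apply: eq_bigr => i _; case: (h i) => [j|] /=; last by rewrite big1.
  rewrite (bigD1 j) //= eqxx expn1 big1 ?muln1 // => k kj.
  by rewrite (inj_eq (@Some_inj _)) eq_sym (negPf kj).
rewrite exchange_big /=; apply: eq_bigr => j _.
rewrite -expn_sum -sum1_card [X in (_ = _ ^ X)%N]big_mkcond; congr (_ ^ _)%N.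
Qed.

Lemma prod_expand (R : pzRingType) (y : I -> option J -> R) n :
  \prod_i (y i None + \sum_j y i (Some j) *+ n j) =
  \sum_(h : {ffun I -> option J}) (\prod_i y i (h i)) *+ \prod_i weight n (h i).
Proof.
transitivity (\prod_i \sum_o y i o *+ weight n o).
  apply: eq_bigr => i _; rewrite [RHS](bigD1 None) //= mulr1n; congr (_ + _).
  rewrite [RHS](reindex_omap Some id) => [|[]//].
  by apply: eq_bigl => j /=; rewrite eqxx.
rewrite bigA_distr_bigA /=; apply: eq_bigr => h _.
elim/big_rec3: _ => [|i a b c _ ->]; first by rewrite mulr1n.
by rewrite /= mulrnAl mulrnAr -mulrnA mulnC.
Qed.

End MultilinearPart.

(** The functional of [vandermonde_functional], applied in each variable [n j] separately on a grid,
    isolates the terms of degree one in every variable. The data depend on J and D only, so one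
    choice serves all degrees at once. *)
Lemma multilinear_part (K : numFieldType) (J : finType) D :
  exists (E : finType) (A : E -> K) (n : E -> J -> nat),
  forall (I : finType) (V : lmodType K) (b : {ffun I -> option J} -> V),
    (#|I| < D)%N ->
    \sum_e A e *: (\sum_h b h *+ \prod_i weight (n e) (h i)) =
    \sum_(h | multilinear h) b h.
Proof.
have [alpha ha] := vandermonde_functional K D.
exists {ffun J -> 'I_D}, (fun e : {ffun J -> 'I_D} => \prod_j alpha (e j)), (fun (e :
  {ffun J -> 'I_D}) j => e j : nat).
move=> I V b ID.
under eq_bigr do rewrite scaler_sumr.
rewrite exchange_big [RHS]big_mkcond /=; apply: eq_bigr => h _.
transitivity ((\prod_j \sum_n alpha n * (n : nat)%:R ^+ #|[pred i | h i == Some j]|) *: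
  b h).
  rewrite bigA_distr_bigA /= scaler_suml; apply: eq_bigr => e _.
  rewrite -scaler_nat scalerA weight_prod natr_prod -big_split /=.
  by congr (_ *: _); apply: eq_bigr => j _; rewrite natrX.
rewrite (eq_bigr (fun j => (#|[pred i | h i == Some j]| == 1%N)%:R)); last first.
  by move=> j _; apply: ha; apply: leq_ltn_trans ID; exact: max_card.
case: ifP => [/forallP hm|/negbT/forallPn[j hj]].
  by rewrite big1 ?scale1r // => j _; rewrite (eqP (hm j)).
by rewrite (bigD1 j) //= (negPf hj) mul0r scale0r.
Qed.

Lemma multilinear_card (I J : finType) (h : {ffun I -> option J}) :
  multilinear h -> #|[pred i | h i != None]| = #|J|.
Proof.
move=> /forallP hm; rewrite -sum1_card -[RHS]sum1_card.
rewrite (eq_bigr (fun i => \sum_(j | h i == Some j) 1)%N); last first.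
  move=> i; rewrite inE; case: (h i) => // j _.
  by rewrite (big_pred1 j) // => k; rewrite (inj_eq (@Some_inj _)) eq_sym.
rewrite (exchange_big_dep xpredT) //=; apply: eq_bigr => j _.
rewrite -[RHS](eqP (hm j)) -sum1_card; apply: eq_bigl => i.
by rewrite !inE; case: (h i).
Qed.

Lemma multilinear_total (I J : finType) (h : {ffun I -> option J}) :
  multilinear h -> #|I| = #|J| <-> forall i, h i != None.
Proof.
move=> hm; have := multilinear_card hm; split=> [IJ i|hS].
  have e : #|[pred i | h i != None]| = #|{: I}| by rewrite IJ.
  by have /(subset_cardP e) /(_ i) := subset_predT [pred i | h i != None]; rewrite !inE.
by rewrite -H; apply: eq_card => i; rewrite !inE hS.
Qed.

Lemma multilinear_perm n (V : nmodType) (b : {ffun 'I_n -> option 'I_n} -> V) :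
  \sum_(h | multilinear h) b h = \sum_(s : 'S_n) b [ffun i => Some (s i)].
Proof.
(* The default i of [odflt] and the default permutation 1 of [insubd] are not met on a multilinear
   h. *)
pose f (h : {ffun 'I_n -> option 'I_n}) := [ffun i => odflt i (h i)].
rewrite (reindex_onto (fun s : 'S_n => [ffun i => Some (s i)]) (fun h => insubd (1%g :
  'S_n) (f h))).
  apply: eq_bigl => s; have -> : f [ffun i => Some (s i)] = val s.
    by apply/ffunP => i; rewrite !ffunE /= -pvalE.
  rewrite valKd eqxx andbT; apply/forallP => j; rewrite -(card1 (s^-1 j)%g).
  apply/eqP/eq_card => i; rewrite !inE ffunE (inj_eq (@Some_inj _)).
  by rewrite -(can2_eq (permK s) (permKV s)).
move=> h hm; have hS := (multilinear_total hm).1 erefl.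
have fi : injectiveb (f h).
  apply/injectiveP => i j; rewrite !ffunE => ij; apply/eqP.
  have hi : h i = Some (odflt i (h i)) by case: (h i) (hS i).
  have hj : h j = Some (odflt i (h i)) by rewrite ij; case: (h j) (hS j).
  move/forallP: hm => /(_ (odflt i (h i))) /card1P[k hk].
  move: (hk i) (hk j); rewrite !inE hi hj /= eqxx.
  by move=> /esym /eqP -> /esym /eqP ->.
apply/ffunP => i; rewrite ffunE -pvalE.
have -> : pval (insubd (1%g : 'S_n) (f h)) = f h by exact: insubdK.
by rewrite ffunE; case: (h i) (hS i).
Qed.

(** * Multilinear forms and reordering of their arguments *)

Section Forms.
Variable K : numFieldType.
Local Notation L := (grassmann K).
Implicit Types X : gset.

Lemma gscalerAl k (x y : L) : k *: (x * y) = (k *: x) * y.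
Proof.
rewrite (gmulE (fsubset_refl _) (fsubset_refl _)) (gmulE (msuppZ_le _ _) (fsubset_refl
  _)).
rewrite scaler_sumr; apply: eq_bigr => A _; rewrite scaler_sumr; apply: eq_bigr => B _.
by apply/malgP => C; rewrite mcoeffZ !mcoeffU mcoeffZ mulrnAr !mulrA.
Qed.

Lemma gscalerAr k (x y : L) : k *: (x * y) = x * (k *: y).
Proof.
rewrite (gmulE (fsubset_refl _) (fsubset_refl _)) (gmulE (fsubset_refl _) (msuppZ_le _
  _)).
rewrite scaler_sumr; apply: eq_bigr => A _; rewrite scaler_sumr; apply: eq_bigr => B _.
by apply/malgP => C; rewrite mcoeffZ !mcoeffU mcoeffZ mulrnAr [_ * (k * _)]mulrCA !mulrA.
Qed.

Lemma signZ X n (x : symalg K X) : ((-1) ^+ n : L) *: x = (-1) ^+ n * x.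
Proof.
rewrite -signr_odd -[in RHS]signr_odd; case: (odd n); rewrite ?scale1r ?mul1r //.
by rewrite scaleN1r mulN1r.
Qed.

(* A multilinear form in the vectors y j, j : J, and the element of S(M) it *)
(* defines when all the y j are the tautological vector.                    *)
Definition mform X (J : finType) (c : {ffun J -> X} -> L) (y : J -> X -> L) : L :=
  \sum_u c u * \prod_j y j (u j).

Definition sform X (J : finType) (c : {ffun J -> X} -> L) : symalg K X :=
  \sum_u c u *: \prod_j svar K (u j).

Definition even_family X (J : Type) (y : J -> X -> L) : Prop :=
  forall j x, ghomog (gpar x) (y j x).

Lemma even_scomm X (J : Type) (y : J -> X -> L) i j x x' : even_family y ->
  scomm (gpar x) (gpar x') (y i x) (y j x').
Proof. by move=> hy; apply: ghomog_scomm. Qed.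

(** Reordering multiplies the product of the variables and the product of the coordinates of an even
    family by the same sign, which is absorbed into the coefficients. The last clause transports the
    vanishing of coefficients and serves [tag_part_slots]. *)
Lemma reform X (J J' : finType) (h : J' -> J) (c : {ffun J -> X} -> L) : bijective h ->
  exists c' : {ffun J' -> X} -> L, [/\ sform c' = sform c,
    forall y, even_family y -> mform c' (fun j => y (h j)) = mform c y
  & forall u : {ffun J -> X}, c u = 0 -> c' [ffun j => u (h j)] = 0].
Proof.
move=> h_bij; have [g hK gK] := h_bij.
pose e (u : {ffun J -> X}) := inversions (fun j => gpar (u j)) (map h (index_enum J')).
pose back (u : {ffun J' -> X}) : {ffun J -> X} := [ffun j => u (g j)].
have backK (u : {ffun J -> X}) : back [ffun j => u (h j)] = u.
  by apply/ffunP => j; rewrite !ffunE gK.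
have re (V : nmodType) (F : {ffun J' -> X} -> V) :
    \sum_u F u = \sum_(u : {ffun J -> X}) F [ffun j => u (h j)].
  rewrite (reindex_onto (fun u : {ffun J -> X} => [ffun j => u (h j)] : {ffun J' -> X})
    back).
    by apply: eq_bigl => u; rewrite backK eqxx.
  by move=> u _; apply/ffunP => j; rewrite !ffunE hK.
exists (fun u => (-1) ^+ e (back u) * c (back u)); split=> [|y hy|u cu]; last first.
- by rewrite backK cu mulr0.
- rewrite /mform re; apply: eq_bigr => u _; rewrite backK.
  rewrite (eq_bigr (fun j => y (h j) (u (h j)))) => [|j _]; last by rewrite ffunE.
  rewrite (@prod_bij _ _ (fun j => gpar (u j)) (fun j => y j (u j))) //.
    by rewrite -!mulrA signrMA signrK.
  by move=> i j; exact: even_scomm.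
- rewrite /sform re; apply: eq_bigr => u _; rewrite backK.
  rewrite (eq_bigr (fun j => svar K (u (h j)))) => [|j _]; last by rewrite ffunE.
  rewrite (@prod_bij _ _ (fun j => gpar (u j)) (fun j => svar K (u j))) //.
    by rewrite -signZ scalerA -mulrA -signrM_comm -mulrA -exprD addnn
       -[X in _ * X]signr_odd odd_double mulr1.
  by move=> i j; exact: svar_scomm.
Qed.

Lemma sum_words X (V : nmodType) (F : seq X -> V) (s : seq (seq X)) D : uniq s ->
  (forall w, w \in s -> size w < D)%N ->
  \sum_(w <- s) F w =
  \sum_(d < D) \sum_(u : {ffun 'I_d -> X} | codom u \in s) F (codom u).
Proof.
move=> us sD.
have one w : w \in s -> \sum_(d < D) \sum_(u : {ffun 'I_d -> X} | codom u == w) F w = F w.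
  move=> ws; pose d := Ordinal (sD w ws).
  rewrite (bigD1 d) //= [X in _ + X]big1 ?addr0; last first.
    move=> d' dd'; rewrite big_pred0 // => u; apply: contraNF dd' => /eqP e.
    by rewrite -val_eqE /= -e size_codom card_ord.
  pose u0 : {ffun 'I_d -> X} := [ffun i => tnth (in_tuple w) i].
  have cu0 : codom u0 = w.
    rewrite codomE; transitivity (map (tnth (in_tuple w)) (enum 'I_d)).
      by apply: eq_map => i; rewrite ffunE.
    by rewrite map_tnth_enum.
  rewrite (big_pred1 u0) // => u; apply/eqP/eqP => [e|-> //].
  have : codom u = codom u0 by rewrite cu0.
  by rewrite !codom_ffun => /val_inj /(can_inj fgraphK).
rewrite [LHS]big_seq (eq_bigr _ (fun w ws => esym (one w ws))) -big_seq.
rewrite exchange_big /=; apply: eq_bigr => d _.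
rewrite (exchange_big_dep xpredT) //= [RHS]big_mkcond; apply: eq_bigr => u _.
case: ifP => us'.
  rewrite -big_filter (@eq_filter _ _ (pred1 (codom u : seq X))) => [|w];
    last exact: eq_sym.
  by rewrite filter_pred1_uniq // big_seq1.
by rewrite big_seq_cond big_pred0 // => w; apply/negP => /andP[ws /eqP e];
  rewrite e ws in us'.
Qed.

End Forms.

(** * Recovering forms from values at sums of vectors *)

Section Polarization.
Variable K : numFieldType.
Local Notation L := (grassmann K).
Implicit Types X : gset.

Lemma prod_eq0 (R : pzRingType) (I : finType) (F : I -> R) i : F i = 0 -> \prod_j F j = 0.
Proof.
move=> Fi; have := mem_index_enum i; elim: (index_enum I) => //= j s IH.
rewrite inE big_cons => /predU1P[<-|/IH ->]; first by rewrite Fi mul0r.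
by rewrite mulr0.
Qed.

Lemma prod_codom (R : pzRingType) (T : Type) n (u : {ffun 'I_n -> T}) (F : T -> R) :
  \prod_(x <- codom u) F x = \prod_i F (u i).
Proof. by rewrite codomE big_map enumT [index_enum _]unlock. Qed.

Lemma fhomogD X p (v w : fmod K X) : fhomog p v -> fhomog p w -> fhomog p (v + w).
Proof. by move=> hv hw x; rewrite ffunE; apply: ghomogD. Qed.

Lemma fhomog0 X p : fhomog p (0 : fmod K X).
Proof. by move=> x; rewrite ffunE; exact: ghomog0. Qed.

Lemma fhomogMn X p (v : fmod K X) n : fhomog p v -> fhomog p (v *+ n).
Proof.
move=> hv; elim: n => [|n IH]; first by rewrite mulr0n; exact: fhomog0.
by rewrite mulrS; exact: fhomogD.
Qed.

Lemma fhomog_sum X p (I : Type) (s : seq I) (P : pred I) (F : I -> fmod K X) :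
  (forall i, P i -> fhomog p (F i)) -> fhomog p (\sum_(i <- s | P i) F i).
Proof.
by move=> hF; apply: big_ind => //; [exact: fhomog0|exact: fhomogD].
Qed.

Lemma coordfD X (v w : fmod K X) x : coordf (v + w) x = coordf v x + coordf w x.
Proof. by rewrite /coordf ffunE sgncD. Qed.

Lemma coordf0 X x : coordf (0 : fmod K X) x = 0.
Proof. by rewrite /coordf ffunE sgnc0. Qed.

Lemma coordf_sum X (I : Type) (s : seq I) (P : pred I) (F : I -> fmod K X) x :
  coordf (\sum_(i <- s | P i) F i) x = \sum_(i <- s | P i) coordf (F i) x.
Proof. by apply: (big_morph (fun v => coordf v x)) => [v w|];
  [exact: coordfD|exact: coordf0]. Qed.

Lemma coordfMn X (v : fmod K X) n x : coordf (v *+ n) x = coordf v x *+ n.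
Proof. by elim: n => [|n IH]; rewrite ?mulr0n ?coordf0 // !mulrS coordfD IH. Qed.

(** By [reform], permuting the arguments of the form leaves the element of S(M) unchanged; so does
    averaging over all permutations. *)
Lemma symmetrize X d (a : {ffun 'I_d -> X} -> L) :
  exists C : {ffun 'I_d -> X} -> L, sform C = sform a /\
  forall y, even_family y ->
    mform C y = (d`!%:R^-1 : K) *: \sum_(s : 'S_d) mform a (fun i => y (s i)).
Proof.
have h (s : 'S_d) : exists c : {ffun 'I_d -> X} -> L, sform c = sform a /\
    forall y, even_family y -> mform c y = mform a (fun i => y (s i)).
  have [|c [c1 c2 _]] := reform (h := (s^-1)%g : 'I_d -> 'I_d) a.
    by exists s; [exact: permKV|exact: permK].
  exists c; split=> // y hy; rewrite -(c2 (fun i => y (s i))) => [|i x]; last exact: hy.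
  by apply: eq_bigr => u _; congr (_ * _); apply: eq_bigr => i _; rewrite permKV.
pose c s := sval (cid (h s)).
have c1 s : sform (c s) = sform a by exact: (svalP (cid (h s))).1.
have c2 s := (svalP (cid (h s))).2.
have d0 : d`!%:R != 0 :> K by rewrite pnatr_eq0 -lt0n fact_gt0.
exists (fun u => (d`!%:R^-1 : K) *: \sum_s c s u); split=> [|y hy].
  transitivity (((d`!%:R^-1 : K) *: (1 : L)) *: \sum_s sform (c s)).
    rewrite /sform exchange_big scaler_sumr /=; apply: eq_bigr => u _.
    by rewrite -scaler_suml scalerA -gscalerAl mul1r.
  rewrite (eq_bigr _ (fun s _ => c1 s)) sumr_const card_Sn -scaler_nat scalerA.
  rewrite -gscalerAl mul1r (_ : d`!%:R = (d`!%:R : K) *: (1 : L)); last first.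
    by rewrite scaler_nat.
  by rewrite scalerA mulVf // !scale1r.
transitivity ((d`!%:R^-1 : K) *: \sum_s mform (c s) y).
  rewrite /mform exchange_big scaler_sumr /=; apply: eq_bigr => u _.
  by rewrite -mulr_suml gscalerAl.
by congr (_ *: _); apply: eq_bigr => s _; exact: c2.
Qed.

(** The value of x at an integer combination of d vectors is polynomial in the integers; its part of
    degree one in each of them comes from the degree d component alone and is d! times the
    symmetrized form. *)
Lemma polarize X (x : symalg K X) :
  exists D (C : forall d, {ffun 'I_d -> X} -> L),
  x = \sum_(d < D) sform (C d) /\ forall d, (d < D)%N ->
  exists (E : finType) (A : E -> K) (n : E -> 'I_d -> nat), forall v : 'I_d -> fmod K X,
    (forall k, fhomog false (v k)) ->
    mform (C d) (fun k => coordf (v k)) = \sum_e A e *: seval (\sum_k v k *+ n e k) x.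
Proof.
have [t xt] := spi_surj x.
pose a d (u : {ffun 'I_d -> X}) := t@_(codom u).
pose D := (\max_(w <- msupp t) size w).+1.
have sD w : w \in msupp t -> (size w < D)%N.
  by move=> wt; rewrite ltnS; exact: leq_bigmax_seq.
have words (V : nmodType) (F : seq X -> V) : (forall w, w \notin msupp t -> F w = 0) ->
    \sum_(w <- msupp t) F w = \sum_(d < D) \sum_(u : {ffun 'I_d -> X}) F (codom u).
  move=> F0; rewrite (sum_words F (fset_uniq _) sD); apply: eq_bigr => d _.
  by rewrite big_mkcond; apply: eq_bigr => u _; case: ifP => // /negbT /F0 ->.
have xE : x = \sum_(d < D) sform (a d).
  rewrite xt (monalgE t) spi_sum.
  rewrite (eq_bigr _ (fun w _ => spi_word t@_w w)) words; last first.
    by move=> w /mcoeff_outdom ->; rewrite scale0r.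
  by apply: eq_bigr => d _; apply: eq_bigr => u _; rewrite prod_codom.
have xv v : fhomog false v -> seval v x = \sum_(d < D) mform (a d) (fun=> coordf v).
  move=> hv; rewrite xt seval_spi // /teval words; last first.
    by move=> w /mcoeff_outdom ->; rewrite mul0r.
  by apply: eq_bigr => d _; apply: eq_bigr => u _; rewrite prod_codom.
pose C d := sval (cid (symmetrize (a d))).
have C1 d : sform (C d) = sform (a d) by exact: (svalP (cid (symmetrize (a d)))).1.
have C2 d := (svalP (cid (symmetrize (a d)))).2.
exists D, C; split=> [|d dD]; first by rewrite xE; apply: eq_bigr => d _; rewrite C1.
have [E [A [n ex]]] := multilinear_part K 'I_d D.
exists E, (fun e => d`!%:R^-1 * A e), n => v hv.
rewrite C2 => [|k y]; last exact: coordf_homog.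
under [RHS]eq_bigr do rewrite -scalerA.
rewrite -scaler_sumr; congr (_ *: _).
(* The constant term [None] is 0, so only choices without [None] survive; for a multilinear choice
   this forces d' = d. *)
pose Y o y : L := if o is Some k then coordf (v k) y else 0.
have expand e d' : mform (a d') (fun=> coordf (\sum_k v k *+ n e k)) =
    \sum_(h : {ffun 'I_d' -> option 'I_d}) mform (a d') (fun i => Y (h i)) *+ \prod_i
      weight (n e) (h i).
  rewrite /mform; under [RHS]eq_bigr do rewrite -sumrMnl.
  rewrite exchange_big; apply: eq_bigr => u _ /=.
  rewrite (eq_bigr (fun i => Y None (u i) + \sum_k Y (Some k) (u i) *+ n e k));
    last first.
    move=> i _; rewrite add0r coordf_sum; apply: eq_bigr => k _; exact: coordfMn.
  rewrite (prod_expand (fun i o => Y o (u i))) mulr_sumr; apply: eq_bigr => h _.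
  by rewrite mulrnAr.
rewrite (eq_bigr (fun e => \sum_(d' < D) A e *: \sum_(h : {ffun 'I_d' -> option 'I_d})
    mform (a d') (fun i => Y (h i)) *+ \prod_i weight (n e) (h i))); last first.
  move=> e _; rewrite xv; last by apply: fhomog_sum => k _; exact: fhomogMn.
  by rewrite scaler_sumr; apply: eq_bigr => d' _; rewrite expand.
rewrite [RHS]exchange_big [RHS](bigD1 (Ordinal dD)) //= ex ?card_ord //.
rewrite multilinear_perm [X in _ = _ + X]big1 ?addr0 => [|d' dd'].
  by apply: eq_bigr => s _; apply: eq_bigr => u _; congr (_ * _);
    apply: eq_bigr => i _; rewrite ffunE.
rewrite ex ?card_ord // big1 // => h hm.
have [i hi] : exists i, h i = None.
  apply/not_existsP => hS; case/negP: dd'; rewrite -val_eqE /=.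
  have := (multilinear_total hm).2; rewrite !card_ord => -> // i.
  by apply/eqP/hS.
by apply: big1 => u _; rewrite (@prod_eq0 _ _ _ i) ?mulr0 // hi.
Qed.

End Polarization.

(** * Comparison of coefficients *)

Section FreshGenerators.
Variable K : numFieldType.
Local Notation L := (grassmann K).
Implicit Types X : gset.

Lemma gmulUU A B (a b : K) :
  (<< a *g A >> : L) * << b *g B >> = << a * b * gsign K A B *g (A `|` B)%fset >>.
Proof. by rewrite (gmulE msuppU_le msuppU_le) !big_seq_fset1 !mcoeffUU. Qed.

Lemma gmonom_sqr (B : {fset nat}) : B != fset0 -> (<< 1 *g B >> : L) * << 1 *g B >> = 0.
Proof.
by move=> B0; rewrite gmulUU /gsign -fsetI_eq0 fsetIid (negPf B0) mulr0 monalgU0.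
Qed.

Lemma gmulU_neq0 (a : L) (B : {fset nat}) :
  (forall A, A \in msupp a -> [disjoint A & B]%fset) -> a != 0 -> a * << 1 *g B >> != 0.
Proof.
move=> dB a0; have [A Aa] : exists A, A \in msupp a.
  by apply/fset0Pn/eqP => e; case/eqP: a0; apply/malgP => A;
    rewrite mcoeff0 mcoeff_outdom ?e.
rewrite (gmulE (fsubset_refl _) msuppU_le).
apply/eqP => /(congr1 (fun z : L => z@_(A `|` B)%fset)).
rewrite mcoeff0 raddf_sum /= (big_fsetD1 A) //= big_seq_fset1 mcoeffU eqxx mcoeffUU mulr1.
rewrite big_seq big1 ?addr0 => [|A'].
  by apply/eqP; rewrite mulf_neq0 ?mcoeff_neq0 // /gsign dB // signr_eq0.
rewrite in_fsetD1 => /andP[A'A A'a]; rewrite big_seq_fset1 mcoeffU; case: eqP => // e.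
case/negP: A'A; apply/eqP/fsetP => i; move/fsetP: e => /(_ i); rewrite !in_fsetU.
case iB: (i \in B); last by rewrite !orbF.
have no C : C \in msupp a -> i \in C = false.
  by move=> hC; apply/negP => /(fdisjointP (dB _ hC)); rewrite iB.
by rewrite !no.
Qed.

(** Only finitely many generators occur in a. Beyond them, z is one generator if p is odd and the
    product of two if p is even; it squares to 0 and supercommutes with every y. *)
Lemma fresh_generator (a : L) (p : bool) : a != 0 ->
  exists z : L, [/\ ghomog p z, forall y, z * y * z = 0 & a * z != 0].
Proof.
move=> a0; pose M := (\max_(A <- msupp a) \max_(i <- A) i)%N.+1.
have ltM A i : A \in msupp a -> i \in A -> (i < M)%N.
  move=> Aa iA; rewrite ltnS; apply: leq_trans (leq_bigmax_seq A Aa isT).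
  exact: (leq_bigmax_seq i iA isT).
pose B := if p then [fset M]%fset else [fset M; M.+1]%fset.
have cB : odd #|` B| = p.
  by rewrite /B; case: (p); rewrite ?cardfs1 // cardfs2 neq_ltn ltnSn.
have B0 : B != fset0 by apply/fset0Pn; exists M; rewrite /B; case: (p); rewrite !inE eqxx.
exists << 1 *g B >>; split.
- by rewrite -{1}cB; exact: ghomogU.
- have hz : ghomog p (<< 1 *g B >> : L) by rewrite -{1}cB; exact: ghomogU.
  by move=> y; rewrite (gsupercomm y hz) -mulrA gmonom_sqr ?mulr0.
- apply: gmulU_neq0 a0 => A Aa; apply/fdisjointP => i iA.
  have iM := ltM _ _ Aa iA.
  rewrite /B; case: (p); rewrite !inE ?negb_or; first by rewrite ltn_eqF.
  by rewrite !ltn_eqF // ltnS ltnW.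
Qed.

Lemma fresh_family (a : L) (J : finType) (p : J -> bool) : a != 0 ->
  exists z : J -> L, [/\ forall j, ghomog (p j) (z j),
    forall j y, z j * y * z j = 0 & a * \prod_j z j != 0].
Proof.
have := index_enum_uniq J; elim: (index_enum J) a => [|j s IH] a /= us a0.
  exists (fun=> 0); split=> [j|j y|]; [exact: ghomog0|by rewrite mulr0|].
  by rewrite big_nil mulr1.
case/andP: us => js us; have [zj [hz z2 az]] := fresh_generator (p j) a0.
have [z [h1 h2 h3]] := IH _ us az.
exists (fun k => if k == j then zj else z k); split.
- by move=> k; case: eqP => [->|].
- by move=> k y; case: eqP.
rewrite big_cons eqxx mulrA (eq_big_seq z) // => k ks.
by case: eqP => // kj; rewrite -kj ks in js.
Qed.

(** The factor y in the middle makes the condition stable under even endomorphisms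
    ([null_square_map]). *)
Definition null_square X (v : fmod K X) : Prop := forall x x' y, v x * y * v x' = 0.

(** If [c u] is nonzero, let [v j] be the basis vector at [u j] times a fresh [z j] of the same
    parity: the value is [c u] times the product of the [z j], which is nonzero. *)
Lemma mform_eq0 X (J : finType) (c : {ffun J -> X} -> L) :
  (forall v : J -> fmod K X, (forall j, fhomog false (v j)) ->
     (forall j, null_square (v j)) -> mform c v = 0) ->
  forall u, c u = 0.
Proof.
move=> c0 u; apply/eqP; apply: contraT => cu.
have [z [hz z2 cz]] := fresh_family (fun j => gpar (u j)) cu.
pose v j : fmod K X := [ffun x => if x == u j then z j else 0].
case/negP: cz; rewrite -(c0 v).
- rewrite /mform (bigD1 u) //= [X in _ == _ + X]big1 ?addr0 => [|w wu].
    by apply/eqP; congr (_ * _); apply: eq_bigr => j _; rewrite ffunE eqxx.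
  have [j /eqP/negPf ne] : exists j, w j <> u j.
    by apply/existsNP => e; case/eqP: wu; apply/ffunP.
  by rewrite (@prod_eq0 _ _ _ j) ?mulr0 // ffunE ne.
- move=> j x; rewrite ffunE; case: eqP => [->|_]; [exact: hz|exact: ghomog0].
- move=> j x x' y; rewrite !ffunE.
  by case: eqP => _; case: eqP => _; rewrite ?mul0r ?mulr0 ?z2.
Qed.

Definition bform X (I J : finType) (c : {ffun I -> X} -> {ffun J -> X} -> L)
    (u : I -> X -> L) (f : J -> X -> L) : L :=
  \sum_p \sum_q c p q * (\prod_i u i (p i) * \prod_j f j (q j)).

Lemma bform_eq0 X (I J : finType) (c : {ffun I -> X} -> {ffun J -> X} -> L) :
  (forall (u : I -> fmod K X) (f : J -> fmod K X),
     (forall i, fhomog false (u i)) -> (forall i, null_square (u i)) ->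
     (forall j, fhomog false (f j)) -> bform c u f = 0) ->
  forall p q, c p q = 0.
Proof.
move=> c0 p q; apply: (@mform_eq0 X I (fun p => c p q)) p => u hu su.
apply: (@mform_eq0 X J (fun q => mform (c^~ q) u)) q => f hf _.
rewrite -[RHS](c0 u f) // /mform /bform exchange_big /=; apply: eq_bigr => q _.
by rewrite mulr_suml; apply: eq_bigr => p _; rewrite mulrA.
Qed.

End FreshGenerators.

(** * Elements of GL(U) *)

Section GLElements.
Variable K : numFieldType.
Local Notation L := (grassmann K).
Implicit Types X : gset.

Lemma sgncZ p k (x : L) : sgnc p (k *: x) = k *: sgnc p x.
Proof. by apply/malgP => A; rewrite sgncE !mcoeffZ sgncE mulrCA. Qed.

Lemma ghomogZ p k (x : L) : ghomog p x -> ghomog p (k *: x).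
Proof. by move=> hx A; rewrite mcoeffZ mulf_eq0 negb_or => /andP[_ /hx]. Qed.

Lemma sgnc_even p (x : L) : ghomog false x -> sgnc p x = x.
Proof. by move=> /(sgnc_homog p) ->; rewrite andbF mul1r. Qed.

Lemma rscaleD X (v : fmod K X) a b : rscale v (a + b) = rscale v a + rscale v b.
Proof. by apply/ffunP => x; rewrite !ffunE sgncD mulrDr. Qed.

Lemma rscaleDl X (v w : fmod K X) a : rscale (v + w) a = rscale v a + rscale w a.
Proof. by apply/ffunP => x; rewrite !ffunE mulrDl. Qed.

Lemma rscaleA X (v : fmod K X) a b : rscale (rscale v a) b = rscale v (a * b).
Proof. by apply/ffunP => x; rewrite !ffunE sgncM mulrA. Qed.

Lemma rscale_even X (v : fmod K X) a x : ghomog false a -> rscale v a x = v x * a.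
Proof. by move=> ha; rewrite ffunE sgnc_even. Qed.

Lemma rscaleN X (v : fmod K X) a : rscale (- v) a = - rscale v a.
Proof. by apply/ffunP => x; rewrite !ffunE mulNr. Qed.

Lemma even_endoD X (f h : fmod K X -> fmod K X) :
  even_endo f -> even_endo h -> even_endo (fun w => f w + h w).
Proof.
move=> [fD fZ fh] [hD hZ hh]; split=> [v w|v a|p v hv].
- by rewrite fD hD addrACA.
- by rewrite fZ hZ rscaleDl.
- by apply: fhomogD; [exact: fh|exact: hh].
Qed.

Lemma even_endo_comp X (f h : fmod K X -> fmod K X) :
  even_endo f -> even_endo h -> even_endo (f \o h).
Proof.
move=> [fD fZ fh] [hD hZ hh]; split=> [v w|v a|p v hv] /=.
- by rewrite hD fD.
- by rewrite hZ fZ.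
- exact/fh/hh.
Qed.

Lemma even_endo_rank1 X (v phi : fmod K X) : fhomog false v -> fhomog false phi ->
  even_endo (fun w => rscale v (ev phi w)).
Proof.
move=> hv hphi; split=> [u w|u a|p u hu].
- by rewrite evD rscaleD.
- by rewrite ev_rscale rscaleA.
- move=> x; rewrite ffunE addbC; apply: ghomogM; first exact: hv.
  by apply: ghomog_sgnc; exact: (ev_homog hphi hu).
Qed.

Lemma fhomogN X p (v : fmod K X) : fhomog p v -> fhomog p (- v).
Proof. by move=> hv x; rewrite ffunE; exact: ghomogN. Qed.

Lemma null_square_map X (f : fmod K X -> fmod K X) v :
  even_endo f -> null_square v -> null_square (f v).
Proof.
move=> ef sv y y' a; rewrite (even_endo_lext ef v) !ffunE.
rewrite !mulr_suml big1 // => x _; rewrite mulr_sumr big1 // => x' _.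
by rewrite -!mulrA [_ * (a * _)]mulrA (mulrA (v x)) mulrA [_ * v x'](_ : _ = 0) ?mul0r //;
  rewrite -!mulrA mulrA sv.
Qed.

Lemma null_square_ev X (v phi : fmod K X) a : fhomog false v -> null_square v ->
  rscale v (ev phi v * a) = 0.
Proof.
move=> hv sv; apply/ffunP => x; rewrite !ffunE sgncM /ev sgnc_sum mulrA.
rewrite mulr_sumr big1 ?mul0r // => y _; rewrite sgncM sgncK.
by rewrite (sgnc_homog _ (hv y)) !signrMA mulrA sv mulr0.
Qed.

Lemma even_endo0 X (f : fmod K X -> fmod K X) : even_endo f -> f 0 = 0.
Proof. by case=> fD _ _; apply: (addrI (f 0)); rewrite -fD !addr0. Qed.

Lemma ev0 X (f : fmod K X) : ev f 0 = 0.
Proof. by apply: (addrI (ev f 0)); rewrite -evD !addr0. Qed.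

Lemma evN X (f v : fmod K X) : ev f (- v) = - ev f v.
Proof. by apply: (addrI (ev f v)); rewrite -evD !subrr ev0. Qed.

Section GLgroup.
Variables m n : nat.
Local Notation X := (gV m n).

Definition gl_one : GL K m n :=
  MkGL (@even_endo_id K X) (@even_endo_id K X) (fun=> erefl) (fun=> erefl).

(** The map factors as g after 1 + v' phi, where v' is the preimage of v under g. As v' is null
    square, v' phi has square zero and 1 - v' phi is the inverse of the second factor. *)
Lemma gl_add_rank1 (g : GL K m n) (v phi : fmod K X) :
  fhomog false v -> fhomog false phi -> null_square v ->
  exists g' : GL K m n, forall w, g' w = g w + rscale v (ev phi w).
Proof.
move=> hv hphi sv; pose v' := gl_inv g v.
have [_ gZ _] := gl_even g; have [gD _ _] := gl_even g.
have hv' : fhomog false v' by case: (gl_inv_even g) => _ _; apply.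
have sv' : null_square v' := null_square_map (gl_inv_even g) sv.
pose h w := w + rscale v' (ev phi w); pose h' w := w + rscale (- v') (ev phi w).
have eh : even_endo h := even_endoD (even_endo_id K X) (even_endo_rank1 hv' hphi).
have eh' : even_endo h' :=
  even_endoD (even_endo_id K X) (even_endo_rank1 (fhomogN hv') hphi).
have hK : cancel h h'.
  move=> w; rewrite /h' /h evD ev_rscale rscaleD [rscale _ (ev phi v' * _)]rscaleN.
  by rewrite null_square_ev // oppr0 addr0 rscaleN addrK.
have h'K : cancel h' h.
  move=> w; rewrite /h' /h evD ev_rscale evN rscaleD mulNr -mulrN.
  by rewrite null_square_ev // addr0 rscaleN subrK.
exists (MkGL (even_endo_comp (gl_even g) eh) (even_endo_comp eh' (gl_inv_even g))
  (can_comp (gl_funK g) hK) (can_comp h'K (gl_invK g))) => w /=.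
by rewrite /h gD gZ /v' gl_invK.
Qed.

(** The rank one terms are added one at a time, so each [v j] has to be null square but distinct
    [v j] need satisfy no relation. *)
Lemma gl_unipotent (J : Type) (s : seq J) (v phi : J -> fmod K X) :
  (forall j, fhomog false (v j)) -> (forall j, fhomog false (phi j)) ->
  (forall j, null_square (v j)) ->
  exists g : GL K m n, forall w, g w = w + \sum_(j <- s) rscale (v j) (ev (phi j) w).
Proof.
move=> hv hphi sv; elim: s => [|j s [g gE]].
  by exists gl_one => w; rewrite big_nil addr0.
have [g' g'E] := gl_add_rank1 g (hv j) (hphi j) (sv j).
by exists g' => w; rewrite g'E gE big_cons addrAC addrA.
Qed.

Lemma dmap_gl_VK (g : GL K m n) f : dmap (gl_V g) (dmap g f) = f.
Proof.
apply/ffunP => x; rewrite ffunE ev_dmap; last exact: gl_even.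
by rewrite [g _]gl_invK ev_bas.
Qed.

Lemma gl_scalar (k : K) : k != 0 ->
  exists g : GL K m n, (forall w x, g w x = k *: w x) /\
    forall f x, dmap (gl_V g) f x = k^-1 *: f x.
Proof.
move=> k0; pose h k (w : fmod K X) : fmod K X := [ffun x => k *: w x].
have eh l : even_endo (h l).
  split=> [v w|v a|p v hv].
  - by apply/ffunP => x; rewrite !ffunE scalerDr.
  - by apply/ffunP => x; rewrite !ffunE gscalerAl.
  - by move=> x; rewrite ffunE; apply: ghomogZ.
have hK l : l != 0 -> cancel (h l) (h l^-1).
  by move=> l0 w; apply/ffunP => x; rewrite !ffunE scalerA mulVf // scale1r.
have hK' : cancel (h k^-1) (h k) by rewrite -{2}[k]invrK; apply: hK; rewrite invr_eq0.
exists (MkGL (eh k) (eh k^-1) (hK k k0) hK'); split=> [w x|f x] /=;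
  first by rewrite ffunE.
rewrite ffunE /ev (bigD1 x) //= !ffunE eqxx sgncZ sgnc1 -gscalerAr mulr1.
by rewrite big1 ?addr0 // => y yx;
  rewrite !ffunE eq_sym (negPf yx) sgncZ sgnc0 scaler0 mulr0.
Qed.

End GLgroup.

End GLElements.

(** * Invariant multilinear forms *)

(** A vector of the row space of A killed by the transpose of A has sum of squares 0, hence is 0. So
    A times its transpose has the same rank, and the same row space, as the transpose. *)
Lemma gram_row (F : realFieldType) p q (A : 'M[F]_(p, q)) (d : 'rV_q) :
  exists y : 'rV_p, y *m A *m A^T = d *m A^T.
Proof.
have sq0 (v : 'rV[F]_q) : v *m A^T = 0 -> (v <= A)%MS -> v = 0.
  move=> vA /submxP[x vx]; have vv : v *m v^T = 0.
    by rewrite {2}vx trmx_mul mulmxA vA mul0mx.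
  apply/rowP => i; rewrite mxE.
  have := congr1 (fun B : 'M_1 => B 0 0) vv; rewrite !mxE => /eqP.
  rewrite psumr_eq0 => [/allP /(_ i (mem_index_enum i))|j _]; last first.
    by rewrite mxE -expr2 sqr_ge0.
  by rewrite mxE -expr2 sqrf_eq0 => /eqP.
have cap0 : (A :&: kermx A^T)%MS = 0.
  apply/row_matrixP => i; rewrite row0; apply: sq0.
    by apply/sub_kermxP; apply: submx_trans (row_sub _ _) (capmxSr _ _).
  by apply: submx_trans (row_sub _ _) (capmxSl _ _).
have rk : \rank (A *m A^T) = \rank A^T.
  by rewrite -[RHS]addn0 mxrank_tr -(mxrank_mul_ker A A^T) cap0 mxrank0 !addn0.
have : (d *m A^T <= A *m A^T)%MS.
  apply: submx_trans (submxMl d A^T) _.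
  by rewrite -(mxrank_leqif_sup (submxMl A A^T)).2 rk.
by case/submxP => y ->; exists y; rewrite mulmxA.
Qed.

(* The real linear combination of the rows of M nearest to the unit vector at *)
(* t has the same products with the rows of M as that vector.               *)
Lemma gram_functional (F : realFieldType) (P T : finType) (M : P -> T -> F) (t : T) :
  exists y : P -> F, forall p, \sum_u (\sum_q y q * M q u) * M p u = M p t.
Proof.
pose A : 'M[F]_(#|P|, #|T|) := \matrix_(i, j) M (enum_val i) (enum_val j).
have [y yE] := gram_row A (delta_mx 0 (enum_rank t)).
exists (fun p => y 0 (enum_rank p)) => p.
have := congr1 (fun B : 'rV_#|P| => B 0 (enum_rank p)) yE.
rewrite -rowE !mxE !enum_rankK => <-.
rewrite (reindex_onto enum_val enum_rank) => [|u _]; last by rewrite enum_rankK.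
apply: eq_big => [j|j _]; first by rewrite enum_valK eqxx.
rewrite !mxE enum_rankK; congr (_ * _).
rewrite (reindex_onto enum_val enum_rank) => [|u _]; last by rewrite enum_rankK.
by apply: eq_big => [i|i _]; rewrite ?mxE enum_valK ?eqxx.
Qed.

Section FFT.
Variable K : numFieldType.
Local Notation L := (grassmann K).
Implicit Types X : gset.

Lemma prod_even_split (I : Type) (s : seq I) (x e : I -> L) :
  (forall i, ghomog false (e i)) ->
  \prod_(i <- s) (x i * e i) = \prod_(i <- s) x i * \prod_(i <- s) e i.
Proof.
move=> he; rewrite (@prod_interleave _ _ (fun=> 1%N) (fun=> 0%N)).
  by rewrite (_ : cross _ s = 0%N) ?mul1r //; elim: s => //= i s ->; rewrite big1.
by move=> i j; rewrite /scomm mul1r; exact: ghomog_evenC.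
Qed.

Section Bform.
Variables (X : gset) (I J : finType) (c : {ffun I -> X} -> {ffun J -> X} -> L).

Lemma eq_bform u u' f f' : (forall i x, u i x = u' i x) -> (forall j x, f j x = f' j x) ->
  bform c u f = bform c u' f'.
Proof.
move=> uu' ff'; apply: eq_bigr => p _; apply: eq_bigr => q _; congr (_ * (_ * _)).
  by apply: eq_bigr => i _; exact: uu'.
by apply: eq_bigr => j _; exact: ff'.
Qed.

Lemma bform_expandl (H : finType) (n : H -> nat) (u : I -> X -> L)
    (y : I -> option H -> X -> L) f :
  (forall i x, u i x = y i None x + \sum_j y i (Some j) x *+ n j) ->
  bform c u f = \sum_(h : {ffun I -> option H})
    bform c (fun i => y i (h i)) f *+ \prod_i weight n (h i).
Proof.
move=> uE; rewrite /bform; under [RHS]eq_bigr do rewrite -sumrMnl.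
rewrite [RHS]exchange_big /=; apply: eq_bigr => p _.
under [RHS]eq_bigr do rewrite -sumrMnl.
rewrite [RHS]exchange_big /=; apply: eq_bigr => q _.
rewrite (eq_bigr _ (fun i _ => uE i (p i))) (prod_expand (fun i o => y i o (p i))).
by rewrite mulr_suml mulr_sumr; apply: eq_bigr => h _; rewrite mulrnAl mulrnAr.
Qed.

Lemma bform_expandr (H : finType) (n : H -> nat) u (f : J -> X -> L)
    (y : J -> option H -> X -> L) :
  (forall i x, f i x = y i None x + \sum_j y i (Some j) x *+ n j) ->
  bform c u f = \sum_(h : {ffun J -> option H})
    bform c u (fun j => y j (h j)) *+ \prod_j weight n (h j).
Proof.
move=> fE; rewrite /bform; under [RHS]eq_bigr do rewrite -sumrMnl.
rewrite [RHS]exchange_big /=; apply: eq_bigr => p _.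
under [RHS]eq_bigr do rewrite -sumrMnl.
rewrite [RHS]exchange_big /=; apply: eq_bigr => q _.
rewrite (eq_bigr _ (fun i _ => fE i (q i))) (prod_expand (fun i o => y i o (q i))).
by rewrite !mulr_sumr; apply: eq_bigr => h _; rewrite !mulrnAr.
Qed.

Lemma bform_evenl u e f : (forall i, ghomog false (e i)) ->
  bform c (fun i x => u i x * e i) f = bform c u f * \prod_i e i.
Proof.
move=> he; rewrite mulr_suml; apply: eq_bigr => p _; rewrite mulr_suml.
apply: eq_bigr => q _; rewrite prod_even_split // -!mulrA; congr (_ * (_ * _)).
by apply: ghomog_evenC; exact: ghomog_prod0.
Qed.

Lemma bform_evenr u e f : (forall i, ghomog false (e i)) ->
  bform c u (fun i x => f i x * e i) = bform c u f * \prod_i e i.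
Proof.
move=> he; rewrite mulr_suml; apply: eq_bigr => p _; rewrite mulr_suml.
by apply: eq_bigr => q _; rewrite prod_even_split // -!mulrA.
Qed.

End Bform.

Section Invariants.
Variables m n : nat.
Local Notation X := (gV m n).

(** [dmap (gl_V g)] is the action of g on covectors, composition with the inverse of g. *)
Definition invariant_form (I J : finType) (c : {ffun I -> X} -> {ffun J -> X} -> L) :
  Prop :=
  forall (g : GL K m n) (u : I -> fmod K X) (f : J -> fmod K X),
    (forall i, fhomog false (u i)) -> (forall j, fhomog false (f j)) ->
    bform c (fun i => g (u i)) (fun j => dmap (gl_V g) (f j)) = bform c u f.

(** The scalar 2 acts on the form by 2 to the power #|I| - #|J|, which differs from 1 in
    characteristic zero. *)
Lemma invariant_form_unbalanced (I J : finType) c : @invariant_form I J c ->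
  #|I| != #|J| -> forall p q, c p q = 0.
Proof.
move=> ci IJ; apply: bform_eq0 => u f hu _ hf.
have two0 : 2 != 0 :> K by rewrite pnatr_eq0.
have [g [gE gVE]] := gl_scalar m n two0.
have prodZ (T : finType) (k : K) (F : T -> L) :
    \prod_i (k *: F i) = k ^+ #|T| *: \prod_i F i.
  rewrite -prodr_const (eq_bigl xpredT) //; elim/big_rec3: _ => [|i a b d _ ->].
    by rewrite scale1r.
  by rewrite -gscalerAl -gscalerAr scalerA.
have := ci g u f hu hf.
have -> : bform c (fun i => g (u i)) (fun j => dmap (gl_V g) (f j)) =
    (2 ^+ #|I| * 2^-1 ^+ #|J| : K) *: bform c u f.
  rewrite /bform scaler_sumr; apply: eq_bigr => p _.
  rewrite scaler_sumr; apply: eq_bigr => q _.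
  rewrite (eq_bigr (fun i => 2 *: u i (p i))) => [|i _]; last exact: gE.
  rewrite [X in _ * (_ * X)](eq_bigr (fun j => 2^-1 *: f j (q j))) => [|j _];
    last exact: gVE.
  by rewrite !prodZ -gscalerAl -!gscalerAr scalerA.
move/eqP; rewrite -subr_eq0 -{2}[bform c u f]scale1r -scalerBl scaler_eq0 => /orP[|/eqP
  //].
rewrite subr_eq0 exprVn => /eqP /divr1_eq /eqP; rewrite -!natrX eqr_nat eqn_exp2l //.
by rewrite (negPf IJ).
Qed.

Lemma ev_sum (Y : gset) (f : fmod K Y) (I : Type) (s : seq I) (F : I -> fmod K Y) :
  ev f (\sum_(i <- s) F i) = \sum_(i <- s) ev f (F i).
Proof. by apply: (big_morph (ev f)); [exact: evD|exact: ev0]. Qed.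

Lemma evMn (Y : gset) (f v : fmod K Y) k : ev f (v *+ k) = ev f v *+ k.
Proof. by elim: k => [|k IH]; rewrite ?mulr0n ?ev0 // !mulrS evD IH. Qed.

Lemma fmodMnE (Y : gset) (v : fmod K Y) k x : (v *+ k) x = v x *+ k.
Proof. by elim: k => [|k IH]; rewrite ?mulr0n ?ffunE // !mulrS ffunE IH. Qed.

(* the coefficient of \prod_j n j in the invariance of c under the maps        *)
(* w |-> w + \sum_j (v j *+ n j) <phi j, w>                                     *)
Lemma invariant_form_exchange N c (v phi u f : 'I_N -> fmod K X) :
  @invariant_form 'I_N 'I_N c ->
  (forall k, fhomog false (v k)) -> (forall k, null_square (v k)) ->
  (forall k, fhomog false (phi k)) -> (forall k, fhomog false (u k)) ->
  (forall k, fhomog false (f k)) ->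
  \sum_(s : 'S_N) bform c (fun k => v (s k)) f * \prod_k ev (phi (s k)) (u k) =
  \sum_(s : 'S_N) bform c u (fun k => phi (s k)) * \prod_k ev (f k) (v (s k)).
Proof.
move=> ci hv sv hphi hu hf.
have hev (a b : fmod K X) : fhomog false a -> fhomog false b -> ghomog false (ev a b).
  exact: (@ev_homog _ _ false false).
have [E [A [n0 ex]]] := multilinear_part K 'I_N N.+1.
have g_ex e : exists g : GL K m n, forall w,
    g w = w + \sum_(j <- index_enum 'I_N) rscale (v j *+ n0 e j) (ev (phi j) w).
  apply: gl_unipotent => // j; first exact: fhomogMn.
  by move=> x x' y; rewrite !fmodMnE mulrnAl mulrnAl mulrnAr sv !mul0rn.
(* Terms of g applied to u_k and of f_k composed with g: [None] is the unchanged vector, [Some j]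
   the contribution of the j-th rank one map. *)
pose yu k (o : option 'I_N) x : L := if o is Some j then v j x * ev (phi j) (u k) else
  u k x.
pose yf k (o : option 'I_N) x : L := if o is Some j then phi j x * ev (f k) (v j) else
  f k x.
(* Invariance is applied to u and to the covectors f_k composed with g, so that g acts on u on one
   side and on f on the other. *)
have eq1 e : \sum_(h : {ffun 'I_N -> option 'I_N})
      bform c (fun k => yu k (h k)) f *+ \prod_i weight (n0 e) (h i) =
    \sum_(h : {ffun 'I_N -> option 'I_N})
      bform c u (fun k => yf k (h k)) *+ \prod_i weight (n0 e) (h i).
  have [g gE] := g_ex e.
  rewrite -(@bform_expandl _ _ _ _ _ _ (fun k => g (u k))); last first.
    move=> k x; rewrite gE ffunE sum_ffunE; congr (_ + _); apply: eq_bigr => j _.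
    by rewrite rscale_even ?fmodMnE ?mulrnAl //; exact: hev.
  rewrite -(@bform_expandr _ _ _ _ _ _ _ (fun k => dmap g (f k))); last first.
    move=> k x; rewrite ffunE gE evD ev_bas; congr (_ + _).
    rewrite ev_sum; apply: eq_bigr => j _; rewrite ev_rscale evMn ev_bas mulrnAl.
    by rewrite /yf ghomog_evenC //; exact: hev.
  rewrite -(ci g u (fun k => dmap g (f k))) //; last first.
    by move=> k; case: (even_endo_dmap (gl_even g)) => _ _; apply.
  by apply: eq_bform => // k x; rewrite dmap_gl_VK.
have: \sum_e A e *: \sum_(h : {ffun 'I_N -> option 'I_N})
      bform c (fun k => yu k (h k)) f *+ \prod_i weight (n0 e) (h i) =
    \sum_e A e *: \sum_(h : {ffun 'I_N -> option 'I_N})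
      bform c u (fun k => yf k (h k)) *+ \prod_i weight (n0 e) (h i).
  by apply: eq_bigr => e _; rewrite eq1.
rewrite !ex ?card_ord // !multilinear_perm => e1.
transitivity (\sum_(s : 'S_N) bform c (fun k => yu k (Some (s k))) f).
  apply: eq_bigr => s _; rewrite -bform_evenl //.
  by move=> k; exact: hev.
transitivity (\sum_(s : 'S_N) bform c u (fun k => yf k (Some (s k)))).
  transitivity (\sum_(s : 'S_N)
     bform c (fun k => yu k ([ffun i => Some (s i)] k)) f).
    by apply: eq_bigr => s _; apply: eq_bform => // k x; rewrite ffunE.
  rewrite e1; apply: eq_bigr => s _; apply: eq_bform => // k x; by rewrite ffunE.
by apply: eq_bigr => s _; rewrite -bform_evenr // => k; exact: hev.
Qed.

End Invariants.
End FFT.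

(** * Invariant forms are combinations of products of pairings *)

Section Span.
Variable K : numFieldType.
Local Notation L := (grassmann K).

(* the matrix of s acting on tensors: see prod_permute *)
Definition perm_coef (X : gset) N (p q : {ffun 'I_N -> X}) (s : 'S_N) : rat :=
  if p == [ffun k => q (s k)]
  then (-1) ^+ inversions (fun k => gpar (q k)) (map s (index_enum 'I_N)) else 0.

Lemma perm_coef1 (X : gset) N (p q : {ffun 'I_N -> X}) :
  perm_coef p q 1 = (p == q)%:R.
Proof.
rewrite /perm_coef (_ : [ffun k => q ((1%g : 'S_N) k)] = q); last first.
  by apply/ffunP => k; rewrite ffunE perm1.
case: eqP => // _; rewrite inversions_perm big1 // => k _.
by rewrite big_pred0 // => l; rewrite !perm1; case: ltngtP.
Qed.

Lemma signZ1 n (x : L) : ((-1) ^+ n : K) *: x = (-1) ^+ n * x.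
Proof.
rewrite -signr_odd -[in RHS]signr_odd; case: (odd n); rewrite ?scale1r ?mul1r //.
by rewrite scaleN1r mulN1r.
Qed.

Lemma prod_permute (X : gset) N (y : 'I_N -> X -> L) (p : {ffun 'I_N -> X}) (s : 'S_N) :
  even_family y ->
  \prod_k y (s k) (p k) =
  \sum_q (ratr (perm_coef p q s) : K) *: \prod_k y k (q k).
Proof.
move=> hy; pose q0 : {ffun 'I_N -> X} := [ffun k => p (s^-1 k)%g].
have pq0 : [ffun k => q0 (s k)] = p by apply/ffunP => k; rewrite !ffunE permK.
rewrite (bigD1 q0) //= [X in _ = _ + X]big1 ?addr0 => [|q qq0].
  rewrite /perm_coef pq0 eqxx rmorph_sign signZ1.
  rewrite -(@prod_bij _ _ (fun k => gpar (q0 k)) (fun k => y k (q0 k))).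
  - by apply: eq_bigr => k _; rewrite ffunE permK.
  - by move=> i j; exact: even_scomm.
  - by exists s^-1%g; [exact: permK|exact: permKV].
rewrite /perm_coef; case: eqP => [e|_]; last by rewrite raddf0 scale0r.
case/eqP: qq0; apply/ffunP => k; rewrite ffunE e ffunE permKV.
by [].
Qed.

Lemma ev_even (X : gset) (f v : fmod K X) : fhomog false f ->
  ev f v = \sum_x v x * f x.
Proof.
move=> hf; apply: eq_bigr => x _.
by rewrite (gsupercomm _ (hf x)) sgncK addbb sgnc_false.
Qed.

(** Comparing coefficients of (u, phi) in [invariant_form_exchange] gives one identity for each pair
    of words (p, q). Weights [y] on these pairs are chosen so that the permutations, weighted by
    [e], act together as the identity on tensors; the left sides then add up to the given form. The
    resulting coefficients involve neither v nor f. *)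
Lemma invariant_form_span (m n N : nat)
    (c : {ffun 'I_N -> gV m n} -> {ffun 'I_N -> gV m n} -> L) :
  invariant_form c -> exists C : 'S_N -> L, forall v f : 'I_N -> fmod K (gV m n),
    (forall k, fhomog false (v k)) -> (forall k, null_square (v k)) ->
    (forall k, fhomog false (f k)) ->
    bform c v f = \sum_(s : 'S_N) C s * \prod_k ev (f k) (v (s k)).
Proof.
move=> ci; pose X := gV m n; pose W := {ffun 'I_N -> X}.
(* Exponent of the sign that separates a product of factors u_k phi_(s k) into the product of the u
   and the product of the phi. *)
pose kappa (p : W) := cross (fun i j => gpar (p i) * gpar (p j))%N (index_enum 'I_N).
pose M p q s : K := ratr (@perm_coef X N p q s).
(* The matrix coefficients are rational, so the positivity behind [gram_functional] is used over
   [rat] and the solution is carried to K by [ratr]. The chosen column is that of the identity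
   permutation. *)
have [y0 yE] := gram_functional (fun (pq : (W * W)%type) s => @perm_coef X N pq.1 pq.2
  s) 1%g.
pose y pq : K := ratr (y0 pq).
pose e s := \sum_pq y pq * M pq.1 pq.2 s.
have eM p q : \sum_s e s * M p q s = (p == q)%:R.
  rewrite -[RHS](rmorph_nat (@ratr K)) -perm_coef1 -(yE (p, q)) rmorph_sum.
  by apply: eq_bigr => s _; rewrite rmorphM rmorph_sum; congr (_ * _);
    apply: eq_bigr => pq _; rewrite rmorphM.
exists (fun s => \sum_pq y pq *: \sum_q M q pq.2 s *: ((-1) ^+ kappa pq.1 * c pq.1 q)).
move=> v f hv sv hf.
have hev (a b : fmod K X) : fhomog false a -> fhomog false b -> ghomog false (ev a b).
  exact: (@ev_homog _ _ false false).
pose G s := bform c (fun k => v (s k)) f.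
pose Ev (s : 'S_N) : L := \prod_k ev (f k) (v (s k)).
have hEv s : ghomog false (Ev s) by apply: ghomog_prod0 => k _; exact: hev.
have Ge : \sum_s e s *: G s = bform c v f.
  rewrite /G /bform; under eq_bigr do rewrite scaler_sumr.
  rewrite exchange_big /=; apply: eq_bigr => p _.
  under eq_bigr do rewrite scaler_sumr.
  rewrite exchange_big /=; apply: eq_bigr => q _.
  transitivity (c p q * ((\sum_s e s *: \prod_k v (s k) (p k)) * \prod_k f k (q k))).
    rewrite mulr_suml mulr_sumr; apply: eq_bigr => s _.
    by rewrite -gscalerAl -gscalerAr.
  congr (_ * (_ * _)).
  transitivity (\sum_(q' : W) (\sum_s e s * M p q' s) *: \prod_k v k (q' k)).
    under [RHS]eq_bigr do rewrite scaler_suml.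
    rewrite exchange_big; apply: eq_bigr => s _.
    rewrite (prod_permute _ _ (y := fun k x => v k x)) //.
    by rewrite scaler_sumr; apply: eq_bigr => q' _; rewrite scalerA.
  rewrite (bigD1 p) //= eM eqxx scale1r [X in _ + X]big1 ?addr0 // => q' q'p.
  by rewrite eM eq_sym (negPf q'p) scale0r.
have key p q : \sum_s M p q s *: G s =
    \sum_s (\sum_q' M q' q s *: ((-1) ^+ kappa p * c p q')) * Ev s.
  pose cL p q := (-1) ^+ kappa p * \sum_s M p q s *: G s.
  pose cR p q := \sum_s (\sum_q' M q' q s *: c p q') * Ev s.
  (* [cL] and [cR] are the coefficients in (u, phi) of the two sides of the exchange identity. *)
  have cLR : cL p q = cR p q.
    apply/subr0_eq; move: p q; apply: bform_eq0 => u phi hu _ hphi.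
    transitivity (\sum_(s : 'S_N) (G s * \prod_k ev (phi (s k)) (u k) -
        bform c u (fun k => phi (s k)) * Ev s)); last first.
      by rewrite sumrB (invariant_form_exchange ci hv sv hphi hu hf) subrr.
    rewrite sumrB; transitivity (bform cL u phi - bform cR u phi).
      rewrite /bform -sumrB; apply: eq_bigr => p _.
      by rewrite -sumrB; apply: eq_bigr => q _; rewrite mulrBl.
    congr (_ - _).
    - transitivity (\sum_(s : 'S_N) \sum_(p : W) \sum_(q : W) G s * ((-1) ^+ kappa p *
          (M p q s *: (\prod_k u k (p k) * \prod_k phi k (q k))))).
        rewrite [RHS]exchange_big; apply: eq_bigr => p _.
        rewrite [RHS]exchange_big; apply: eq_bigr => q _.
        rewrite /cL mulr_sumr mulr_suml; apply: eq_bigr => s _.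
        by rewrite signrMA -!mulrA -gscalerAl -!gscalerAr.
      apply: eq_bigr => s _.
      have -> : \prod_k ev (phi (s k)) (u k) = \prod_k \sum_x u k x * phi (s k) x.
        by apply: eq_bigr => k _; exact: ev_even.
      rewrite bigA_distr_bigA mulr_sumr; apply: eq_bigr => p _ /=.
      rewrite (@prod_interleave _ _ (fun k => gpar (p k)) (fun k => gpar (p k)));
        last first.
        by move=> i j; apply: ghomog_scomm; [exact: hphi|exact: hu].
      rewrite (prod_permute _ _ (y := fun k x => phi k x)) // -mulr_sumr -mulr_sumr.
      congr (_ * (_ * _)); rewrite mulr_sumr; apply: eq_bigr => q _.
      by rewrite gscalerAr.
    - transitivity (\sum_(s : 'S_N) \sum_(p : W) \sum_(q : W) \sum_(q' : W) (c p q' *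
      (M q' q s *:
          (\prod_k u k (p k) * \prod_k phi k (q k)))) * Ev s).
        rewrite [RHS]exchange_big; apply: eq_bigr => p _.
        rewrite [RHS]exchange_big; apply: eq_bigr => q _.
        rewrite /cR mulr_suml; apply: eq_bigr => s _.
        rewrite -mulrA (ghomog_evenC _ (hEv s)) mulrA mulr_suml mulr_suml.
        by apply: eq_bigr => q' _; rewrite -gscalerAl -gscalerAr.
      apply: eq_bigr => s _; rewrite mulr_suml; apply: eq_bigr => p _.
      rewrite exchange_big mulr_suml; apply: eq_bigr => q' _ /=.
      rewrite (prod_permute _ _ (y := fun k x => phi k x)) // -mulr_suml -mulr_sumr.
      congr (_ * _ * _); rewrite mulr_sumr; apply: eq_bigr => q _.
      by rewrite gscalerAr.
  move/(congr1 (fun z => (-1) ^+ kappa p * z)): cLR; rewrite /cL signrK => ->.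
  rewrite mulr_sumr; apply: eq_bigr => s _; rewrite mulrA mulr_sumr.
  by congr (_ * _); apply: eq_bigr => q' _; rewrite gscalerAr.
rewrite -Ge.
transitivity (\sum_pq y pq *: \sum_s M pq.1 pq.2 s *: G s).
  rewrite /e; under eq_bigr do rewrite scaler_suml.
  rewrite exchange_big; apply: eq_bigr => pq _; rewrite scaler_sumr.
  by apply: eq_bigr => s _; rewrite scalerA.
under eq_bigr do rewrite key scaler_sumr.
rewrite exchange_big; apply: eq_bigr => s _; rewrite mulr_suml.
by apply: eq_bigr => pq _; rewrite gscalerAl.
Qed.
End Span.

(** * Positions of the factors of a picture *)

Section Enumerations.

Lemma index_enum_sig (I : finType) (J : I -> finType) :
  index_enum {i : I & J i} = [seq Tagged J j | i <- index_enum I, j <- index_enum (J i)].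
Proof.
rewrite ![index_enum _]unlock [@Finite.enum in LHS]unlock /= /tag_enum.
by congr flatten; apply: eq_map => i; rewrite [index_enum _]unlock.
Qed.

Lemma prod_sig (R : pzRingType) (I : finType) (J : I -> finType) (F : {i : I & J i} ->
  R) :
  \prod_z F z = \prod_i \prod_(j : J i) F (Tagged J j).
Proof.
rewrite index_enum_sig; elim: (index_enum I) => [|i s IH]; first by rewrite !big_nil.
by rewrite allpairs_cons big_cat IH big_cons big_map.
Qed.

Lemma pairwise_allpairs (T1 : eqType) (T2 : T1 -> eqType) (T : eqType) (lt : rel T1)
    (r : rel T) (f : forall i, T2 i -> T) (s1 : seq T1) (s2 : forall i, seq (T2 i)) :
  pairwise lt s1 -> (forall i i' j j', lt i i' -> r (f i j) (f i' j')) ->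
  (forall i, pairwise (fun j j' => r (f i j) (f i j')) (s2 i)) ->
  pairwise r [seq f i j | i <- s1, j <- s2 i].
Proof.
move=> + hr h2; elim: s1 => //= i s IH /andP[/allP ls ps].
rewrite pairwise_cat IH // andbT pairwise_map h2 andbT.
apply/allrelP => _ y /mapP[j _ ->] /allpairsPdep[i' [j' [i's _ ->]]].
by apply: hr; exact: ls.
Qed.

Section Lexicographic.
Variables (s : nat) (mu : 'I_s -> nat).
Local Notation J := {i : 'I_s & 'I_(mu i)}.

Definition lex_lt (p p' : J) : bool :=
  (tag p < tag p')%N || (tag p == tag p') && (tagged p < tagged p')%N.

Lemma lex_lt_irr : irreflexive lex_lt.
Proof. by move=> p; rewrite /lex_lt eqxx !ltnn. Qed.

Lemma lex_lt_asym p p' : lex_lt p p' -> ~~ lex_lt p' p.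
Proof.
rewrite /lex_lt -!val_eqE /= [(tag p' : nat) == _]eq_sym negb_or negb_and.
case: ltngtP => //= _; rewrite -leqNgt; exact: ltnW.
Qed.

Lemma lex_total p p' : [|| lex_lt p p', p == p' | lex_lt p' p].
Proof.
case: p p' => [i j] [i' j']; rewrite /lex_lt /= -[i == i']val_eqE -[i' == i]val_eqE /=.
case: (ltngtP i i') => [//|lt|/val_inj e]; first by rewrite !orbT.
case: _ / e j' => j'.
rewrite eq_Tagged /= -val_eqE /=.
by case: ltngtP.
Qed.

Lemma pairwise_lex : pairwise lex_lt (index_enum J).
Proof.
rewrite index_enum_sig.
apply: pairwise_allpairs (pairwise_index_enum_ord s) _ _ => [i i' j j' lt|i].
  by rewrite /lex_lt lt.
apply: sub_pairwise (pairwise_index_enum_ord _) => j j' lt.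
by rewrite /lex_lt /= ltnn eqxx.
Qed.

Lemma cross_lex f : cross f (index_enum J) =
  (\sum_(i < s) \sum_(j < mu i) \sum_(i' < s)
       \sum_(j' < mu i' | (i < i') || (i == i') && (j < j'))
     f (Tagged (fun i => 'I_(mu i)) j) (Tagged (fun i => 'I_(mu i)) j'))%N.
Proof.
rewrite (cross_pairwise _ lex_lt_irr lex_lt_asym pairwise_lex).
rewrite [RHS](sig_big_dep xpredT (fun (i : 'I_s) (j : 'I_(mu i)) => true)
  (fun (i : 'I_s) (j : 'I_(mu i)) => \sum_(i' < s)
     \sum_(j' < mu i' | (i < i') || (i == i') && (j < j'))
       f (Tagged (fun i => 'I_(mu i)) j) (Tagged (fun i => 'I_(mu i)) j'))%N) /=.
apply: eq_bigr => -[i j] _.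
rewrite (sig_big_dep xpredT
  (fun (i' : 'I_s) (j' : 'I_(mu i')) => (i < i') || (i == i') && (j < j'))%N
  (fun (i' : 'I_s) (j' : 'I_(mu i')) =>
     f (Tagged (fun i => 'I_(mu i)) j) (Tagged (fun i => 'I_(mu i)) j'))) /=.
by apply: eq_big => [[i' j']|[i' j'] _].
Qed.

Variable c : 'I_s -> nat.
Local Notation Z := {p : J & 'I_(c (tag p))}.

Lemma offset_lex p p' : lex_lt p p' ->
  (offset mu c (tag p) (tagged p) + c (tag p) <= offset mu c (tag p') (tagged p'))%N.
Proof.
case: p p' => [i j] [i' j'] /=; rewrite /lex_lt /= => /orP[ii'|/andP[/eqP e]].
  rewrite /offset -addnA.
  apply: leq_trans (_ : \sum_(p < s | p < i) mu p * c p + mu i * c i <= _)%N.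
    by rewrite leq_add2l -mulSnr leq_mul2r ltn_ord orbT.
  apply: leq_trans (leq_addr _ _).
  rewrite [X in (_ <= X)%N](bigD1 i) //= addnC leq_add2l.
  rewrite [X in (_ <= X)%N](bigID (fun p : 'I_s => p < i)%N) /=.
  apply: leq_trans (leq_addr _ _); rewrite leq_eqVlt; apply/orP; left; apply/eqP.
  apply: eq_bigl => p; case pi: (p < i)%N; rewrite ?andbF //= andbT.
  by rewrite (ltn_trans pi ii') -val_eqE /= ltn_eqF.
case: _ / e j' => j' jj' /=; rewrite /offset -addnA leq_add2l -mulSnr.
by rewrite leq_mul2r jj' orbT.
Qed.

Definition zpos (z : Z) : 'I_(\sum_p mu p * c p) := pos (tagged (tag z)) (tagged z).

(** [zpos] is strictly increasing for the lexicographic order because the blocks follow one another,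
    and both sides have the same length. *)
Lemma zpos_enum : map zpos (index_enum Z) = index_enum 'I_(\sum_p mu p * c p).
Proof.
have pz : pairwise (fun k l : 'I__ => (k < l)%N) (map zpos (index_enum Z)).
  rewrite index_enum_sig map_allpairs.
  apply: pairwise_allpairs pairwise_lex _ _ => [p p' l l' pp'|p].
    apply: leq_trans (leq_trans (offset_lex pp') (leq_addr _ _)).
    by rewrite /= -addnS leq_add2l.
  apply: sub_pairwise (pairwise_index_enum_ord _) => j j' lt.
  by rewrite /= ltn_add2l.
have tr : transitive (fun k l : 'I_(\sum_p mu p * c p) => (k < l)%N).
  by move=> ? ? ?; exact: ltn_trans.
apply: (irr_sorted_eq tr); first by move=> k; exact: ltnn.
- by rewrite sorted_pairwise.
- by rewrite sorted_pairwise // pairwise_index_enum_ord.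
apply: (uniq_min_size _ _ _).2 => //.
- by apply: (pairwise_uniq _ pz) => k; rewrite ltnn.
- by move=> k _; exact: mem_index_enum.
rewrite size_map -!sum1_size.
have -> : (\sum_(z <- index_enum Z) 1 = \sum_(p : J) \sum_(l < c (tag p)) 1)%N.
  by rewrite (sig_big_dep xpredT (fun p l => true) (fun p l => 1%N)).
rewrite -(sig_big_dep xpredT (fun i j => true) (fun i j => \sum_(l < c i) 1%N)) /=.
rewrite [X in (X <= _)%N](_ : _ = \sum_p mu p * c p)%N; last first.
  by rewrite sum1_size -[RHS]card_ord cardE enumT [index_enum _]unlock.
apply: leq_sum => i _; rewrite (eq_bigr (fun=> c i)) => [|j _].
  by rewrite sum_nat_const card_ord.
by rewrite sum_nat_const card_ord muln1.
Qed.

End Lexicographic.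

End Enumerations.

(** * Decomposable tensors *)

Section PureTensors.
Variable K : numFieldType.
Local Notation L := (grassmann K).
Local Notation Lc := (grassmann K)^c.
Implicit Types X Y : gset.

Lemma signr_conv n : ((-1) ^+ n : Lc) = ((-1) ^+ n : L).
Proof. by rewrite -signr_odd -[in RHS]signr_odd; case: (odd n). Qed.

Lemma ghomog_scomm_conv p q (x y : L) : ghomog p x -> ghomog q y -> @scomm Lc p q x y.
Proof.
move=> hx hy; rewrite /scomm signr_conv.
change ((y : L) * x = (x * y) * (-1) ^+ (p * q)).
by rewrite signrM_comm mulnC; exact: (ghomog_scomm hy hx).
Qed.

Fixpoint tprod X b : ('I_b -> fmod K X) -> fmod K (gpow X b) :=
  match b with
  | 0 => fun=> [ffun=> 1]
  | b'.+1 => fun u => tens (u ord0) (tprod (fun k => u (lift ord0 k)))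
  end.

Lemma tprod_even X b (u : 'I_b -> fmod K X) :
  (forall k, fhomog false (u k)) -> fhomog false (tprod u).
Proof.
elim: b u => [|b IH] u hu /=; first by move=> x; rewrite ffunE; exact: ghomog1.
by apply: (@tens_homog K _ _ false false); [exact: hu|apply: IH => k; exact: hu].
Qed.

Lemma powmap_tprod X b (h : fmod K X -> fmod K X) (u : 'I_b -> fmod K X) :
  even_endo h -> @powmap K X h b (tprod u) = tprod (fun k => h (u k)).
Proof.
move=> eh; elim: b u => [|b IH] u //=.
by rewrite tmap_tens //; [rewrite IH|exact: even_endo_powmap].
Qed.

(* In the converse ring the coordinates of a pure tensor are the products, in   *)
(* the order of the factors, of the coordinates of the factors.                *)
Lemma tens_conv X Y (v : fmod K X) (w : fmod K Y) z :
  fhomog false v -> tens v w z = w z.2 * v z.1.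
Proof.
move=> hv; rewrite ffunE; have h : ghomog (gpar z.1) (v z.1) by exact: hv.
by rewrite (gsupercomm _ h) sgncK addbb sgnc_false.
Qed.

Lemma tprod_gtup X b (u : 'I_b -> fmod K X) (r : 'I_b -> X) :
  (forall k, fhomog false (u k)) ->
  tprod u (gtup r) = \prod_(k < b) (u k (r k) : Lc).
Proof.
elim: b u r => [|b IH] u r hu /=; first by rewrite ffunE big_ord0.
by rewrite tens_conv // IH // big_ord_recl.
Qed.

Lemma gpar_gtup X b (r : 'I_b -> X) :
  gpar (gtup r) = odd (\sum_(k < b) gpar (r k)) :> bool.
Proof.
elim: b r => [|b IH] r /=; first by rewrite big_ord0.
by rewrite IH big_ord_recl oddD oddb.
Qed.

Fixpoint untup X b : gpow X b -> 'I_b -> X :=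
  match b with
  | 0 => fun _ k => match (notF (ltn_ord k)) with end
  | b'.+1 => fun z k => if unlift ord0 k is Some k' then untup z.2 k' else z.1
  end.

Lemma untupK X b (z : gpow X b) : gtup (untup z) = z.
Proof.
elim: b z => [|b IH] /=; first by case.
case=> x z; rewrite unlift_none; congr (_, _); rewrite -[RHS]IH.
by congr gtup; apply/funext => k; rewrite liftK.
Qed.

Section Sum.
Variables (s : nat) (Y : 'I_s -> gset).

(** Writing the embedding of a summand as a sum avoids transporting an index along an equality of
    tags. *)
Definition inj_sum i (v : fmod K (Y i)) : fmod K (gsum Y) :=
  [ffun z => \sum_x (if z == Tagged (fun i => gcar (Y i)) x then v x else 0)].

Lemma inj_sumE i (v : fmod K (Y i)) x : inj_sum v (Tagged (fun i => gcar (Y i)) x) = v x.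
Proof.
rewrite ffunE (bigD1 x) //= eqxx big1 ?addr0 // => y yx.
by rewrite eq_Tagged /= eq_sym (negPf yx).
Qed.

Lemma inj_sum_out i (v : fmod K (Y i)) z : tag z != i -> inj_sum v z = 0.
Proof.
move=> zi; rewrite ffunE big1 // => x _; case: eqP => // e.
by rewrite e eqxx in zi.
Qed.

Lemma inj_sum_even i (v : fmod K (Y i)) : fhomog false v -> fhomog false (inj_sum v).
Proof.
move=> hv z; rewrite ffunE; apply: ghomog_sum => x _.
by case: eqP => [->|_]; [exact: hv|exact: ghomog0].
Qed.

Lemma summap_inj_sum (h : forall i, fmod K (Y i) -> fmod K (Y i)) i v :
  (forall i, even_endo (h i)) -> summap h (@inj_sum i v) = inj_sum (h i v).
Proof.
move=> eh; apply/ffunP => -[j x]; rewrite ffunE /=.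
have [e|ji] := eqVneq j i.
  case: _ / (esym e) x => x; rewrite inj_sumE; congr (h i _ x).
  by apply/ffunP => y; rewrite ffunE inj_sumE.
rewrite [RHS]inj_sum_out //;
  have -> : [ffun x => inj_sum v (Tagged (fun i => gcar (Y i)) x)] = 0 :> fmod K (Y j).
  by apply/ffunP => y; rewrite ffunE inj_sum_out // ffunE.
by rewrite even_endo0 // ffunE.
Qed.

End Sum.
End PureTensors.

Lemma scomm_odd (R : pzRingType) p q (x y : R) : scomm (odd p) (odd q) x y -> scomm p q
  x y.
Proof. by rewrite /scomm -[(-1) ^+ (p * q)]signr_odd oddM mulnb. Qed.

Lemma prod_signs (R : pzRingType) (I : Type) (s : seq I) (d : I -> nat) (x : I -> R) :
  \prod_(i <- s) ((-1) ^+ d i * x i) = (-1) ^+ (\sum_(i <- s) d i) * \prod_(i <- s) x i.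
Proof.
elim: s => [|i s IH]; first by rewrite !big_nil mul1r.
by rewrite !big_cons IH exprD -!mulrA signrMA.
Qed.

Lemma prod_zpos (R : pzRingType) s (mu c : 'I_s -> nat) (F : 'I_(\sum_p mu p * c p) ->
  R) :
  \prod_(p : {i : 'I_s & 'I_(mu i)}) \prod_(l < c (tag p)) F (pos (tagged p) l) =
    \prod_k F k.
Proof.
rewrite -(prod_sig (fun z : {p : {i : 'I_s & 'I_(mu i)} & 'I_(c (tag p))} => F (zpos z))).
by rewrite -[in RHS]zpos_enum big_map.
Qed.

Section Slots.
Variables (K : numFieldType) (m n s : nat) (b t : 'I_s -> nat).
Local Notation L := (grassmann K).
Local Notation Lc := (grassmann K)^c.
Local Notation X := (gV m n).
Local Notation W := (gW m n b t).

Definition decomposable i (u : 'I_(b i) -> fmod K X) (f : 'I_(t i) -> fmod K X) : fmod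
  K W :=
  inj_sum (Y := fun i => gUbt m n (b i) (t i)) (tens (tprod u) (tprod f) : fmod K (gUbt
    m n (b i) (t i))).

Lemma decomposable_even i u f :
  (forall k, fhomog false (u k)) -> (forall k, fhomog false (f k)) ->
  fhomog false (@decomposable i u f).
Proof.
move=> hu hf; apply: inj_sum_even.
by apply: (@tens_homog K _ _ false false); exact: tprod_even.
Qed.

Lemma Wact_even (g : GL K m n) : even_endo (@Wact K m n s b t g).
Proof.
apply: even_endo_summap => i; apply: even_endo_tmap.
  exact/even_endo_powmap/gl_even.
exact/even_endo_powmap/even_endo_dmap/gl_even.
Qed.

Lemma Wact_decomposable (g : GL K m n) i u f :
  Wact g (@decomposable i u f) =
  decomposable (fun k => g (u k)) (fun k => dmap (gl_V g) (f k)).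
Proof.
have eg := gl_even g; have ed := even_endo_dmap (gl_even (gl_V g)).
rewrite /Wact summap_inj_sum => [|j]; last first.
  by apply: even_endo_tmap; exact: even_endo_powmap.
rewrite /decomposable /Uact tmap_tens; [|exact: even_endo_powmap|exact: even_endo_powmap].
by rewrite !powmap_tprod.
Qed.

Lemma seval_SWact (g : GL K m n) (v : fmod K W) (x : symalg K W) : fhomog false v ->
  seval v (SWact (gl_V g) x) = seval (Wact g v) x.
Proof. by move=> hv; rewrite -(seval_sact _ (Wact_even g) hv). Qed.

Variables (mu : 'I_s -> nat) (N : nat) (eN : (\sum_p mu p * t p = N)%N).
Local Notation J := {i : 'I_s & 'I_(mu i)}.
Local Notation M := (\sum_p mu p * b p)%N.

(** N is kept free so that upper positions can be indexed by the sum of the [mu p * t p] itself or,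
    in the balanced case, by the same type as the lower positions. *)
Definition up (i : 'I_s) (j : 'I_(mu i)) (k : 'I_(t i)) : 'I_N := cast_ord eN (pos j k).

Definition slot (u : 'I_M -> fmod K X) (f : 'I_N -> fmod K X) (p : J) : fmod K W :=
  decomposable (fun l : 'I_(b (tag p)) => u (pos (tagged p) l)) (fun k => f (up (tagged
    p) k)).

Definition slot_word (r : 'I_M -> X) (q : 'I_N -> X) (p : J) : W :=
  Tagged (fun i => gcar (gUbt m n (b i) (t i)))
    (gtup (fun l : 'I_(b (tag p)) => r (pos (tagged p) l)),
     gtup (fun k : 'I_(t (tag p)) => q (up (tagged p) k))).

Lemma slot_even u f p : (forall k, fhomog false (u k)) -> (forall k, fhomog false (f
  k)) ->
  fhomog false (slot u f p).
Proof. by move=> hu hf; exact: decomposable_even. Qed.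

Lemma prod_up (R : pzRingType) (F : 'I_N -> R) :
  \prod_(p : J) \prod_(k < t (tag p)) F (up (tagged p) k) = \prod_k F k.
Proof.
rewrite (prod_zpos (fun k => F (cast_ord eN k))).
by case: _ / eN F => F; apply: eq_bigr => k _; rewrite cast_ord_id.
Qed.

Section SlotSigns.
Variables (a : 'I_M -> nat) (a' : 'I_N -> nat).

Definition lpar (p : J) : nat := (\sum_(l < b (tag p)) a (pos (tagged p) l))%N.
Definition upar (p : J) : nat := (\sum_(k < t (tag p)) a' (up (tagged p) k))%N.
Definition slot_par (p : J) : nat := (lpar p + upar p)%N.

(** The three terms come from the sign in [coordf] at each slot, from reversing the order of the
    slots, and from moving upper parts past lower parts. *)
Definition slot_sign : nat :=
  (\sum_p slot_par p + cross (fun p p' => slot_par p * slot_par p') (index_enum J)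
   + cross (fun p p' => upar p * lpar p') (index_enum J))%N.
End SlotSigns.

Section SlotProduct.
Variables (u : 'I_M -> fmod K X) (f : 'I_N -> fmod K X).
Hypotheses (hu : forall k, fhomog false (u k)) (hf : forall k, fhomog false (f k)).
Variables (r : 'I_M -> X) (q : 'I_N -> X).
Local Notation a := (fun k => gpar (r k) : nat).
Local Notation a' := (fun k => gpar (q k) : nat).

Let lprod (p : J) : L := \prod_(l < b (tag p)) (u (pos (tagged p) l) (r (pos (tagged p)
  l)) : Lc).
Let uprod (p : J) : L := \prod_(k < t (tag p)) (f (up (tagged p) k) (q (up (tagged p)
  k)) : Lc).

Lemma ghomog_prodc (I : Type) (e : seq I) (p : I -> bool) (F : I -> L) :
  (forall i, ghomog (p i) (F i)) ->
  ghomog (odd (\sum_(i <- e) p i)) (\prod_(i <- e) (F i : Lc) : L).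
Proof.
move=> hF; elim: e => [|i e IH]; first by rewrite !big_nil; exact: ghomog1.
by rewrite !big_cons oddD oddb addbC; apply: ghomogM.
Qed.

Lemma lprod_homog p : ghomog (odd (lpar a p)) (lprod p).
Proof. by apply: ghomog_prodc => l; exact: hu. Qed.

Lemma uprod_homog p : ghomog (odd (upar a' p)) (uprod p).
Proof. by apply: ghomog_prodc => l; exact: hf. Qed.

Lemma coordf_slot p :
  coordf (slot u f p) (slot_word r q p) = (-1) ^+ slot_par a a' p * (uprod p * lprod p).
Proof.
rewrite /coordf /slot_word /slot /decomposable inj_sumE tens_conv;
  last by exact: tprod_even.
rewrite /= !tprod_gtup // -/(uprod p) -/(lprod p).
rewrite (sgnc_homog _ (ghomogM (@uprod_homog p) (@lprod_homog p))) !gpar_gtup.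
rewrite -[in RHS]signr_odd oddD [in LHS]addbC -/(upar a' p) -/(lpar a p).
by rewrite [odd (lpar _ _) (+) _]addbC andbb.
Qed.

Lemma slot_product :
  \prod_p coordf (slot u f p) (slot_word r q p) = (-1) ^+ slot_sign a a' *
    ((\prod_k (f k (q k) : Lc) : L) * (\prod_k (u k (r k) : Lc) : L)).
Proof.
rewrite (eq_bigr _ (fun p _ => coordf_slot p)) prod_signs /slot_sign -addnA exprD -mulrA.
congr (_ * _); rewrite exprD.
have V_homog p : ghomog (odd (slot_par a a' p)) (uprod p * lprod p).
  by rewrite oddD addbC; apply: ghomogM; [exact: uprod_homog|exact: lprod_homog].
(* Passing to the converse ring reverses the product; [prod_rev] restores the order of the slots at
   the cost of a sign. *)
rewrite -{1}[index_enum J]revK -rev_prodr.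
rewrite (@prod_rev Lc J (slot_par a a')) => [|p p']; last first.
  by apply/scomm_odd/ghomog_scomm_conv.
rewrite (@prod_interleave Lc J (lpar a) (upar a') lprod uprod) => [|p p']; last first.
  by apply/scomm_odd/ghomog_scomm_conv; [exact: uprod_homog|exact: lprod_homog].
rewrite (prod_zpos (fun k => u k (r k) : Lc)) (prod_up (fun k => f k (q k) : Lc)).
set c1 := cross _ _; set c2 := cross (fun i j => upar _ i * _)%N _.
(* Products of the converse ring are read in [grassmann], which reverses their factors. *)
change ((\prod_k (f k (q k) : Lc) : L) * (\prod_k (u k (r k) : Lc) : L) *
  ((-1) ^+ c2 : Lc) * ((-1) ^+ c1 : Lc) = (-1) ^+ c1 * (-1) ^+ c2 *
    ((\prod_k (f k (q k) : Lc) : L) * (\prod_k (u k (r k) : Lc) : L))).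
rewrite !signr_conv; set z := (_ * _ : L).
by rewrite -[RHS]mulrA -[RHS]signrM_comm -[in RHS]signrM_comm.
Qed.

End SlotProduct.
End Slots.

(** * Values of the picture invariants *)

Lemma sum_up s (mu t : 'I_s -> nat) N (eN : (\sum_p mu p * t p = N)%N) (F : 'I_N -> nat) :
  (\sum_k F k = \sum_(p : {i : 'I_s & 'I_(mu i)}) \sum_(k < t (tag p)) F (up eN (tagged
    p) k))%N.
Proof.
have -> : (\sum_k F k = \sum_k F (cast_ord eN k))%N.
  by case: _ / eN F => F; apply: eq_bigr => k _; rewrite cast_ord_id.
rewrite -[in LHS]zpos_enum big_map.
by rewrite (sig_big_dep xpredT (fun p l => true) (fun (p : {i : 'I_s & 'I_(mu i)}) (k :
  'I_(t (tag p))) => F (up eN (tagged p) k))).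
Qed.

Section PictureForms.
Variables (K : numFieldType) (m n s : nat) (b t : 'I_s -> nat).
Local Notation L := (grassmann K).
Local Notation Lc := (grassmann K)^c.
Local Notation X := (gV m n).
Local Notation W := (gW m n b t).

Lemma prod_conv_sign n0 (p : 'I_n0 -> nat) : exists e, forall y : 'I_n0 -> L,
  (forall k k', scomm (p k) (p k') (y k) (y k')) ->
  (\prod_k (y k : Lc) : L) = (-1) ^+ e * \prod_k y k.
Proof.
exists (cross (fun i j => p i * p j)%N (index_enum 'I_n0)) => y hy.
by rewrite rev_prodr (prod_rev hy).
Qed.

Section Unbalanced.
Variables (mu : 'I_s -> nat) (N : nat) (eN : (\sum_p mu p * t p = N)%N).
Local Notation J := {i : 'I_s & 'I_(mu i)}.
Local Notation M := (\sum_p mu p * b p)%N.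

(** The sign depends on the words r and q only, so it can be moved into the coefficients
    ([slot_formE]), and results on [bform] apply to slots. *)
Lemma slot_bform : exists e : {ffun 'I_M -> X} -> {ffun 'I_N -> X} -> nat,
  forall (u : 'I_M -> fmod K X) (f : 'I_N -> fmod K X),
  (forall k, fhomog false (u k)) -> (forall k, fhomog false (f k)) ->
  forall (r : {ffun 'I_M -> X}) (q : {ffun 'I_N -> X}),
  \prod_p coordf (slot (mu := mu) (b := b) eN u f p) (slot_word eN r q p) =
  (-1) ^+ e r q * (\prod_k u k (r k) * \prod_k f k (q k)).
Proof.
have e1 (r : {ffun 'I_M -> X}) := prod_conv_sign (fun k => gpar (r k)).
have e2 (q : {ffun 'I_N -> X}) := prod_conv_sign (fun k => gpar (q k)).
pose a (r : {ffun 'I_M -> X}) k : nat := gpar (r k).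
pose a' (q : {ffun 'I_N -> X}) k : nat := gpar (q k).
exists (fun r q => slot_sign (b := b) eN (a r) (a' q) + (sval (cid (e2 q)) + sval (cid
  (e1 r)) +
  (\sum_k a' q k) * (\sum_k a r k)))%N.
move=> u f hu hf r q; rewrite slot_product // exprD -!mulrA; congr (_ * _).
rewrite (svalP (cid (e1 r))) => [|k k']; last exact: ghomog_scomm (hu _ _) (hu _ _).
rewrite (svalP (cid (e2 q))) => [|k k']; last exact: ghomog_scomm (hf _ _) (hf _ _).
rewrite -mulrA signrMA !exprD -!mulrA; congr (_ * (_ * _)).
have : scomm (\sum_k a' q k)%N (\sum_k a r k)%N (\prod_k f k (q k)) (\prod_k u k (r k)).
  apply: scomm_prod => k _; apply/scomm_sym/scomm_prod => k' _; apply: scomm_sym.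
  by apply: ghomog_scomm; [exact: hf|exact: hu].
by [].
Qed.

Definition slot_form (c : {ffun 'I_M -> X} -> {ffun 'I_N -> X} -> L) u f : L :=
  \sum_r \sum_q c r q * \prod_p coordf (slot (mu := mu) (b := b) eN u f p) (slot_word
    eN r q p).

Lemma slot_formE : exists e : {ffun 'I_M -> X} -> {ffun 'I_N -> X} -> nat, forall c u f,
  (forall k, fhomog false (u k)) -> (forall k, fhomog false (f k)) ->
  slot_form c u f = bform (fun r q => c r q * (-1) ^+ e r q) u f.
Proof.
have [e eE] := slot_bform; exists e => c u f hu hf.
apply: eq_bigr => r _; apply: eq_bigr => q _; by rewrite eE // -mulrA.
Qed.

Lemma slot_form_eq0 c : (forall u f,
    (forall k, fhomog false (u k)) -> (forall k, null_square (u k)) ->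
    (forall k, fhomog false (f k)) -> slot_form c u f = 0) ->
  forall r q, c r q = 0.
Proof.
have [e eE] := slot_formE => c0 r q.
have : c r q * (-1) ^+ e r q = 0.
  move: r q; apply: bform_eq0 => u f hu su hf; rewrite -eE //; exact: c0.
by move/(congr1 (fun z => z * (-1) ^+ e r q)); rewrite mul0r -mulrA -exprD addnn
  -signr_odd odd_double mulr1.
Qed.

End Unbalanced.

Section Picture.
Variable P : picture b t.
Local Notation mu := (pmul P).
Local Notation sigma := (pperm P).
Local Notation N := (\sum_p pmul P p * b p)%N.
Local Notation J := {i : 'I_s & 'I_(mu i)}.

Lemma phiE : phi K m n P = \sum_(r : {ffun 'I_N -> X})
  (gamma K (P := P) (fun k => gpar (r k)) * (-1) ^+ qexp (P := P) (fun k => gpar (r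
    k))) *:
  \prod_p svar K (slot_word (pbal P) (fun k => r (sigma k)) r p).
Proof. by apply: eq_bigr => r _; rewrite prod_sig. Qed.

Lemma gammaE (a : 'I_N -> nat) : gamma K (P := P) a = (-1) ^+ inversions a (map sigma
  (index_enum 'I_N)).
Proof.
rewrite (inversions_perm a sigma) -prodrXr; apply: eq_bigr => k _.
by rewrite -prodrXr.
Qed.

(** A position lies below the offset of slot p' exactly when it is an upper position of an earlier
    slot; this turns the first sum of the exponent into a [cross]. *)
Lemma qexpE (a : 'I_N -> nat) : qexp (P := P) a =
  (cross (fun p p' => upar (pbal P) a p * lpar (b := b) (mu := mu) (fun k => a (sigma
    k)) p')%N (index_enum J)
   + \sum_k a k + cross (fun k l => a k * a l)%N (index_enum 'I_N)
   + cross (fun p p' => slot_par (pbal P) (fun k => a (sigma k)) a p * slot_par (pbal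
     P) (fun k => a (sigma k)) a p')%N
       (index_enum J))%N.
Proof.
rewrite /qexp cross_ord [X in _ = (_ + X)%N]cross_lex; congr (_ + _ + _ + _)%N.
rewrite (cross_pairwise _ (@lex_lt_irr _ mu) (@lex_lt_asym _ mu) (pairwise_lex mu)).
rewrite (exchange_big_dep xpredT) //=.
rewrite (sig_big_dep xpredT (fun (i : 'I_s) (j : 'I_(mu i)) => true)
  (fun (i : 'I_s) (j : 'I_(mu i)) => (\sum_(l < b i) a (lower j l)) *
     (\sum_(k < N | (k < offset mu t i j)) a k))%N) /=.
apply: eq_bigr => p' _; rewrite -big_distrl /= mulnC; congr (_ * _)%N.
rewrite big_mkcond (sum_up (pbal P) (fun k => if (k < offset mu t (tag p') (tagged
  p'))%N then a k else 0%N)).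
rewrite [RHS]big_mkcond; apply: eq_bigr => p _; rewrite /upar.
have lt_up k : (up (pbal P) (tagged p) k < offset mu t (tag p') (tagged p'))%N = lex_lt
  p p'.
  apply/idP/idP => [lt|pp'].
    have /or3P[//|/eqP pp'|p'p] := lex_total p p'.
      by move: lt; rewrite /= -pp' ltnNge leq_addr.
    move: lt; rewrite ltnNge (leq_trans _ (leq_addr _ _)) //.
    by apply: leq_trans (offset_lex t p'p); exact: leq_addr.
  by apply: leq_trans (offset_lex t pp'); rewrite /= -addnS leq_add2l.
case pp': (lex_lt p p') lt_up => lt_up; last by rewrite big1 // => k _; rewrite lt_up.
by apply: eq_bigr => k _; rewrite lt_up.
Qed.

(** Every [cross] and the inversions occur twice, once in the definition of the picture and once
    from reordering. The slot parities add up to an even number, each index being counted once below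
    and once above. What is left is the sign built into [ev]. *)
Lemma phi_exponent (a : 'I_N -> nat) :
  odd (inversions a (map sigma (index_enum 'I_N)) + qexp (P := P) a
     + slot_sign (pbal P) (fun k => a (sigma k)) a
     + inversions a (map sigma (index_enum 'I_N))
     + cross (fun k l => a k * a l)%N (index_enum 'I_N)) = odd (\sum_k a k).
Proof.
have e : (\sum_p slot_par (mu := mu) (b := b) (pbal P) (fun k => a (sigma k)) a p =
  (\sum_k a k).*2)%N.
  rewrite big_split /= -addnn; congr (_ + _)%N; last by rewrite -sum_up.
  rewrite (reindex_inj (@perm_inj _ sigma)) -[in RHS]zpos_enum big_map.
  by rewrite (sig_big_dep xpredT (fun p l => true)
    (fun (p : J) (l : 'I_(b (tag p))) => a (sigma (pos (tagged p) l)))).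
rewrite qexpE /slot_sign e !oddD odd_double.
case: (odd (inversions _ _)); case: (odd (\sum_k a k));
by case: (odd (cross _ _)); case: (odd (cross _ _)); case: (odd (cross _ _)).
Qed.

Lemma cross0 (I : Type) (e : seq I) : cross (fun _ _ => 0 * 0)%N e = 0%N.
Proof. by elim: e => //= i e ->; rewrite big1. Qed.

Lemma prod_even_conv (I : finType) (x : I -> L) : (forall i, ghomog false (x i)) ->
  (\prod_i (x i : Lc) : L) = \prod_i x i.
Proof.
move=> hx; rewrite rev_prodr (@prod_rev _ _ (fun=> 0%N)) ?cross0 ?mul1r // => i j.
by rewrite /scomm mul1r; exact: ghomog_evenC.
Qed.

Lemma phi_eval (u f : 'I_N -> fmod K X) :
  (forall k, fhomog false (u k)) -> (forall k, fhomog false (f k)) ->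
  \sum_(r : {ffun 'I_N -> X})
  (gamma K (P := P) (fun k => gpar (r k)) * (-1) ^+ qexp (P := P) (fun k => gpar (r k))) *
  \prod_p coordf (slot (pbal P) u f p) (slot_word (pbal P) (fun k => r (sigma k)) r p) =
  \prod_k ev (f k) (u (sigma^-1 k))%g.
Proof.
move=> hu hf; rewrite /ev bigA_distr_bigA; apply: eq_bigr => r _ /=.
pose a k : nat := gpar (r k); pose y k : L := u (sigma^-1%g k) (r k).
have hy k : ghomog (gpar (r k)) (y k) by exact: hu.
have hfr k : ghomog (gpar (r k)) (f k (r k)) by exact: hf.
rewrite -/a slot_product //.
(* Sorting the lower factors by sigma produces the sign [gamma]. *)
have U1 : (\prod_k (u k (r (sigma k)) : Lc) : L) =
    (-1) ^+ inversions a (map sigma (index_enum 'I_N)) * (\prod_k (y k : Lc) : L).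
  rewrite -signrM_comm -[in RHS]signr_conv.
  transitivity (\prod_k (y (sigma k) : Lc) : L).
    by apply: eq_bigr => k _; rewrite /y permK.
  apply: (@prod_bij Lc _ a (fun k => y k : Lc)) => [i j|].
    exact: ghomog_scomm_conv.
  by exists (sigma^-1)%g; [exact: permK|exact: permKV].
(* Each [f k] is paired with [y k]; the pairs are even, so their product is the same in the converse
   ring. *)
have U2 : (\prod_k (f k (r k) : Lc) : L) * (\prod_k (y k : Lc) : L) =
    (-1) ^+ cross (fun k l => a k * a l)%N (index_enum 'I_N) * \prod_k (f k (r k) * y k).
  rewrite -[\prod_k (_ * _)]prod_even_conv => [|k]; last first.
    by rewrite -(addbb (gpar (r k))); apply: ghomogM.
  have := @prod_interleave Lc _ a a (fun k => y k : Lc) (fun k => f k (r k) : Lc)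
    (index_enum 'I_N).
  move=> /(_ (fun i j => ghomog_scomm_conv (hfr i) (hy j))) e.
  rewrite [X in _ = _ * X]e.
  change ((\prod_k (f k (r k) : Lc) : L) * (\prod_k (y k : Lc) : L) = (-1) ^+ cross
    (fun k l => a k * a l)%N (index_enum 'I_N) *
    ((\prod_k (f k (r k) : Lc) : L) * (\prod_k (y k : Lc) : L) *
      ((-1) ^+ cross (fun k l => a k * a l)%N (index_enum 'I_N) : Lc)) :> L).
  by rewrite signr_conv signrM_comm signrK.
rewrite U1 [_ * ((-1) ^+ inversions _ _ * _)]signrMA U2 gammaE.
transitivity ((-1) ^+ (\sum_k a k) * \prod_k (f k (r k) * y k)).
  rewrite !mulrA -!exprD; congr (_ * _).
  by rewrite -[LHS]signr_odd -[RHS]signr_odd (phi_exponent a).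
rewrite -prod_signs; apply: eq_bigr => k _.
by rewrite (sgnc_homog _ (hy k)) andbb signrMA.
Qed.
End Picture.
End PictureForms.

(** * Invariants and pictures *)

Section Assembly.
Variables (K : numFieldType) (m n s : nat) (b t : 'I_s -> nat).
Local Notation L := (grassmann K).
Local Notation X := (gV m n).
Local Notation W := (gW m n b t).

Lemma gtupK (Y : gset) c (r : 'I_c -> Y) k : untup (gtup r) k = r k.
Proof.
elim: c r k => [|c IH] r k /=; first by case: k.
by case: unliftP => [k' ->|-> //]; rewrite IH.
Qed.

Lemma zpos_bij (mu c : 'I_s -> nat) : bijective (@zpos s mu c).
Proof.
have ie (T : finType) : enum T = index_enum T by rewrite enumT [index_enum T]unlock.
apply: inj_card_bij.
  apply/injectiveP; rewrite /injectiveb /dinjectiveb.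
  by rewrite ie zpos_enum index_enum_uniq.
by rewrite !cardE !ie -zpos_enum size_map.
Qed.

Section Typed.
Variables (mu : 'I_s -> nat) (N : nat) (eN : (\sum_p mu p * t p = N)%N).
Local Notation J := {i : 'I_s & 'I_(mu i)}.
Local Notation M := (\sum_p mu p * b p)%N.

Definition slot_fun (rq : {ffun 'I_M -> X} * {ffun 'I_N -> X}) : {ffun J -> W} :=
  [ffun p => slot_word eN rq.1 rq.2 p].

Lemma up_zpos (p : J) (k : 'I_(t (tag p))) :
  up eN (tagged p) k = cast_ord eN (zpos (Tagged (fun p : J => 'I_(t (tag p))) k)).
Proof. by []. Qed.

Lemma slot_fun_inj : injective slot_fun.
Proof.
move=> [r q] [r' q'] /ffunP e; have [zb _ zbK] := zpos_bij mu b;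
  have [zt _ ztK] := zpos_bij mu t.
have {}e (p : J) : gtup (fun l : 'I_(b (tag p)) => r (pos (tagged p) l)) =
      gtup (fun l : 'I_(b (tag p)) => r' (pos (tagged p) l)) /\
    gtup (fun k : 'I_(t (tag p)) => q (up eN (tagged p) k)) =
      gtup (fun k : 'I_(t (tag p)) => q' (up eN (tagged p) k)).
  by have := e p; rewrite !ffunE => /eqP; rewrite eq_Tagged => /eqP[].
congr (_, _); apply/ffunP => k.
  rewrite -(zbK k); case: (zb k) => p l; have [/(congr1 (fun z => untup z l)) + _] := e p.
  by rewrite !gtupK.
have [k' ->] : exists k', k = cast_ord eN k' by exists (cast_ord (esym eN) k);
  rewrite cast_ordKV.
rewrite -(ztK k'); case: (zt k') => p l; have [_ /(congr1 (fun z => untup z l))] := e p.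
by rewrite !gtupK.
Qed.

Lemma slot_fun_surj (U : {ffun J -> W}) : (forall p : J, tag (U p) = tag p) ->
  exists rq, U = slot_fun rq.
Proof.
move=> tU; have [zb zbK zbK'] := zpos_bij mu b; have [zt ztK ztK'] := zpos_bij mu t.
have h p : exists z : gpow X (b (tag p)) * gpow X (t (tag p)),
    U p = Tagged (fun i => gcar (gUbt m n (b i) (t i))) z.
  by move: (tU p); case: (U p) => i z /= e; case: _ / e z => z; exists z.
pose z p := sval (cid (h p)); have zE p : U p = Tagged _ (z p) := svalP (cid (h p)).
pose r := [ffun k => untup (z (tag (zb k))).1 (tagged (zb k))] : {ffun 'I_M -> X}.
pose q := [ffun k => let y := zt (cast_ord (esym eN) k) in untup (z (tag y)).2 (tagged y)]
  : {ffun 'I_N -> X}.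
exists (r, q); apply/ffunP => p; rewrite zE ffunE; congr (Tagged _ _).
rewrite [z p]surjective_pairing; congr (_, _); rewrite -[LHS]untupK; congr gtup;
  apply/funext => k.
  rewrite /= ffunE; have -> : pos (tagged p) k = zpos (Tagged (fun p : J => 'I_(b (tag
    p))) k) by [].
  by rewrite zbK.
by rewrite /= ffunE up_zpos /= cast_ordK ztK.
Qed.

(** Families whose p-th entry lies in the summand [tag p] correspond to pairs (r, q), cut into
    blocks. *)
Lemma typed_sum (V : nmodType) (F : {ffun J -> W} -> V) :
  (forall (U : {ffun J -> W}) (p : J), tag (U p) != tag p -> F U = 0) ->
  \sum_U F U = \sum_r \sum_q F (slot_fun (r, q)).
Proof.
move=> F0; rewrite pair_big /=.
transitivity (\sum_(U in slot_fun @: [set: _]) F U).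
  rewrite [RHS]big_mkcond; apply: eq_bigr => U _; case: ifP => // /negbT Un.
  have [p pU] : exists p : J, tag (U p) <> tag p.
    apply/existsNP => tU; have [rq Urq] := slot_fun_surj tU.
    by case/imsetP: Un; exists rq; rewrite ?inE.
  by rewrite (F0 U p) //; apply/eqP.
rewrite big_imset /=; last by move=> rq rq' _ _; exact: slot_fun_inj.
by apply: eq_big => [rq|[r q] _]; rewrite ?inE.
Qed.

End Typed.
End Assembly.

(** * Sorting an element by the summands of W *)

Section Components.
Variables (K : numFieldType) (m n s : nat) (b t : 'I_s -> nat).
Local Notation L := (grassmann K).
Local Notation X := (gV m n).
Local Notation W := (gW m n b t).

Definition slot_sum (mu : 'I_s -> nat) N (eN : (\sum_p mu p * t p = N)%N)
    (c : {ffun 'I_(\sum_p mu p * b p)%N -> X} -> {ffun 'I_N -> X} -> L) : symalg K W :=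
  \sum_r \sum_q c r q *: \prod_p svar K (slot_word (b := b) eN r q p).

Definition tag_part d (C : {ffun 'I_d -> W} -> L) (tau : {ffun 'I_d -> 'I_s}) (u :
  {ffun 'I_d -> W}) : L :=
  if [ffun k => tag (u k)] == tau then C u else 0.

Lemma sform_tag_part d (C : {ffun 'I_d -> W} -> L) :
  sform C = \sum_tau sform (tag_part C tau).
Proof.
rewrite /sform [RHS]exchange_big; apply: eq_bigr => u _ /=.
rewrite (bigD1 [ffun k => tag (u k)]) //= /tag_part eqxx [X in _ + X]big1 ?addr0 // =>
  tau ne.
by rewrite eq_sym (negPf ne) scale0r.
Qed.

(** [mu i] is the number of factors lying in summand i; enumerating each fibre of tau numbers its
    slots. *)
Lemma fibre_slots d (tau : 'I_d -> 'I_s) : exists (mu : 'I_s -> nat)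
  (h : {i : 'I_s & 'I_(mu i)} -> 'I_d) (g : 'I_d -> {i : 'I_s & 'I_(mu i)}),
  [/\ cancel h g, cancel g h & forall p, tau (h p) = tag p].
Proof.
pose A i := [pred k | tau k == i]; pose mu i := #|A i|.
pose J := {i : 'I_s & 'I_(mu i)}.
pose h (p : J) : 'I_d := enum_val (tagged p : 'I_#|A (tag p)|).
have tau_h p : tau (h p) = tag p by apply/eqP;
  have := enum_valP (tagged p : 'I_#|A (tag p)|).
have Ak k : k \in A (tau k) by rewrite inE.
pose g k : J := Tagged (fun i => 'I_(mu i)) (enum_rank_in (Ak k) k).
have gK : cancel g h by move=> k; rewrite /h /g /= enum_rankK_in.
have h_inj : injective h.
  move=> p p' e; have := tau_h p'; rewrite -e tau_h => e1.
  case: p p' e e1 => [i j] [i' j'] /= e e1; case: _ / e1 j' e => j' e.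
  by congr Tagged; exact: enum_val_inj e.
by exists mu, h, g; split=> //; exact: inj_can_sym gK h_inj.
Qed.

(** [reform] along the bijection of [fibre_slots] puts the factors into slot order. At slots the
    whole of C has the same value as its part of type tau, because the coordinates of a slot vanish
    outside its summand. *)
Lemma tag_part_slots d (C : {ffun 'I_d -> W} -> L) (tau : {ffun 'I_d -> 'I_s}) :
  exists (mu : 'I_s -> nat) (g : 'I_d -> {i : 'I_s & 'I_(mu i)}),
  forall N (eN : (\sum_p mu p * t p = N)%N), exists c,
    sform (tag_part C tau) = slot_sum eN c /\
    forall u f, (forall k, fhomog false (u k)) -> (forall k, fhomog false (f k)) ->
      slot_form eN c u f = mform C (fun k => coordf (slot eN u f (g k))).
Proof.
have [mu [h [g [hK gK tau_h]]]] := fibre_slots tau.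
exists mu, g => N eN.
have [c' [c1 c2 c3]] := reform (tag_part C tau) (Bijective hK gK).
pose J := {i : 'I_s & 'I_(mu i)}.
have c'0 (U : {ffun J -> W}) (p : J) : tag (U p) != tag p -> c' U = 0.
  move=> Up; have -> : U = [ffun p => [ffun k => U (g k)] (h p)].
    by apply/ffunP => p'; rewrite !ffunE hK.
  apply: c3; rewrite /tag_part; case: eqP => // /ffunP /(_ (h p)).
  by rewrite !ffunE hK tau_h => e; rewrite e eqxx in Up.
exists (fun r q => c' (slot_fun eN (r, q))); split.
  rewrite -c1 /sform /slot_sum (typed_sum eN) => [|U p /c'0 ->]; last by rewrite scale0r.
  apply: eq_bigr => r _.
  apply: eq_bigr => q _.
  have e : \prod_p svar K (slot_fun eN (r, q) p) = \prod_p svar K (slot_word eN r q p).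
    by apply: eq_bigr => p _; rewrite ffunE.
  exact (congr1 (fun z => c' (slot_fun eN (r, q)) *: z) e).
move=> u f hu hf.
transitivity (mform c' (fun p => coordf (slot eN u f p))).
  rewrite /mform (typed_sum eN) => [|U p /c'0 ->]; last by rewrite mul0r.
  apply: eq_bigr => r _; apply: eq_bigr => q _; congr (_ * _).
  by apply: eq_bigr => p _; rewrite ffunE.
have -> : (fun p => coordf (slot eN u f p)) =
    (fun p => coordf (slot eN u f (g (h p)))) :> (J -> W -> L).
  by apply/funext => p; rewrite hK.
rewrite (c2 (fun k => coordf (slot eN u f (g k)))) => [|k y]; last first.
  by apply: coordf_homog; exact: slot_even.
apply: eq_bigr => w _; rewrite /tag_part; case: eqP => // ne.
have [k wk] : exists k, tag (w k) <> tau k.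
  by apply/existsNP => e; apply: ne; apply/ffunP => k; rewrite ffunE.
rewrite mul0r (@prod_eq0 _ _ _ k) ?mulr0 //.
rewrite /coordf /slot /decomposable inj_sum_out ?sgnc0 //.
by rewrite -tau_h gK; exact/eqP.
Qed.

Definition is_decomposable (v : fmod K W) : Prop := exists i u f,
  [/\ forall k, fhomog false (u k), forall k, fhomog false (f k)
    & v = @decomposable K m n s b t i u f].

Lemma decomposable_homog v : is_decomposable v -> fhomog false v.
Proof. by case=> i [u [f [hu hf ->]]]; exact: decomposable_even. Qed.

Lemma slot_is_decomposable mu N eN u f p :
  (forall k, fhomog false (u k)) -> (forall k, fhomog false (f k)) ->
  is_decomposable (@slot K m n s b t mu N eN u f p).
Proof. by move=> hu hf; exists (tag p); do 2!eexists; split; [| |by []] => k;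
  [exact: hu|exact: hf]. Qed.

(** By [polarize], the slot forms of x are combinations of its values at sums of slots, which are
    decomposable; so all the coefficients of these forms vanish. *)
Lemma seval_separation (x : symalg K W) :
  (forall d (v : 'I_d -> fmod K W) (e : 'I_d -> nat), (forall k, is_decomposable (v k)) ->
     seval (\sum_k v k *+ e k) x = 0) -> x = 0.
Proof.
move=> x0; have [D [C [xE CE]]] := polarize x.
rewrite xE big1 // => d _; rewrite sform_tag_part big1 // => tau _.
have [mu [g h]] := tag_part_slots (C d) tau; have [c [-> cE]] := h _ erefl.
have c0 : forall r q, c r q = 0.
  apply: (@slot_form_eq0 K m n s b t mu _ erefl c) => u f hu _ hf; rewrite cE //.
  have [E [A [e ->]]] := CE d (ltn_ord d); last by move=> k; exact: slot_even.
  by rewrite big1 // => i _; rewrite x0 ?scaler0 // => k; exact: slot_is_decomposable.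
by apply: big1 => r _; apply: big1 => q _; rewrite c0 scale0r.
Qed.

Lemma Wact_sum (g : GL K m n) d (v : 'I_d -> fmod K W) (e : 'I_d -> nat) :
  Wact g (\sum_k v k *+ e k) = \sum_k Wact g (v k) *+ e k.
Proof.
have [gD _ _] := @Wact_even K m n s b t g;
  have g0 := even_endo0 (@Wact_even K m n s b t g).
rewrite (big_morph (Wact g) gD g0); apply: eq_bigr => k _.
by elim: (e k) => [|i IH]; rewrite ?mulr0n ?g0 // !mulrS gD IH.
Qed.

Lemma Wact_slot mu N eN (g : GL K m n) u f p :
  Wact g (@slot K m n s b t mu N eN u f p) =
  slot eN (fun k => g (u k)) (fun k => dmap (gl_V g) (f k)) p.
Proof. exact: Wact_decomposable. Qed.

(** Treats a picture as a form with independent lower and upper words, so that it can be compared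
    with a general form coefficient by coefficient. *)
Definition phi_coef (P : picture b t) (r q : {ffun 'I_(\sum_p pmul P p * b p)%N -> X})
  : L :=
  if r == [ffun k => q (pperm P k)] then
    gamma K (P := P) (fun k => gpar (q k)) * (-1) ^+ qexp (P := P) (fun k => gpar (q k))
  else 0.

Lemma phi_coef_sum (V : lmodType L) (P : picture b t)
    (F : {ffun 'I_(\sum_p pmul P p * b p)%N -> X} -> {ffun 'I_(\sum_p pmul P p * b p)%N
      -> X} -> V) :
  \sum_r \sum_q phi_coef r q *: F r q =
  \sum_(q : {ffun 'I_(\sum_p pmul P p * b p)%N -> X})
    (gamma K (P := P) (fun k => gpar (q k)) * (-1) ^+ qexp (P := P) (fun k => gpar (q k)))
      *: F [ffun k => q (pperm P k)] q.
Proof.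
rewrite exchange_big; apply: eq_bigr => q _ /=.
rewrite (bigD1 [ffun k => q (pperm P k)]) //= /phi_coef eqxx [X in _ + X]big1 ?addr0 //
  => r ne.
by rewrite (negPf ne) scale0r.
Qed.
End Components.

(** * Invariance of the pictures *)

Section Converse.
Variables (K : numFieldType) (m n s : nat) (b t : 'I_s -> nat).
Local Notation L := (grassmann K).
Local Notation X := (gV m n).
Local Notation W := (gW m n b t).

Lemma decomposable_slots mu N (eN : (\sum_p mu p * t p = N)%N)
    (w : {i : 'I_s & 'I_(mu i)} -> fmod K W) :
  (forall p, exists u f, [/\ forall k, fhomog false (u k), forall k, fhomog false (f k)
    & w p = @decomposable K m n s b t (tag p) u f]) ->
  exists u f, [/\ forall k, fhomog false (u k), forall k, fhomog false (f k)
    & forall p, w p = slot eN u f p].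
Proof.
move=> h; have [zb zbK zbK'] := zpos_bij mu b; have [zt ztK ztK'] := zpos_bij mu t.
pose u p := sval (cid (h p)); pose hu0 p := svalP (cid (h p)).
pose f p := sval (cid (hu0 p)).
have hu p : [/\ forall k, fhomog false (u p k), forall k, fhomog false (f p k)
    & w p = @decomposable K m n s b t (tag p) (u p) (f p)] := svalP (cid (hu0 p)).
exists (fun k => u (tag (zb k)) (tagged (zb k))).
exists (fun k => let z := zt (cast_ord (esym eN) k) in f (tag z) (tagged z)).
split=> [k|k|p] /=; [by case: (hu (tag (zb k)))|by case: (hu (tag (zt (cast_ord (esym
  eN) k))))|].
have [_ _ ->] := hu p; rewrite /slot; congr decomposable; apply/funext => k.
  have -> : pos (tagged p) k = zpos (Tagged (fun p => 'I_(b (tag p))) k) by [].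
  by rewrite zbK.
by rewrite up_zpos /= cast_ordK ztK.
Qed.

Section PhiInvariant.
Variable P : picture b t.
Local Notation J := {i : 'I_s & 'I_(pmul P i)}.
Local Notation N := (\sum_p pmul P p * b p)%N.

(** The multilinear version of the picture: on a constant family it is evaluation ([seval_phi]). *)
Definition phi_form (w : J -> fmod K W) : L :=
  \sum_(r : {ffun 'I_N -> X})
  (gamma K (P := P) (fun k => gpar (r k)) * (-1) ^+ qexp (P := P) (fun k => gpar (r k))) *
  \prod_p coordf (w p) (slot_word (pbal P) (fun k => r (pperm P k)) r p).

Lemma seval_phi (v : fmod K W) : fhomog false v -> seval v (phi K m n P) = phi_form
  (fun=> v).
Proof.
move=> hv; rewrite phiE seval_sum //; apply: eq_bigr => r _.
rewrite sevalZ // seval_prod //; congr (_ * _); apply: eq_bigr => p _.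
exact: seval_svar.
Qed.

Lemma phi_form0 w p : (forall r q, coordf (w p) (@slot_word m n s b t (pmul P) _ (pbal
  P) r q p) = 0) ->
  phi_form w = 0.
Proof. by move=> w0; rewrite /phi_form big1 // => r _;
  rewrite (@prod_eq0 _ _ _ p) ?mulr0. Qed.

(** If every vector lies in the summand of its slot, [phi_eval] gives a product of pairings,
    unchanged by g. If some vector is 0 or lies in another summand, both sides vanish, since the
    action preserves the summands. *)
Lemma phi_form_Wact (g : GL K m n) w : (forall p, w p = 0 \/ is_decomposable (w p)) ->
  phi_form (fun p => Wact g (w p)) = phi_form w.
Proof.
move=> dec.
have g0 : Wact g (0 : fmod K W) = 0 := even_endo0 (Wact_even b t g).
have [[p wp]|nz] := pselect (exists p, w p = 0).
  by rewrite !(@phi_form0 _ p) // => r q; rewrite ?wp ?g0 coordf0.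
have [[p [i [u [f [ip wp]]]]]|ty] := pselect (exists p i u f, i != tag p /\ w p =
  @decomposable K m n s b t i u f).
  rewrite !(@phi_form0 _ p) // => r q; rewrite wp ?Wact_decomposable.
    by rewrite /coordf inj_sum_out ?sgnc0 // eq_sym.
  by rewrite /coordf inj_sum_out ?sgnc0 // eq_sym.
have [|u [f [hu hf wE]]] := @decomposable_slots (pmul P) _ (pbal P) w.
  move=> p; case: (dec p) => [wp|[i [u [f [hu hf wp]]]]]; first by case: nz; exists p.
  have [e|ne] := eqVneq i (tag p); last by case: ty; exists p, i, u, f.
  by case: _ / e u f hu hf wp => u f hu hf wp; exists u, f.
have hgu k : fhomog false (g (u k)) by case: (gl_even g) => _ _; apply.
have hgf k : fhomog false (dmap (gl_V g) (f k)).
  by case: (even_endo_dmap (gl_even (gl_V g))) => _ _; apply.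
have e1 : (fun p => Wact g (w p)) =
    slot (pbal P) (fun k => g (u k)) (fun k => dmap (gl_V g) (f k)).
  by apply/funext => p; rewrite wE Wact_slot.
have e2 : w = slot (pbal P) u f by apply/funext.
rewrite e1 e2 /phi_form !phi_eval //; apply: eq_bigr => k _.
rewrite ev_dmap; last exact: gl_even.
by congr ev; exact: gl_funK.
Qed.

Lemma phi_form_sum d (v : 'I_d -> fmod K W) (e : 'I_d -> nat) :
  phi_form (fun=> \sum_k v k *+ e k) = \sum_(h : {ffun J -> option 'I_d})
    phi_form (fun p => if h p is Some k then v k else 0) *+ \prod_p weight e (h p).
Proof.
rewrite /phi_form; under [RHS]eq_bigr do rewrite -sumrMnl.
rewrite [RHS]exchange_big; apply: eq_bigr => r _ /=.
pose z p : W := slot_word (pbal P) (fun k => r (pperm P k)) r p.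
rewrite (eq_bigr (fun p => coordf (0 : fmod K W) (z p) + \sum_k coordf (v k) (z p) *+ e
  k)); last first.
  move=> p _; rewrite coordf0 add0r coordf_sum; apply: eq_bigr => k _; exact: coordfMn.
rewrite (prod_expand (fun p o => coordf (if o is Some k then v k else 0) (z p))).
by rewrite mulr_sumr; apply: eq_bigr => h _; rewrite mulrnAr.
Qed.

(** By [seval_separation] it suffices to compare values at sums of decomposables; [phi_form_sum]
    expands them into the cases of [phi_form_Wact]. *)
Lemma phi_invariant (g : GL K m n) : SWact g (phi K m n P) = phi K m n P.
Proof.
apply/subr0_eq/seval_separation => d v e dec.
have hv : fhomog false (\sum_k v k *+ e k).
  by apply: fhomog_sum => k _; apply: fhomogMn; exact: decomposable_homog.
have hgv : fhomog false (Wact (gl_V g) (\sum_k v k *+ e k)).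
  by case: (Wact_even b t (gl_V g)) => _ _; apply.
rewrite sevalD // -[- phi K m n P]scaleN1r sevalZ // mulN1r.
rewrite (seval_sact _ (Wact_even b t (gl_V g)) hv) !seval_phi //.
rewrite Wact_sum !phi_form_sum; apply/eqP; rewrite subr_eq0; apply/eqP.
apply: eq_bigr => h _; congr (_ *+ _).
rewrite -(phi_form_Wact (gl_V g) (w := fun p => if h p is Some k then v k else 0)).
  congr phi_form; apply/funext => p; case: (h p) => // .
  by rewrite (even_endo0 (Wact_even b t (gl_V g))).
by move=> p; case: (h p) => [k|]; [right; exact: dec|left].
Qed.

End PhiInvariant.
End Converse.

(** * Invariants lie in the span of the pictures *)

Section Forward.
Variables (K : numFieldType) (m n s : nat) (b t : 'I_s -> nat).
Local Notation L := (grassmann K).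
Local Notation X := (gV m n).
Local Notation W := (gW m n b t).

Definition in_span (x : symalg K W) : Prop :=
  exists l : seq (L * picture b t), x = \sum_(cP <- l) cP.1 *: phi K m n cP.2.

Lemma in_spanD x y : in_span x -> in_span y -> in_span (x + y).
Proof. by move=> [l ->] [l' ->]; exists (l ++ l'); rewrite big_cat. Qed.

Lemma in_span_sum (I : Type) (r : seq I) (F : I -> symalg K W) :
  (forall i, in_span (F i)) -> in_span (\sum_(i <- r) F i).
Proof.
move=> hF; apply: big_ind => //; last exact: in_spanD.
by exists [::]; rewrite big_nil.
Qed.

Lemma slot_form_phi mu (e : (\sum_p mu p * t p = \sum_p mu p * b p)%N) (sigma :
  'S_(\sum_p mu p * b p))
    (u f : 'I_(\sum_p mu p * b p) -> fmod K X) :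
  (forall k, fhomog false (u k)) -> (forall k, fhomog false (f k)) ->
  slot_form e (phi_coef K (m := m) (n := n) (P := Picture e sigma)) u f =
  \prod_k ev (f k) (u (sigma^-1 k))%g.
Proof.
move=> hu hf; rewrite -(@phi_eval K m n s b t (Picture e sigma) u f hu hf).
rewrite /slot_form.
rewrite (@phi_coef_sum K m n s b t L^o (Picture e sigma)).
apply: eq_bigr => q _ /=.
have -> : [ffun k => q (sigma k)] = (fun k => q (sigma k)) :> ('I_(\sum_p mu p * b p)
  -> X).
  by apply/funext => k; rewrite ffunE.
by [].
Qed.

Lemma slot_sum_phi mu (e : (\sum_p mu p * t p = \sum_p mu p * b p)%N)
    (sigma : 'S_(\sum_p mu p * b p)) :
  slot_sum e (phi_coef K (m := m) (n := n) (P := Picture e sigma)) =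
  phi K m n (Picture e sigma).
Proof.
rewrite phiE /slot_sum (@phi_coef_sum K m n s b t (symalg K W) (Picture e sigma)).
apply: eq_bigr => q _ /=.
have -> : [ffun k => q (sigma k)] = (fun k => q (sigma k)) :> ('I_(\sum_p mu p * b p)
  -> X).
  by apply/funext => k; rewrite ffunE.
by [].
Qed.

Lemma tactZ (Y : gset) (h : fmod K Y -> fmod K Y) a (y : talg K Y) :
  tact h (a *: y) = a *: tact h y.
Proof.
rewrite (tactEw h (msuppZ_le a y)) scaler_sumr; apply: eq_bigr => w _.
by rewrite mcoeffZ scalerA.
Qed.

Lemma SWactD (g : GL K m n) (x y : symalg K W) : SWact g (x + y) = SWact g x + SWact g y.
Proof.
have [p ->] := spi_surj x; have [q ->] := spi_surj y.
by rewrite -spiD !SWactE tactD spiD.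
Qed.

Lemma SWactZ (g : GL K m n) a (x : symalg K W) : SWact g (a *: x) = a *: SWact g x.
Proof. by have [p ->] := spi_surj x; rewrite -spiZ !SWactE tactZ spiZ. Qed.

Lemma invariant_in_span (x : symalg K W) :
  (forall g : GL K m n, SWact g x = x) -> in_span x.
Proof.
move=> xinv; have [D [C [xE CE]]] := polarize x.
rewrite xE; apply: in_span_sum => d; rewrite sform_tag_part; apply: in_span_sum => tau.
have [mu [g h]] := tag_part_slots (C d) tau.
(* The slot forms of an invariant are invariant: polarization expresses them by values of x, and the
   value at g v is the value at v of x moved by the inverse of g. *)
have inv N (eN : (\sum_p mu p * t p = N)%N) c :
    (forall u f, (forall k, fhomog false (u k)) -> (forall k, fhomog false (f k)) ->
      slot_form eN c u f = mform (C d) (fun k => coordf (slot eN u f (g k)))) ->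
    exists e : {ffun 'I_(\sum_p mu p * b p) -> X} -> {ffun 'I_N -> X} -> nat,
      (forall u f, (forall k, fhomog false (u k)) -> (forall k, fhomog false (f k)) ->
        slot_form eN c u f = bform (fun r q => c r q * (-1) ^+ e r q) u f) /\
      invariant_form (fun r q => c r q * (-1) ^+ e r q).
  move=> cE; have [e eE] := slot_formE K m n b eN; exists e; split=> [u f hu hf|];
    first exact: eE.
  move=> ga u f hu hf.
  have hgu k : fhomog false (ga (u k)) by case: (gl_even ga) => _ _; apply.
  have hgf k : fhomog false (dmap (gl_V ga) (f k)).
    by case: (even_endo_dmap (gl_even (gl_V ga))) => _ _; apply.
  rewrite -(eE c (fun k => ga (u k)) (fun k => dmap (gl_V ga) (f k))) // -eE // !cE //.
  have [E [A [n0 ex]]] := CE d (ltn_ord d).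
  rewrite !ex; [|by move=> k; exact: slot_even|by move=> k; exact: slot_even].
  apply: eq_bigr => i _; congr (_ *: _).
  have hv : fhomog false (\sum_k slot eN u f (g k) *+ n0 i k).
    by apply: fhomog_sum => k _; apply: fhomogMn; exact: slot_even.
  rewrite -{2}(xinv (gl_V ga)) seval_SWact // Wact_sum.
  by congr seval; apply: eq_bigr => k _; rewrite Wact_slot.
have [e|ne] := eqVneq (\sum_p mu p * t p)%N (\sum_p mu p * b p)%N; last first.
  have [c [cS cE]] := h _ erefl; have [e [eE einv]] := inv _ _ _ cE.
  exists [::]; rewrite big_nil cS /slot_sum big1 // => r _; rewrite big1 // => q _.
  have := invariant_form_unbalanced einv; rewrite !card_ord eq_sym => /(_ ne r q).
  move=> /(congr1 (fun z => z * (-1) ^+ e r q)).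
  rewrite mul0r -mulrA -exprD addnn -signr_odd odd_double mulr1 => ->.
  by rewrite scale0r.
have [c [cS cE]] := h _ e; have [e' [eE einv]] := inv _ _ _ cE.
have [Cs CsE] := invariant_form_span einv.
(* The inverse compensates for the inverse permutation in [phi_eval]. *)
pose P (z : 'S__) := Picture e z^-1%g.
(* Both sides have the same slot form, hence the same coefficients. *)
have cC r q : c r q = \sum_z Cs z * phi_coef K (m := m) (n := n) (P := P z) r q.
  apply/subr0_eq.
  apply: (@slot_form_eq0 K m n s b t mu _ e
    (fun r q => c r q - \sum_z Cs z * phi_coef K (m := m) (n := n) (P := P z) r q)) =>
      u f hu su hf.
  transitivity (slot_form e c u f - \sum_z Cs z * slot_form e (phi_coef K (m := m) (n
    := n) (P := P z)) u f).
    rewrite /slot_form; under [X in _ = _ - X]eq_bigr do rewrite mulr_sumr.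
    rewrite [X in _ = _ - X]exchange_big -sumrB; apply: eq_bigr => r' _.
    under [X in _ = _ - X]eq_bigr do rewrite mulr_sumr.
    rewrite [X in _ = _ - X]exchange_big -sumrB; apply: eq_bigr => q' _.
    rewrite mulrBl mulr_suml; congr (_ - _); apply: eq_bigr => z _.
    by rewrite mulrA.
  rewrite eE // CsE //; apply/eqP; rewrite subr_eq0; apply/eqP; apply: eq_bigr => z _.
  by rewrite slot_form_phi // invgK.
exists [seq (Cs z, P z) | z <- index_enum _]; rewrite cS big_map.
transitivity (\sum_z Cs z *: slot_sum e (phi_coef K (m := m) (n := n) (P := P z))).
  rewrite /slot_sum; under [RHS]eq_bigr do rewrite scaler_sumr.
  rewrite [RHS]exchange_big; apply: eq_bigr => r _.
  under [RHS]eq_bigr do rewrite scaler_sumr.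
  rewrite [RHS]exchange_big; apply: eq_bigr => q _ /=.
  by rewrite cC scaler_suml; apply: eq_bigr => z _; rewrite scalerA.
by apply: eq_bigr => z _; rewrite slot_sum_phi.
Qed.

End Forward.

Theorem theorem4p1 (R : realType) (m n s : nat) (t b : 'I_s -> nat)
    (x : symalg R[i] (gW m n b t)) :
  (forall g : GL R[i] m n, SWact g x = x) <->
  exists (k : nat) (c : 'I_k -> grassmann R[i]) (P : 'I_k -> picture b t),
    x = \sum_(j < k) c j *: phi R[i] m n (P j).
Proof.
split=> [/(@invariant_in_span R[i])[l ->]|[k [c [P ->]]] g].
  exists (size l), (fun j => (tnth (in_tuple l) j).1), (fun j => (tnth (in_tuple l) j).2).
  by rewrite big_tnth.
have g0 : SWact g (0 : symalg R[i] (gW m n b t)) = 0.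
  by apply: (addrI (SWact g 0)); rewrite -SWactD !addr0.
rewrite (big_morph (SWact g) (SWactD g) g0); apply: eq_bigr => j _.
by rewrite SWactZ phi_invariant.
Qed.
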